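(* Let $W$ be the Weyl group of type $D_{n+2}$ with simple reflections $0^+,0^-,1,\dots,n$, and let $1\leq i\leq j\leq n$. The set ${}_i\mathbf{JI}_j$ consists of the following three types of elements: (type $O_A$) for $1\leq k\leq\min\{i,n+1-j\}$: $d_{\circ,k}=\phi(b_{\circ,k}^{ij})=\phi^+(b_{\circ,k}^{ij})=\phi^-(b_{\circ,k}^{ij})$; (type $O_B$) for $i<k\leq n+1-j$: $d_{+,k}=\phi^+(b_{\circ,k}^{ij})$ and $d_{-,k}=\phi^-(b_{\circ,k}^{ij})$; (type $X$) for $1\leq k\leq n+1-j$: $d_{\times,k}=\phi(b_{\times,k}^{ij})$. Moreover, the partial order on ${}_i\mathbf{JI}_j$ is generated by the following relations: \begin{align*} d_{\circ,k}&<d_{\circ,k+1}, && 1\leq k\leq\min\{i-1,n-j\},\\ d_{\circ,i}&<d_{\pm,i+1}, && \text{if } i\leq n-j,\\ d_{\pm,k}&<d_{\pm,k+1},\quad d_{\pm,k}<d_{\mp,k+1}, && i<k\leq n-j,\\ d_{\times,k}&<d_{\times,k+1}, && 1\leq k\leq n-j,\\ d_{\circ,k}&<d_{\times,k}, && 1\leq k\leq\min\{i,n+1-j\},\\ d_{\pm,k}&<d_{\times,k}, && i<k\leq n+1-j,\\ d_{\times,k}&<d_{\pm,k+i+1}, && 1\leq k\leq n-j-i. \end{align*} (Relations with $\pm$ hold for both choices of sign, $\mp$ being the opposite sign.)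
   Context: Type $D_{n+2}$ (with $n\geq2$): the Coxeter diagram is simply laced with nodes $0^+,0^-,1,\dots,n$; edges $m-(m+1)$ for $1\leq m<n$, and $0^+-1$, $0^--1$. $\leq$ is the Bruhat order on $W$. An element $w\in W$ is join-irreducible if there is no $U\subseteq W$ with $w=\bigvee U$ (supremum in $(W,\leq)$, $\bigvee\varnothing=e$) and $w\notin U$. Every join-irreducible element has exactly one left descent and one right descent; ${}_i\mathbf{JI}_j$ is the set of join-irreducible elements with left descent $i$ and right descent $j$, ordered by the Bruhat order. ''Generated by'' means that the partial order is the reflexive-transitive closure of the listed relations. The elements $b^{ij}_{\circ,k},b^{ij}_{\times,k}$ belong to the Weyl group of type $B_{n+1}$ (simple reflections $0,1,\dots,n$ along the path $0-1-\cdots-n$, double edge between $0$ and $1$). With $s_{ab}=a\cdots b$ the word along the shortest path from $a$ to $b$ in $0-1-\cdots-n$ and $t_{ab}=a(a-1)\cdots1\,0\,1\cdots(b-1)b$ ($a,b\geq1$), they are given by the reduced words $$b^{ij}_{\circ,k}=s_{i,i-k+1}\cdot s_{i+1,i-k+2}\cdots s_{k+j-1,j}\quad(1\leq k\leq\min\{i,n+1-j\}),$$ $$b^{ij}_{\circ,k}=s_{i,0}\cdot s_{i+1,0}\cdots s_{k-1,0}\cdot s_{k,1}\cdot s_{k+1,2}\cdots s_{k+j-1,j}\quad(i<k\leq n+1-j),$$ $$b^{ij}_{\times,k}=t_{i,i}\cdot t_{i+1,i}\cdots t_{i+k-1,i}\cdot s_{i+k,i+1}\cdots s_{j+k-1,j}\quad(1\leq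 k\leq n+1-j;\text{ only the }t\text{-factors if }i=j).$$ The group homomorphism $\phi$ from the type $B_{n+1}$ Weyl group to $W$ is given by $0\mapsto0^+0^-=0^-0^+$ and $m\mapsto m$ for $1\leq m\leq n$. The maps $\phi^{\pm}$ (defined on join-irreducible elements of type $B_{n+1}$) take a reduced word, replace the occurrences of $0$ alternatingly by $0^+$ and $0^-$, the leftmost occurrence being replaced by $0^+$ for $\phi^+$ and by $0^-$ for $\phi^-$, keep the other letters, and return the corresponding element of $W$; the result does not depend on the reduced word. *)

(* Defs.v *)
From HB Require Import structures.
From Stdlib Require Import Relation_Operators.
From mathcomp Require Import all_boot generic_quotient.
From mathcomp Require Import boolp classical_sets.

Set Implicit Arguments.
Unset Strict Implicit.
Unset Printing Implicit Defensive.

Local Open Scope quotient_scope.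
Local Open Scope classical_set_scope.

(* A Coxeter matrix is a function m : S -> S -> nat, with 0 for infinity. Its *)
(* diagonal values are never used: the relations s s = 1 are a separate       *)
(* constructor below.                                                         *)
Section CoxeterGroup.

Variables (S : finType) (m : S -> S -> nat).
Implicit Types (u v : seq S) (s t : S).

Inductive coxeter_step : seq S -> seq S -> Prop :=
| Involution u s v : coxeter_step (u ++ [:: s; s] ++ v) (u ++ v)
| Braid u s t v :
    s != t -> coxeter_step (u ++ flatten (nseq (m s t) [:: s; t]) ++ v) (u ++ v).

Definition coxeter_eq : seq S -> seq S -> Prop :=
  clos_refl_sym_trans _ coxeter_step.

Definition coxeter_eqb : rel (seq S) := fun u v => `[< coxeter_eq u v >].

Lemma coxeter_eqb_equiv : equiv_class_of coxeter_eqb.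
Proof.
split=> [u|u v|v u w].
- by apply/asboolP; exact: rst_refl.
- by apply/asboolP/asboolP; exact: rst_sym.
- by move=> /asboolP uv /asboolP vw; apply/asboolP; exact: rst_trans uv vw.
Qed.

Canonical coxeter_eqb_equiv_rel := EquivRelPack coxeter_eqb_equiv.

Definition coxeter_group := {eq_quot coxeter_eqb}.

HB.instance Definition _ : EqQuotient _ coxeter_eqb coxeter_group :=
  EqQuotient.on coxeter_group.
HB.instance Definition _ := Choice.on coxeter_group.

Definition cox_ev u : coxeter_group := \pi u.

Lemma cox_evP u v : cox_ev u = cox_ev v <-> coxeter_eq u v.
Proof. by split=> [/eqmodP /asboolP|uv] //; apply/eqmodP/asboolP. Qed.

Lemma coxeter_eq_cat u1 u2 v1 v2 :
  coxeter_eq u1 u2 -> coxeter_eq v1 v2 -> coxeter_eq (u1 ++ v1) (u2 ++ v2).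
Proof.
move=> uu vv; apply: (rst_trans _ _ _ (u2 ++ v1)).
- elim: uu => [x y [u s v|u s t v st]|x|x y _|x y z _ xy _ yz].
  + by rewrite -!catA; apply: rst_step; exact: (Involution u s (v ++ v1)).
  + by rewrite -!catA; apply: rst_step; exact: Braid.
  + exact: rst_refl.
  + exact: rst_sym.
  + exact: rst_trans xy yz.
- elim: vv => [x y [u s v|u s t v st]|x|x y _|x y z _ xy _ yz].
  + by rewrite !(catA u2 u); apply: rst_step; exact: Involution.
  + by rewrite !(catA u2 u); apply: rst_step; exact: Braid.
  + exact: rst_refl.
  + exact: rst_sym.
  + exact: rst_trans xy yz.
Qed.

Lemma cox_ev_repr (w : coxeter_group) : cox_ev (repr w) = w.
Proof. exact: reprK. Qed.

Lemma repr_cox_ev u : coxeter_eq (repr (cox_ev u)) u.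
Proof. by apply/cox_evP; rewrite cox_ev_repr. Qed.

Definition cox_mul (x y : coxeter_group) := cox_ev (repr x ++ repr y).
Definition cox_inv (x : coxeter_group) := cox_ev (rev (repr x)).

Lemma cox_mul_ev u v : cox_mul (cox_ev u) (cox_ev v) = cox_ev (u ++ v).
Proof. by apply/cox_evP/coxeter_eq_cat; exact: repr_cox_ev. Qed.

Lemma cox_mulA : associative cox_mul.
Proof.
move=> x y z; rewrite -[x]cox_ev_repr -[y]cox_ev_repr -[z]cox_ev_repr.
by rewrite !cox_mul_ev catA.
Qed.

Lemma cox_mul1 : left_id (cox_ev [::]) cox_mul.
Proof. by move=> x; rewrite -[x]cox_ev_repr cox_mul_ev. Qed.

Lemma cox_mulr1 : right_id (cox_ev [::]) cox_mul.
Proof. by move=> x; rewrite -[x]cox_ev_repr cox_mul_ev cats0. Qed.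

Lemma coxeter_eq_catV u : coxeter_eq (u ++ rev u) [::].
Proof.
elim/last_ind: u => [|u s IHu]; first exact: rst_refl.
rewrite rev_rcons -cats1 -catA.
apply: rst_trans IHu; apply: rst_step; exact: (Involution u s (rev u)).
Qed.

Lemma cox_mulV : right_inverse (cox_ev [::]) cox_inv cox_mul.
Proof.
move=> x; rewrite /cox_inv -[x in cox_mul x]cox_ev_repr cox_mul_ev.
by apply/cox_evP; exact: coxeter_eq_catV.
Qed.

Lemma cox_mulVl : left_inverse (cox_ev [::]) cox_inv cox_mul.
Proof.
move=> x; rewrite /cox_inv -[x in cox_mul _ x]cox_ev_repr cox_mul_ev.
by apply/cox_evP; rewrite -[X in _ ++ X]revK; exact: coxeter_eq_catV.
Qed.

HB.instance Definition _ :=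
  isGroup.Build coxeter_group cox_mulA cox_mul1 cox_mulr1 cox_mulVl cox_mulV.

End CoxeterGroup.

Section Bruhat.

Local Open Scope group_scope.

Variables (S : finType) (m : S -> S -> nat).
Local Notation W := (coxeter_group m).
Implicit Types (w x y : W) (u v : seq S) (s : S).

Definition cox_gen s : W := cox_ev m [:: s].

Lemma cox_ev_cons s u : cox_ev m (s :: u) = cox_gen s * cox_ev m u.
Proof. by rewrite [RHS](cox_mul_ev m [:: s] u). Qed.

Lemma cox_ev_cat u v : cox_ev m (u ++ v) = cox_ev m u * cox_ev m v.
Proof. by rewrite [RHS](cox_mul_ev m u v). Qed.

Lemma has_word w : exists k, `[< exists2 u, size u = k & cox_ev m u = w >].
Proof.
by exists (size (repr w)); apply/asboolP; exists (repr w); rewrite ?cox_ev_repr.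
Qed.

Definition cox_length w : nat := ex_minn (has_word w).

Definition reduced u : bool := size u == cox_length (cox_ev m u).

Lemma cox_length_word w :
  exists2 u, size u = cox_length w & cox_ev m u = w.
Proof. by rewrite /cox_length; case: ex_minnP => k /asboolP. Qed.

Lemma exists_reduced w : exists u, reduced u /\ cox_ev m u = w.
Proof.
by have [u uk uw] := cox_length_word w; exists u; rewrite /reduced uw uk.
Qed.

Definition reduced_word w : seq S := projT1 (cid (exists_reduced w)).

Definition is_reflection w : Prop := exists x s, w = x * cox_gen s * x^-1.

Definition bruhat_step x y : Prop :=
  exists t, [/\ is_reflection t, y = x * t & (cox_length x < cox_length y)%N].

Definition bruhat : W -> W -> Prop := clos_refl_trans _ bruhat_step.

Definition bruhat_sup (U : set W) w : Prop :=
  (forall x, U x -> bruhat x w) /\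
  (forall y, (forall x, U x -> bruhat x y) -> bruhat w y).

Definition join_irreducible w : Prop :=
  ~ exists U : set W, bruhat_sup U w /\ ~ U w.

Definition left_descent s w : bool :=
  (cox_length (cox_gen s * w)%g < cox_length w)%N.
Definition right_descent s w : bool :=
  (cox_length (w * cox_gen s)%g < cox_length w)%N.

Definition JI s t : set W :=
  [set w | [/\ join_irreducible w, left_descent s w & right_descent t w]].

End Bruhat.

Definition adjacent (a b : nat) : bool := (a == b.+1) || (b == a.+1).

Definition coxB n (a b : 'I_n.+1) : nat :=
  if a == b then 1
  else if adjacent a b then (if minn a b == 0 then 4 else 3)
  else 2.

Lemma coxBC n (a b : 'I_n.+1) : coxB a b = coxB b a.
Proof. by rewrite /coxB /adjacent eq_sym orbC minnC. Qed.

(* inl true and inl false are the nodes 0^+ and 0^-, and inr k is the node    *)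
(* k + 1.                                                                     *)
Definition nodeD n : finType := (bool + 'I_n)%type.

Definition coxD n (a b : nodeD n) : nat :=
  match a, b with
  | inl e, inl e' => if e == e' then 1 else 2
  | inl _, inr k | inr k, inl _ => if k == 0 :> nat then 3 else 2
  | inr k, inr l => if k == l then 1 else if adjacent k l then 3 else 2
  end.

Notation WB n := (coxeter_group (@coxB n)).
Notation WD n := (coxeter_group (@coxD n)).

Definition toD n (e : bool) (a : 'I_n.+1) : nodeD n :=
  if unlift ord0 a is Some k then inr k else inl e.

(* The node m of type D, for 1 <= m <= n; the sign passed to toD is then      *)
(* irrelevant.                                                                *)
Definition midD n (m : nat) : nodeD n := toD true (inord m).

Definition phi_letter n (a : 'I_n.+1) : seq (nodeD n) :=
  if a == ord0 then [:: inl true; inl false] else [:: toD true a].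

Definition phi_word n (u : seq 'I_n.+1) : seq (nodeD n) :=
  flatten [seq phi_letter a | a <- u].

(* The word chosen by repr is irrelevant: phiM, phi_gen0 and phi_gen_lift     *)
(* below show that phi is the group morphism with the prescribed values.      *)
Definition phi n (w : WB n) : WD n := cox_ev _ (phi_word (repr w)).

Section InvolutionIdentities.

Local Open Scope group_scope.

Variables (G : groupType) (p q r : G).
Hypotheses (pp : p * p = 1) (qq : q * q = 1) (rr : r * r = 1).
Hypothesis pq : p * q = q * p.

Let pK x : p * (p * x) = x. Proof. by rewrite mulgA pp mul1g. Qed.
Let qK x : q * (q * x) = x. Proof. by rewrite mulgA qq mul1g. Qed.
Let rK x : r * (r * x) = x. Proof. by rewrite mulgA rr mul1g. Qed.
Let pqx x : p * (q * x) = q * (p * x). Proof. by rewrite !mulgA pq. Qed.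

Lemma expg2_pqr : p * r = r * p -> q * r = r * q -> (p * q * r) ^+ 2 = 1.
Proof.
move=> pr qr; rewrite expgS expg1 -!mulgA [r * _]mulgA -pr -mulgA.
by rewrite [r * _]mulgA -qr -mulgA rr mulg1 pqx pK qq.
Qed.

Lemma expg4_pqr :
  p * (r * p) = r * (p * r) -> q * (r * q) = r * (q * r) ->
  (p * q * r) ^+ 4 = 1.
Proof.
move=> pr qr.
have prx x : p * (r * (p * x)) = r * (p * (r * x)).
  by rewrite !mulgA -[p * r * p]mulgA pr !mulgA.
have qrx x : q * (r * (q * x)) = r * (q * (r * x)).
  by rewrite !mulgA -[q * r * q]mulgA qr !mulgA.
have E x : p * (q * (r * (p * (q * (r * x))))) = q * (r * (p * (q * (r * (q * x))))).
  by rewrite pqx prx -qrx.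
rewrite !expgS expg0 -!mulgA !E qK rK [p * (q * (p * _))]pqx pK qK rK.
by rewrite mulg1 qq.
Qed.

End InvolutionIdentities.

Section PhiMorphism.

Local Open Scope group_scope.

Variable n : nat.
Implicit Types (u v : seq 'I_n.+1) (a b : 'I_n.+1).

Let ev u : WD n := cox_ev _ (phi_word u).
Let g (x : nodeD n) : WD n := cox_gen _ x.

Let gg x : g x * g x = 1.
Proof.
by rewrite /g -!cox_ev_cons; apply/cox_evP/rst_step/(Involution _ [::] x [::]).
Qed.

Let ggK x y : g x * (g x * y) = y.
Proof. by rewrite mulgA gg mul1g. Qed.

Let gE x y : x != y -> (g x * g y) ^+ coxD x y = 1.
Proof.
move=> xy; have -> k : (g x * g y) ^+ k = cox_ev _ (flatten (nseq k [:: x; y])).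
  elim: k => [|k IHk]; first by rewrite expg0.
  by rewrite expgS IHk /= !cox_ev_cons mulgA.
by apply/cox_evP/rst_step; have := Braid (@coxD n) [::] [::] xy; rewrite cats0.
Qed.

Let ev_cat u v : ev (u ++ v) = ev u * ev v.
Proof. by rewrite /ev /phi_word map_cat flatten_cat cox_ev_cat. Qed.

Let ev0 : ev [:: ord0] = g (inl true) * g (inl false).
Proof. by rewrite /ev /phi_word /g -cox_ev_cons. Qed.

Let ev_lift (k : 'I_n) : ev [:: lift ord0 k] = g (inr k).
Proof. by rewrite /ev /phi_word /= /phi_letter /toD liftK. Qed.

Let ev_nseq k u : ev (flatten (nseq k u)) = ev u ^+ k.
Proof.
elim: k => [|k IHk]; first by rewrite expg0.
by rewrite /= ev_cat IHk expgS.
Qed.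

Let comm_g x y : x != y -> coxD x y = 2 -> g x * g y = g y * g x.
Proof.
move=> /gE + xy2; rewrite xy2 expgS expg1 -!mulgA => e.
by rewrite -[RHS]mul1g -e -!mulgA ggK gg mulg1.
Qed.

Let step_phi u v : coxeter_step (@coxB n) u v -> ev u = ev v.
Proof.
have pm : g (inl true) * g (inl false) = g (inl false) * g (inl true).
  exact: comm_g.
have sq a : ev [:: a; a] = 1.
  rewrite (ev_cat [:: a] [:: a]); case: (unliftP ord0 a) => [k|] ->.
    by rewrite ev_lift gg.
  by rewrite ev0 {1}pm -mulgA ggK gg.
suff br a b : a != b -> ev [:: a; b] ^+ coxB a b = 1.
  case=> [x a y|x a b y ab]; rewrite !ev_cat.
  - by rewrite sq mul1g.
  - by rewrite ev_nseq br // mul1g.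
have flip c e k : (c * e : WD n) ^+ k = 1 -> (e * c) ^+ k = 1.
  move=> h; apply: (mulgI c); rewrite mulg1 -[RHS]mul1g -h.
  elim: k {h} => [|k IHk]; first by rewrite !expg0 mulg1 mul1g.
  by rewrite !expgS 2!mulgA -mulgA IHk !mulgA.
have br0 (k : 'I_n) : ev [:: ord0; lift ord0 k] ^+ coxB ord0 (lift ord0 k) = 1.
  rewrite (ev_cat [:: _] [:: _]) ev0 ev_lift.
  have pk e : (g (inl e) * g (inr k)) ^+ (if k == 0 :> nat then 3 else 2) = 1.
    exact: gE.
  rewrite /coxB /adjacent /= eqSS; case: ifP pk => [k0|k0] pk; last first.
    by apply: expg2_pqr; rewrite ?gg //; apply: comm_g => //=; rewrite k0.
  have prp e : g (inl e) * (g (inr k) * g (inl e))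
               = g (inr k) * (g (inl e) * g (inr k)).
    have := pk e; rewrite !expgS expg0 mulg1 -!mulgA => h.
    by rewrite -[RHS]mul1g -h -!mulgA !ggK gg mulg1.
  by apply: expg4_pqr; rewrite ?gg.
move=> ab; case: (unliftP ord0 a) ab => [k|] ->; case: (unliftP ord0 b) => [l|] ->.
- rewrite (inj_eq lift_inj) => kl; rewrite (ev_cat [:: _] [:: _]) !ev_lift.
  have := @gE (inr k) (inr l); rewrite /coxB /adjacent (inj_eq lift_inj) /=.
  rewrite (negPf kl) /= !eqSS.
  rewrite /bump /= !add1n minnSS; apply.
  by apply: contraNneq kl => -[->].
- rewrite (ev_cat [:: _] [:: _]) => _; apply: flip.
  by rewrite -ev_cat coxBC; exact: br0.
- by move=> _; exact: br0.
- by rewrite eqxx.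
Qed.

Lemma phi_cox_ev u : phi (cox_ev (@coxB n) u) = cox_ev _ (phi_word u).
Proof.
suff eq_phi x y : coxeter_eq (@coxB n) x y -> ev x = ev y.
  exact: eq_phi (repr_cox_ev _ u).
by elim=> // ? ? ? _ + _; exact: etrans.
Qed.

Lemma phiM : {morph @phi n : x y / x * y}.
Proof.
move=> x y; rewrite -[x]cox_ev_repr -[y]cox_ev_repr -cox_ev_cat !phi_cox_ev.
exact: ev_cat.
Qed.

Lemma phi_gen0 :
  phi (cox_gen (@coxB n) ord0) = cox_gen _ (inl true) * cox_gen _ (inl false).
Proof. by rewrite phi_cox_ev; exact: ev0. Qed.

Lemma phi_gen_lift (k : 'I_n) :
  phi (cox_gen (@coxB n) (lift ord0 k)) = cox_gen _ (inr k).
Proof. by rewrite phi_cox_ev; exact: ev_lift. Qed.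

End PhiMorphism.

(* e is the sign given to the leftmost letter 0 of u. *)
Fixpoint alternate n (e : bool) (u : seq 'I_n.+1) : seq (nodeD n) :=
  if u is a :: u' then
    toD e a :: alternate (if a == ord0 then ~~ e else e) u'
  else [::].

(* phi_pm true is phi^+ and phi_pm false is phi^-. *)
Definition phi_pm n (e : bool) (w : WB n) : WD n :=
  cox_ev _ (alternate e (reduced_word w)).

(* Words in type B are written with letters in nat, and sent to 'I_n.+1 by    *)
(* evB.                                                                       *)
Definition s_word (a b : nat) : seq nat :=
  if b <= a then rev (iota b (a - b).+1) else iota a (b - a).+1.

Definition t_word (a b : nat) : seq nat := rev (iota 0 a.+1) ++ iota 1 b.

(* The two branches are the two families of reduced words for b_o; the r-th   *)
(* factor of each product is given by r counted from 0.                       *)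
Definition bo_word (i j k : nat) : seq nat :=
  if k <= i then
    flatten [seq s_word (i + r) (i - k + 1 + r) | r <- iota 0 (k + j - i)]
  else
    flatten [seq s_word (i + r) 0 | r <- iota 0 (k - i)] ++
    flatten [seq s_word (k + r) (r + 1) | r <- iota 0 j].

Definition bx_word (i j k : nat) : seq nat :=
  flatten [seq t_word (i + r) i | r <- iota 0 k] ++
  flatten [seq s_word (i + k + r) (i + 1 + r) | r <- iota 0 (j - i)].

Definition evB n (u : seq nat) : WB n := cox_ev _ [seq inord a | a <- u].

Definition bo n i j k : WB n := evB n (bo_word i j k).
Definition bx n i j k : WB n := evB n (bx_word i j k).

(* Labels of the elements d_{o,k}, d_{+,k} and d_{-,k} (the sign being a      *)
(* boolean, true for +), and d_{x,k}.                                         *)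
Inductive label := TypeOA of nat | TypeOB of bool & nat | TypeX of nat.

Definition valid_label (n i j : nat) (l : label) : bool :=
  match l with
  | TypeOA k => 1 <= k <= minn i (n.+1 - j)
  | TypeOB _ k => i < k <= n.+1 - j
  | TypeX k => 1 <= k <= n.+1 - j
  end.

Definition d_elt n i j (l : label) : WD n :=
  match l with
  | TypeOA k => phi (bo n i j k)
  | TypeOB e k => phi_pm e (bo n i j k)
  | TypeX k => phi (bx n i j k)
  end.

Inductive generating (n i j : nat) : label -> label -> Prop :=
| Gen_OA_OA k : 1 <= k <= minn (i - 1) (n - j) ->
    generating n i j (TypeOA k) (TypeOA k.+1)
| Gen_OA_OB e : i <= n - j ->
    generating n i j (TypeOA i) (TypeOB e i.+1)
| Gen_OB_OB e e' k : i < k <= n - j ->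
    generating n i j (TypeOB e k) (TypeOB e' k.+1)
| Gen_X_X k : 1 <= k <= n - j ->
    generating n i j (TypeX k) (TypeX k.+1)
| Gen_OA_X k : 1 <= k <= minn i (n.+1 - j) ->
    generating n i j (TypeOA k) (TypeX k)
| Gen_OB_X e k : i < k <= n.+1 - j ->
    generating n i j (TypeOB e k) (TypeX k)
| Gen_X_OB e k : 1 <= k <= n - j - i ->
    generating n i j (TypeX k) (TypeOB e (k + i).+1).

(* Main.v *)
Require Import Defs.
From Stdlib Require Import Relation_Operators Operators_Properties ZArith.
From mathcomp Require Import all_boot generic_quotient.
From mathcomp Require Import boolp classical_sets.
From mathcomp Require Import zify ssrZ.

Set Implicit Arguments.
Unset Strict Implicit.
Unset Printing Implicit Defensive.

(** Let N = n + 2. The group W of type D acts by odd bijections on the nonzero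
    integers of absolute value at most N: 0^+ exchanges 1 and 2, 0^- exchanges
    -1 and 2, and m exchanges m + 1 and m + 2. A generator exchanging p < q is
    a right descent of w exactly when w p > w q (act_asc), so the action is
    faithful and the Bruhat order can be studied on signed permutations.

    Two general facts reduce the problem to double cosets. By Deodhar's
    criterion (dominated_bruhat), every element is the supremum of its minimal
    coset representatives modulo the maximal parabolic subgroups; therefore a
    join-irreducible element has a unique descent on each side. Let P be the
    set of minimal representatives of the double cosets of W by the parabolic
    subgroups that omit i on the left and j on the right. By the lifting
    property, the elements of P below y are those below the representative of
    the double coset of y (double_min_ex). Since each double coset also has a
    maximal representative, an element of P is join-irreducible in W as soon
    as it is so in P (dmin_witness).

    An element of P is increasing on the body 2, ..., j + 1 and on the tail
    j + 2, ..., N, and so is its inverse with i for j. Such a signed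
    permutation is determined by the number b of its tail values below
    - (i + 1), the number m of its tail values at most i + 1, and, when
    m = b + i + 1, the sign of its value at 1 (dmin_normal_form, dmin_eq). The
    numbers b and m are ranks, which grow along the Bruhat order (rank_bruhat);
    conversely, explicit reflections increase b or m by one (dmin_negate,
    dmin_raise). Hence z <= z' in P if and only if b <= b' and m <= m', unless
    z and z' differ by the sign only (dmin_bruhat). In this poset an element
    with 0 < b < m < b + i + 1 is the supremum of (b, b) and of (0, m), or of
    (b, b) and the two elements (m - i - 1, m) if m > i; every other element
    but the identity is join-irreducible (join_irreducible_parameters,
    dmin_join_irreducible).

    It remains to match the elements of the statement with these parameters:
    (0, k) for type O_A, (k - i - 1, k) with either sign for type O_B, and
    (k, k) for type X (label_dmin). This is a computation of the signed
    permutations of the given words, except that phi^+ and phi^- refer to an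
    arbitrary reduced word; their values are found by following the letters 0
    of such a word from right to left (alternate_form). On the parameters, the
    listed relations generate the order (label_le_generating). *)

(** * Length and reflections in a Coxeter group *)

Section CoxeterTheory.

Local Open Scope group_scope.

Variables (S : finType) (m : S -> S -> nat).
Local Notation W := (coxeter_group m).
Local Notation g := (cox_gen m).
Local Notation ev := (cox_ev m).
Local Notation l := (@cox_length S m).
Implicit Types (w x y z t : W) (u v : seq S) (s : S).

Lemma gen_sq s : g s * g s = 1.
Proof.
by rewrite /cox_gen -!cox_ev_cons; apply/cox_evP/rst_step/(Involution _ [::] s [::]).
Qed.

Lemma gen_inv s : (g s)^-1 = g s.
Proof. by apply: (mulgI (g s)); rewrite mulgV gen_sq. Qed.

Lemma gen_mulK s x : g s * (g s * x) = x.
Proof. by rewrite mulgA gen_sq mul1g. Qed.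

Lemma mul_genK s x : x * g s * g s = x.
Proof. by rewrite -mulgA gen_sq mulg1. Qed.

Lemma ev_nil : ev [::] = 1. Proof. by []. Qed.

Lemma ev_nseq k s s' : ev (flatten (nseq k [:: s; s'])) = (g s * g s') ^+ k.
Proof.
elim: k => [|k IHk]; first by rewrite expg0.
by rewrite expgS -IHk /= !cox_ev_cons mulgA.
Qed.

Lemma gen_braid s s' : s != s' -> (g s * g s') ^+ m s s' = 1.
Proof.
move=> ss'; rewrite -ev_nseq -ev_nil; apply/cox_evP/rst_step.
by have := Braid m [::] [::] ss'; rewrite cats0.
Qed.

Lemma ev_rev u : ev (rev u) = (ev u)^-1.
Proof.
elim: u => [|s u IHu]; first by rewrite invg1.
by rewrite rev_cons -cats1 cox_ev_cat IHu (cox_ev_cons m s u) invgM gen_inv.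
Qed.

Lemma length_le u : l (ev u) <= size u.
Proof.
by rewrite /cox_length; case: ex_minnP => k _; apply; apply/asboolP; exists u.
Qed.

Lemma length1 : l 1 = 0%N.
Proof. by apply/eqP; rewrite -leqn0; exact: (length_le [::]). Qed.

Lemma length_leV w : l w^-1 <= l w.
Proof.
have [u <- <-] := cox_length_word w.
by rewrite -ev_rev -(size_rev u) length_le.
Qed.

Lemma lengthV w : l w^-1 = l w.
Proof.
by apply/eqP; rewrite eqn_leq length_leV -{1}[w]invgK length_leV.
Qed.

Lemma lengthM x y : l (x * y) <= l x + l y.
Proof.
have [u <- <-] := cox_length_word x; have [v <- <-] := cox_length_word y.
by rewrite -cox_ev_cat -size_cat length_le.
Qed.

Lemma length_gen s : l (g s) <= 1.
Proof. exact: (length_le [:: s]). Qed.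

Lemma length_mul_gen w s : l (w * g s) <= (l w).+1.
Proof.
by apply: leq_trans (lengthM _ _) _; rewrite -addn1 leq_add2l length_gen.
Qed.

Lemma length_gen_mul w s : l (g s * w) <= (l w).+1.
Proof. by rewrite -lengthV invgM gen_inv -(lengthV w) length_mul_gen. Qed.

(** The reflections counted here are the v s v^-1 for the prefixes v s of the word.
    For a reduced word they are distinct; for an arbitrary word only the parity
    of their multiplicities is invariant under the Coxeter relations. *)
Fixpoint inv_parity u t : bool :=
  if u is s :: u' then (t == g s) (+) inv_parity u' (t ^ g s) else false.

Lemma inv_parity_cat u v t :
  inv_parity (u ++ v) t = inv_parity u t (+) inv_parity v (t ^ ev u).
Proof.
elim: u t => [|s u IHu] t /=; first by rewrite conjg1.
by rewrite IHu addbA cox_ev_cons conjgM.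
Qed.

(** The reflections of the prefixes of (s s')^q are the (s s')^k s with k < 2 q.
    Their sequence has period m s s', so that each occurs an even number of
    times when q = m s s'. *)
Lemma inv_parity_braid s s' q t :
  inv_parity (flatten (nseq q [:: s; s'])) t
  = odd (count (fun k => (g s * g s') ^+ k * g s == t) (iota 0 q.*2)).
Proof.
elim: q t => [|q IHq] t //=; rewrite IHq -conjgM oddD oddb oddD oddb.
rewrite expg0 mul1g expg1 eq_sym; congr (_ (+) (_ (+) odd _)).
- by rewrite conjgE gen_inv !mulgA -(inj_eq (mulgI (g s)) _ (g s'))
     -(inj_eq (mulIg (g s)) _ (g s * g s')) !mulgA gen_sq mul1g mul_genK eq_sym.
- rewrite -[2]/(0 + 2)%N addnC iotaDl count_map; apply: eq_count => k /=.
  rewrite add2n -(inj_eq (@conjg_inj _ (g s * g s')) _ t); congr (_ == _).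
  by rewrite conjgE expgS -!mulgA mulgA mulKg expgSr -!mulgA !gen_mulK gen_sq mulg1.
Qed.

Lemma inv_parity_eq u v t : coxeter_eq m u v -> inv_parity u t = inv_parity v t.
Proof.
elim=> {u v} [x y xy|x|x y _ IH|x y z _ IH _ IH'] //; last by rewrite IH IH'.
have key (x1 x2 x3 : seq S) : ev x2 = 1 -> inv_parity x2 =1 (fun=> false) ->
      inv_parity (x1 ++ x2 ++ x3) t = inv_parity (x1 ++ x3) t.
    by move=> e h; rewrite !inv_parity_cat e h conjg1.
case: xy => [x1 s x3|x1 s s' x3 ss']; apply: key.
  + by rewrite 2!cox_ev_cons ev_nil mulg1 gen_sq.
  + by move=> t' /=; rewrite addbF -(inj_eq (@conjg_inj _ (g s)))
      (conjgE (g s)) mulKg addbb.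
  + by rewrite ev_nseq gen_braid.
  + move=> t'; rewrite inv_parity_braid -addnn iotaD count_cat oddD.
    rewrite add0n -{2}[m s s']addn0 iotaDl count_map.
    rewrite (eq_count (a2 := fun k => (g s * g s') ^+ k * g s == t')) ?addbb //.
    by move=> k /=; rewrite expgnDr gen_braid // mul1g.
Qed.

Definition inversion w t : bool := inv_parity (repr w) t.

Lemma inversion_ev u t : inversion (ev u) t = inv_parity u t.
Proof. by apply: inv_parity_eq; exact: repr_cox_ev. Qed.

Lemma inversionM x y t : inversion (x * y) t = inversion x t (+) inversion y (t ^ x).
Proof.
by rewrite -[x]cox_ev_repr -[y]cox_ev_repr -cox_ev_cat !inversion_ev inv_parity_cat.
Qed.

Lemma inversion1 t : inversion 1 t = false.
Proof. exact: (inversion_ev [::]). Qed.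

Lemma inversion_gen s t : inversion (g s) t = (t == g s).
Proof. by rewrite inversion_ev /= addbF. Qed.

(** For t = x s x^-1, the contributions of x and of x^-1 cancel each other, and
    the middle letter counts once. *)
Lemma inversion_refl t : is_reflection t -> inversion t t.
Proof.
case=> x [s ->]; rewrite -mulgA 2!inversionM inversion_gen.
have e : (x * (g s * x^-1)) ^ x = g s by rewrite conjgE -mulgA mulKg mulgVK.
rewrite e eqxx conjgE mulKg.
have := inversion1 (x * (g s * x^-1)); rewrite -{1}(mulgV x) inversionM e.
by case: (inversion x _); case: (inversion x^-1 _).
Qed.

Lemma refl_sq t : is_reflection t -> t * t = 1.
Proof. by case=> x [s ->]; rewrite -!mulgA mulKg gen_mulK mulgV. Qed.

Lemma refl_conj t x : is_reflection t -> is_reflection (x * t * x^-1).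
Proof. by case=> y [s ->]; exists (x * y), s; rewrite invgM !mulgA. Qed.

Lemma refl_gen s : is_reflection (g s).
Proof. by exists 1, s; rewrite mul1g invg1 mulg1. Qed.

(** Multiplication by the reflection of a prefix deletes the last letter of this
    prefix. *)
Lemma inv_parity_delete u t : is_reflection t -> inv_parity u t ->
  exists u1 s u2, u = u1 ++ s :: u2 /\ t * ev u = ev (u1 ++ u2).
Proof.
elim: u t => [//|s u IHu] t rt /=.
have [-> _|tNs /=] := eqVneq t (g s).
  by exists [::], s, u; rewrite cox_ev_cons gen_mulK.
have rts : is_reflection (t ^ g s).
  by rewrite conjgE mulgA -{2}(gen_inv s) -{1}(gen_inv s) invgK; apply: refl_conj.
case/(IHu _ rts) => u1 [s' [u2 [-> e]]]; exists (s :: u1), s', u2; split=> //.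
by rewrite cat_cons [ev (s :: u1 ++ u2)]cox_ev_cons -e cox_ev_cons conjgE gen_inv
   -!mulgA gen_mulK.
Qed.

(** One direction is the deletion of a letter from a reduced word. As t is an
    inversion of exactly one of w and t w, the other direction is the first one
    for t w. *)
Lemma inversionP w t : is_reflection t -> inversion w t = (l (t * w) < l w).
Proof.
have lt x : is_reflection t -> inversion x t -> l (t * x) < l x.
  move=> rt; have [u <- {x}<-] := cox_length_word x; rewrite inversion_ev.
  case/(inv_parity_delete rt) => u1 [s [u2 [-> ->]]].
  by apply: leq_ltn_trans (length_le _) _; rewrite !size_cat /= addnS.
move=> rt; apply/idP/idP => [|h]; first exact: lt.
apply: contraLR h => wNt; rewrite -leqNgt; apply: ltnW.
have {1}<- : t * (t * w) = w by rewrite mulgA refl_sq // mul1g.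
apply: lt => //; rewrite inversionM inversion_refl //.
by rewrite conjgE mulKg (negbTE wNt).
Qed.

Lemma length_refl_neq w t : is_reflection t -> l (t * w) != l w.
Proof.
move=> rt; have := inversionP w rt; have := inversionP (t * w) rt.
rewrite inversionM inversion_refl // conjgE mulKg mulgA refl_sq // mul1g.
by case: (inversion w t); case: ltngtP.
Qed.

Lemma strong_exchange u t : is_reflection t -> l (ev u * t) < l (ev u) ->
  exists u1 s u2, u = u1 ++ s :: u2 /\ ev u * t = ev (u1 ++ u2).
Proof.
move=> rt lt; have rt' := refl_conj (ev u) rt.
have e : ev u * t * (ev u)^-1 * ev u = ev u * t by rewrite mulgVK.
have := inversionP (ev u) rt'; rewrite e lt inversion_ev => h.
by have := inv_parity_delete rt' h; rewrite e.
Qed.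

Lemma length_mul_refl_neq w t : is_reflection t -> l (w * t) != l w.
Proof.
move=> rt; have := length_refl_neq w (refl_conj w rt).
by rewrite mulgVK.
Qed.

Lemma length_desc w s : l (w * g s) < l w -> l w = (l (w * g s)).+1.
Proof.
by move=> h; have := length_mul_gen (w * g s) s; rewrite mul_genK; lia.
Qed.

Lemma length_gen_ltgt w s : (l w < l (w * g s)) = ~~ (l (w * g s) < l w).
Proof. by have := length_mul_refl_neq w (refl_gen s); lia. Qed.

(** * The Bruhat order *)

Lemma bruhat_refl x : bruhat x x. Proof. exact: rt_refl. Qed.

Lemma bruhat_trans y x z : bruhat x y -> bruhat y z -> bruhat x z.
Proof. exact: rt_trans. Qed.

Lemma bruhat_mul_refl x t :
  is_reflection t -> l x < l (x * t) -> bruhat x (x * t).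
Proof. by move=> rt lt; apply: rt_step; exists t. Qed.

Lemma bruhat_mul_refl_desc x t :
  is_reflection t -> l (x * t) < l x -> bruhat (x * t) x.
Proof.
move=> rt lt; apply: rt_step; exists t; split=> //.
by rewrite -mulgA refl_sq // mulg1.
Qed.

Lemma bruhat_length x y : bruhat x y -> x = y \/ l x < l y.
Proof.
elim=> {x y} [x y [t [_ _ lt]]|x|x y z _ [->|xy] _ [<-|yz]]; try by [left|right].
by right; exact: ltn_trans yz.
Qed.

Lemma bruhat_leq x y : bruhat x y -> l x <= l y.
Proof. by case/bruhat_length => [->|/ltnW]. Qed.

Lemma bruhat_anti x y : bruhat x y -> bruhat y x -> x = y.
Proof.
by case/bruhat_length => // xy /bruhat_leq; rewrite leqNgt xy.
Qed.

Lemma bruhatV x y : bruhat x y -> bruhat x^-1 y^-1.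
Proof.
elim=> {x y} [x y [t [rt -> lt]]|x|x y z _ xy _ yz].
- apply: rt_step; exists (x * t * x^-1); split; first exact: refl_conj.
  + by rewrite invgM -mulgA mulKg; congr (_ * _); rewrite -[LHS]mul1g -(refl_sq rt) mulgK.
  + by rewrite !lengthV.
- exact: bruhat_refl.
- exact: bruhat_trans xy yz.
Qed.

(** Suppose that y = x t and that multiplication by s reverses the order of x and
    y. Then s t s deletes a letter from a word for x s; this must be the final s,
    for otherwise y would have a word shorter than that of x. *)
Lemma bruhat_step_mul x y s :
  bruhat_step x y -> x * g s = y \/ bruhat_step (x * g s) (y * g s).
Proof.
case=> t [rt ey xy].
have rt' : is_reflection (g s * t * g s).
  by rewrite -{2}(gen_inv s); exact: refl_conj.
have eys : y * g s = x * g s * (g s * t * g s).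
  by rewrite ey !mulgA mul_genK.
have [lt|] := ltnP (l (x * g s)) (l (y * g s)); first by right; exists (g s * t * g s).
rewrite leq_eqVlt => /orP[/eqP e|gt].
  by have := length_mul_refl_neq (x * g s) rt'; rewrite -eys e eqxx.
left; have hy := length_mul_gen (y * g s) s; rewrite mul_genK in hy.
have hx := length_mul_gen x s.
have [u su xu] := cox_length_word x.
have xus : x * g s = ev (rcons u s) by rewrite -cats1 cox_ev_cat xu.
have := @strong_exchange (rcons u s) (g s * t * g s) rt'.
rewrite -xus -eys => /(_ gt) [u1 [s' [u2 []]]].
case/lastP: u2 => [|u2 s''] /=.
  by rewrite cats1 cats0 => /rcons_inj [<- _]; rewrite xu => <-; rewrite mul_genK.
rewrite -rcons_cons -rcons_cat => /rcons_inj [eu <-].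
rewrite -rcons_cat -cats1 cox_ev_cat => /mulIg ey'.
have := length_le (u1 ++ u2); rewrite -ey' leqNgt (leq_trans _ xy) //.
by rewrite -su eu !size_cat /= addnS.
Qed.

Lemma right_descentV w s : right_descent s w^-1 = left_descent s w.
Proof.
by rewrite /right_descent /left_descent -(lengthV (g s * w)) invgM gen_inv lengthV.
Qed.

Lemma bruhat_mul_gen_desc x s : right_descent s x -> bruhat (x * g s) x.
Proof. by move=> xs; apply: bruhat_mul_refl_desc xs; exact: refl_gen. Qed.

Lemma bruhat_mul_gen_asc x s : ~~ right_descent s x -> bruhat x (x * g s).
Proof.
by rewrite /right_descent -length_gen_ltgt => xs; apply: bruhat_mul_refl xs;
  exact: refl_gen.
Qed.

(** With bruhat_mul_upper, the lifting property before any assumption on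
    descents: along a chain from x to y, either multiplication by s respects
    every step, or it exchanges the two ends of one of them. *)
Lemma bruhat_mul_lower x y s :
  bruhat x y -> bruhat (x * g s) y \/ bruhat (x * g s) (y * g s).
Proof.
move=> xy; have := clos_rt_rt1n _ _ _ _ xy; elim=> {x y xy} [x|x y z xy yz IH].
  by right; exact: bruhat_refl.
have [->|/(@rt_step _ _ _ _) xys] := bruhat_step_mul s xy.
  by left; exact: clos_rt1n_rt yz.
by case: IH => IH; [left|right]; exact: bruhat_trans xys IH.
Qed.

Lemma bruhat_mul_upper x y s :
  bruhat x y -> bruhat x (y * g s) \/ bruhat (x * g s) (y * g s).
Proof.
move=> xy; have := clos_rt_rtn1 _ _ _ _ xy; elim=> {y xy} [|y z yz xy IH].
  by right; exact: bruhat_refl.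
have [<-|/(@rt_step _ _ _ _) yzs] := bruhat_step_mul s yz.
  by left; rewrite mul_genK; exact: clos_rtn1_rt xy.
by case: IH => IH; [left|right]; exact: bruhat_trans IH yzs.
Qed.

Lemma bruhat_lift_lower x y s :
  bruhat x y -> right_descent s y -> bruhat (x * g s) y.
Proof.
move=> xy ys; case: (bruhat_mul_lower s xy) => // h.
exact: bruhat_trans (bruhat_mul_gen_desc ys).
Qed.

Lemma bruhat_lift_min x y s :
  bruhat x y -> ~~ right_descent s x -> bruhat x (y * g s).
Proof.
move=> xy xs; case: (bruhat_mul_upper s xy) => // h.
exact: bruhat_trans (bruhat_mul_gen_asc xs) h.
Qed.

Lemma bruhat_lift_both x y s :
  bruhat x y -> right_descent s x -> bruhat (x * g s) (y * g s).
Proof.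
move=> xy xs; case: (bruhat_mul_upper s xy) => // h.
exact: bruhat_trans (bruhat_mul_gen_desc xs) h.
Qed.

Lemma bruhatVE x y : bruhat x^-1 y^-1 <-> bruhat x y.
Proof. by split=> [/bruhatV|/bruhatV //]; rewrite !invgK. Qed.

Lemma bruhat_lift_lower_left x y s :
  bruhat x y -> left_descent s y -> bruhat (g s * x) y.
Proof.
rewrite -right_descentV -!(bruhatVE _ y) invgM gen_inv; exact: bruhat_lift_lower.
Qed.

Lemma bruhat_lift_min_left x y s :
  bruhat x y -> ~~ left_descent s x -> bruhat x (g s * y).
Proof.
rewrite -right_descentV -!(bruhatVE x) invgM gen_inv; exact: bruhat_lift_min.
Qed.

Lemma bruhat_lift_both_left x y s :
  bruhat x y -> left_descent s x -> bruhat (g s * x) (g s * y).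
Proof.
rewrite -right_descentV -(bruhatVE x) -(bruhatVE (_ * _)) !invgM gen_inv.
exact: bruhat_lift_both.
Qed.

Lemma bruhat_gen_desc_left x s : left_descent s x -> bruhat (g s * x) x.
Proof.
by rewrite -right_descentV -bruhatVE invgM gen_inv; exact: bruhat_mul_gen_desc.
Qed.

Lemma reduced_behead s u : reduced m (s :: u) -> reduced m u /\ ~~ left_descent s (ev u).
Proof.
rewrite /reduced /left_descent cox_ev_cons /= => /eqP e.
by have := length_gen_mul (ev u) s; have := length_le u; lia.
Qed.

Lemma right_descent_behead s s' u :
  reduced m (s :: u) -> right_descent s' (ev u) -> right_descent s' (ev (s :: u)).
Proof.
rewrite /reduced /right_descent cox_ev_cons /= => /eqP e us'.
have : l (g s * ev u * g s') <= (l (ev u * g s')).+1 by rewrite -mulgA length_gen_mul.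
by have := length_le u; lia.
Qed.

Lemma right_descent_ex w : w <> 1 -> exists s, right_descent s w.
Proof.
have [u su uw] := cox_length_word w; rewrite -{}uw in su *; move/esym: su.
case/lastP: u => [|u s] su h; first by case: h.
exists s; rewrite /right_descent su -cats1 cox_ev_cat mul_genK size_cat addn1 ltnS.
exact: length_le.
Qed.

Lemma left_descent_ex w : w <> 1 -> exists s, left_descent s w.
Proof.
move=> w1; have [|s] := @right_descent_ex w^-1.
  by move=> e; apply: w1; rewrite -[w]invgK e invg1.
by rewrite right_descentV; exists s.
Qed.

(** * Minimal coset representatives *)

Implicit Types (K I J : pred S).

Definition right_min K x := forall s, K s -> ~~ right_descent s x.

(** By the lifting property, multiplication by an element of K does not lead out
    of the elements above a minimal representative. *)
Lemma right_min_bruhat K x v : right_min K x -> all K v -> bruhat x (x * ev v).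
Proof.
move=> xK; elim/last_ind: v => [|v s IHv]; first by rewrite ev_nil mulg1 => _;
  exact: bruhat_refl.
rewrite all_rcons => /andP[Ks Kv]; rewrite -cats1 cox_ev_cat mulgA.
by apply: bruhat_lift_min (IHv Kv) _; exact: xK.
Qed.

(** Two minimal representatives of a coset are below each other. *)
Lemma right_min_uniq K x v :
  right_min K x -> right_min K (x * ev v) -> all K v -> ev v = 1.
Proof.
move=> xK xvK Kv; apply: (mulgI x); rewrite mulg1; apply: bruhat_anti.
  have := right_min_bruhat (v := rev v) xvK.
  by rewrite ev_rev mulgK all_rev; apply.
exact: right_min_bruhat xK Kv.
Qed.

Lemma right_min_decomp K x : exists x0 v,
  [/\ right_min K x0, all K v, x = x0 * ev v & l x = l x0 + size v].
Proof.
have [k] := ubnP (l x); elim: k x => // k IHk x xk.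
case: (pselect (exists s, K s && right_descent s x)) => [[s /andP[Ks xs]]|h].
  have [|x0 [v [x0K Kv e le]]] := IHk (x * g s).
    by move: xs; rewrite /right_descent; lia.
  exists x0, (rcons v s); split=> //.
  - by rewrite all_rcons Ks.
  - by rewrite -cats1 cox_ev_cat mulgA -e mul_genK.
  - by rewrite size_rcons (length_desc xs) le addnS.
exists x, [::]; split; rewrite ?ev_nil ?mulg1 ?addn0 //.
by move=> s Ks; apply/negP => xs; apply: h; exists s; rewrite Ks.
Qed.

Lemma right_min_word K x v : right_min K x -> all K v ->
  exists v', [/\ all K v', ev v' = ev v & l (x * ev v) = l x + size v'].
Proof.
move=> xK Kv; have [x0 [v' [x0K Kv' e le]]] := right_min_decomp K (x * ev v).
have e0 : x0 = x * ev (v ++ rev v').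
  by rewrite cox_ev_cat ev_rev mulgA e mulgK.
have e1 : ev (v ++ rev v') = 1.
  apply: (right_min_uniq (K := K) xK); first by rewrite -e0.
  by rewrite all_cat Kv all_rev.
move: e0; rewrite e1 mulg1 => e0; rewrite e0 in e le.
by exists v'; split=> //; apply: (mulgI x); rewrite -e.
Qed.

Lemma right_min_length K x v : right_min K x -> all K v ->
  l (x * ev v) = l x + l (ev v).
Proof.
move=> xK Kv; have [v' [_ e le]] := right_min_word xK Kv.
by have := lengthM x (ev v); have := length_le v'; rewrite e; lia.
Qed.

(** If s' in K is a right descent of s x and not of x, multiplication by s'
    reverses the order of x < s x, which is only possible if it exchanges them. *)
Lemma right_min_gen_mul K x s : right_min K x ->
  right_min K (g s * x) \/ exists2 s', K s' & g s * x = x * g s'.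
Proof.
move=> xK; case: (pselect (right_min K (g s * x))) => [|h]; [by left|right].
have [s' Ks' sxs'] : exists2 s', K s' & right_descent s' (g s * x).
  apply: contrapT => h'; apply: h => s' Ks'; apply/negP => d; apply: h'.
  by exists s'.
exists s' => //; move: sxs' (xK _ Ks'); rewrite /right_descent => h1 h2.
have h3 : l x < l (x * g s') by rewrite length_gen_ltgt.
have h4 := length_gen_mul (g s * (x * g s')) s; rewrite gen_mulK in h4.
have {}h1 : l (g s * (x * g s')) < l (g s * x) by rewrite mulgA.
have h5 := length_gen_mul x s.
have : bruhat_step x (g s * x).
  exists (x^-1 * g s * x^-1^-1); split; last by lia.
  - exact: refl_conj (refl_gen s).
  - by rewrite invgK !mulgA mulgV mul1g.
case/(bruhat_step_mul s') => [//|[t [_ _ h6]]].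
have : l (x * g s') < l (g s * (x * g s')) by rewrite mulgA.
by lia.
Qed.

(** * Deodhar's criterion *)

Section GenInjective.

Hypothesis gen_inj : injective g.

Lemma right_min1 K : right_min K 1.
Proof. by move=> s _; rewrite /right_descent length1. Qed.

Lemma gen_neq1 s : g s <> 1.
Proof.
by move=> e; have := length_refl_neq 1 (refl_gen s); rewrite e mulg1 eqxx.
Qed.

Lemma gen_in_parabolic K s v : all K v -> ev v = g s -> K s.
Proof.
move=> Kv e; have [v' [Kv' e']] := right_min_word (@right_min1 K) Kv.
rewrite mul1g length1 e add0n => lv.
have := length_gen s; rewrite lv.
case: v' Kv' e' {lv} => [_ e'|s' [|//] /=]; first by case: (@gen_neq1 s); rewrite -e -e'.
by rewrite andbT => Ks' e' _; rewrite -(gen_inj (etrans e' e)).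
Qed.

(** Exchange in a reduced word over K expresses the generator s over K. *)
Lemma right_descent_parabolic K v s :
  all K v -> right_descent s (ev v) -> K s.
Proof.
move=> Kv; have [v' [Kv' <-]] := right_min_word (@right_min1 K) Kv.
move=> _ /(strong_exchange (refl_gen s)) [v1 [s' [v2 [ev' e]]]].
apply: (@gen_in_parabolic K s (rev v' ++ (v1 ++ v2))).
  rewrite all_cat all_rev Kv' /=.
  by move: Kv'; rewrite ev' !all_cat /= => /and3P[-> _ ->].
by rewrite cox_ev_cat -e ev_rev mulKg.
Qed.

Definition dominated x y := forall q, exists x0 v,
  [/\ right_min (predC1 q) x0, all (predC1 q) v, x = x0 * ev v & bruhat x0 y].

Lemma bruhat_one_eq x : bruhat x 1 -> x = 1.
Proof. by case/bruhat_length => //; rewrite length1. Qed.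

(** Deodhar's criterion. Let a be a left descent of y. If a is a left descent of
    x, the lifting property shows that a x is dominated by a y, since left
    multiplication by a either moves a minimal representative to another one or
    keeps it in its coset. Otherwise x itself is dominated by a y. *)
Lemma dominated_bruhat x y : dominated x y -> bruhat x y.
Proof.
have [k] := ubnP (l y); elim: k x y => // k IHk x y yk xy.
case: (pselect (y = 1)) => [y1|/left_descent_ex [a ya]].
  case: (pselect (x = 1)) => [->|/right_descent_ex [s xs]].
    by rewrite y1; exact: bruhat_refl.
  have [x0 [v [_ Kv e]]] := xy s.
  rewrite y1 => /bruhat_one_eq x01; move: xs; rewrite e x01 mul1g.
  by move/(right_descent_parabolic Kv); rewrite /= eqxx.
have ayk : l (g a * y) < k by move: (ya); rewrite /left_descent; lia.
case: (boolP (left_descent a x)) => xa.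
- suff /(IHk _ _ ayk) h : dominated (g a * x) (g a * y).
    rewrite -[x](gen_mulK a); apply: (bruhat_lift_lower_left _ ya).
    exact: bruhat_trans (bruhat_gen_desc_left ya).
  move=> q; have [x0 [v [x0K Kv e x0y]]] := xy q.
  have [ax0|ax0] := boolP (left_descent a x0).
  + have [ax0K|[s' Ks' es']] := right_min_gen_mul a x0K; last first.
      have := x0K _ Ks'; rewrite /right_descent -es'.
      by move: ax0; rewrite /left_descent => ->.
    exists (g a * x0), v; split=> //; first by rewrite e mulgA.
    exact: bruhat_lift_both_left.
  have x0ay := bruhat_lift_min_left x0y ax0.
  have [ax0K|[s' Ks' es']] := right_min_gen_mul a x0K; last first.
    exists x0, (s' :: v); split=> //; first by rewrite /= Kv andbT.
    by rewrite cox_ev_cons e !mulgA es'.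
  have e1 : l (g a * x) = l (g a * x0) + l (ev v).
    by rewrite e mulgA (right_min_length ax0K).
  have e2 : l x = l x0 + l (ev v) by rewrite e (right_min_length x0K).
  by move: xa ax0; rewrite /left_descent; lia.
- suff /(IHk _ _ ayk) h : dominated x (g a * y).
    exact: bruhat_trans (bruhat_gen_desc_left ya).
  move=> q; have [x0 [v [x0K Kv e x0y]]] := xy q.
  exists x0, v; split=> //; apply: bruhat_lift_min_left x0y _.
  have e1 : l (g a * x) <= l (g a * x0) + l (ev v) by rewrite e mulgA lengthM.
  have e2 : l x = l x0 + l (ev v) by rewrite e (right_min_length x0K).
  by move: xa; rewrite /left_descent; lia.
Qed.

(** If w has two right descents, it is no minimal representative modulo a maximal
    parabolic subgroup, whereas it is the supremum of its representatives. *)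
Lemma join_irreducible_right_descent w s s' :
  join_irreducible w -> right_descent s w -> right_descent s' w -> s = s'.
Proof.
move=> wJ ws ws'; apply: contrapT => ss'; apply: wJ.
exists [set x | exists q, right_min (predC1 q) x /\
                exists2 v, all (predC1 q) v & w = x * ev v]%classic.
split; [split|] => [x [q [xq [v Kv ->]]]|y xy|[q [wq _]]].
- exact: right_min_bruhat xq Kv.
- apply: dominated_bruhat => q.
  have [x0 [v [x0K Kv e _]]] := right_min_decomp (predC1 q) w.
  exists x0, v; split=> //; apply: xy; exists q; split=> //.
  by exists v.
- have [sq|sq] := eqVneq s q.
    have := wq s'; rewrite ws' /= => /(_ _)/negP; apply => //.
    by apply/eqP => e; apply: ss'; rewrite e.
  by have := wq s; rewrite /= ws => /(_ sq).
Qed.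

Lemma join_irreducibleV w : join_irreducible w -> join_irreducible w^-1.
Proof.
move=> wJ [U [[Uw sup] nUw]]; apply: wJ.
exists [set x | U x^-1]%classic; split=> //=; split=> [x /Uw|y xy].
  by rewrite bruhatVE.
by rewrite -bruhatVE; apply: sup => x Ux; rewrite -bruhatVE invgK; apply: xy;
  rewrite /= invgK.
Qed.

Lemma join_irreducible_left_descent w s s' :
  join_irreducible w -> left_descent s w -> left_descent s' w -> s = s'.
Proof.
move/join_irreducibleV; rewrite -!right_descentV.
exact: join_irreducible_right_descent.
Qed.

End GenInjective.

Lemma join_irreducible_witness d y :
  (forall x, bruhat x d -> x <> d -> bruhat x y) -> ~ bruhat d y ->
  join_irreducible d.
Proof.
move=> dy ndy [U [[Ud sup] nUd]]; apply: ndy; apply: sup => x Ux.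
by apply: dy (Ud _ Ux) _ => e; apply: nUd; rewrite -e.
Qed.

(** * Double cosets *)

Definition double_min I J z :=
  (forall s, I s -> ~~ left_descent s z) /\ (forall s, J s -> ~~ right_descent s z).

Definition double_coset I J x y :=
  exists u v, [/\ all I u, all J v & y = ev u * x * ev v].

Lemma double_coset_refl I J x : double_coset I J x x.
Proof. by exists [::], [::]; rewrite ev_nil mul1g mulg1. Qed.

Lemma double_coset_left I J x y s :
  I s -> double_coset I J x (g s * y) -> double_coset I J x y.
Proof.
move=> Is [u [v [Iu Jv e]]]; exists (s :: u), v; split=> //=; first by rewrite Is.
by rewrite cox_ev_cons -!mulgA [ev u * _]mulgA -e gen_mulK.
Qed.

Lemma double_coset_right I J x y s :
  J s -> double_coset I J x (y * g s) -> double_coset I J x y.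
Proof.
move=> Js [u [v [Iu Jv e]]]; exists u, (rcons v s); split=> //=;
  first by rewrite all_rcons Js.
by rewrite -cats1 cox_ev_cat mulgA -e mul_genK.
Qed.

Lemma double_coset_invariant I J (Q : W -> Prop) x y :
  (forall w s, I s -> Q w -> Q (g s * w)) ->
  (forall w s, J s -> Q w -> Q (w * g s)) ->
  double_coset I J x y -> Q x -> Q y.
Proof.
move=> QI QJ [u [v [Iu Jv ->]]] Qx.
have {Qx} : Q (x * ev v).
  elim/last_ind: v Jv => [|v s IHv]; first by rewrite ev_nil mulg1.
  rewrite all_rcons -cats1 cox_ev_cat mulgA => /andP[Js /IHv Qv].
  exact: QJ.
rewrite -mulgA; elim: u Iu => [|s u IHu] /=; first by rewrite ev_nil mul1g.
by case/andP=> Is Iu Qv; rewrite cox_ev_cons -mulgA; apply: QI => //; exact: IHu.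
Qed.

(** By the lifting property, removing from y its descents in I and J, one after
    the other, keeps it above every x that has no such descent. *)
Lemma double_min_ex I J y : exists z, [/\ double_min I J z, double_coset I J z y,
  bruhat z y & forall x, double_min I J x -> bruhat x y -> bruhat x z].
Proof.
have [k] := ubnP (l y); elim: k y => // k IHk y yk.
case: (pselect (exists s, I s && left_descent s y)) => [[s /andP[Is ys]]|h].
  have [|z [zm zy bzy zmax]] := IHk (g s * y); first by move: ys;
    rewrite /left_descent; lia.
  exists z; split=> //; first exact: double_coset_left zy.
    exact: bruhat_trans (bruhat_gen_desc_left ys).
  by move=> x xm xy; apply: zmax => //; apply: bruhat_lift_min_left xy _; exact: xm.1.
case: (pselect (exists s, J s && right_descent s y)) => [[s /andP[Js ys]]|h'].
  have [|z [zm zy bzy zmax]] := IHk (y * g s); first by move: ys;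
    rewrite /right_descent; lia.
  exists z; split=> //; first exact: double_coset_right zy.
    exact: bruhat_trans (bruhat_mul_gen_desc ys).
  by move=> x xm xy; apply: zmax => //; apply: bruhat_lift_min xy _; exact: xm.2.
exists y; split=> //; [split=> s Ks;
  apply/negP => d|exact: double_coset_refl|exact: bruhat_refl].
  by apply: h; exists s; rewrite Ks.
by apply: h'; exists s; rewrite Ks.
Qed.

Definition double_max I J y :=
  (forall s, I s -> left_descent s y) /\ (forall s, J s -> right_descent s y).

Lemma double_max_ex I J B x : (forall w, l w <= B) ->
  exists2 y, double_max I J y & double_coset I J x y.
Proof.
move=> lB; suff h k w : B - l w < k -> double_coset I J x w ->
    exists2 y, double_max I J y & double_coset I J x y.
  exact: h (ltnSn _) (double_coset_refl I J x).
elim: k w => // k IHk w wk xw.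
case: (pselect (exists s, I s && ~~ left_descent s w)) => [[s /andP[Is ws]]|h].
  apply: (IHk (g s * w)); last by apply: (@double_coset_left _ _ _ _ s);
    rewrite ?gen_mulK.
  have := lB (g s * w); have := length_refl_neq w (refl_gen s); have := lB w.
  by move: ws wk; rewrite /left_descent; lia.
case: (pselect (exists s, J s && ~~ right_descent s w)) => [[s /andP[Js ws]]|h'].
  apply: (IHk (w * g s)); last by apply: (@double_coset_right _ _ _ _ s);
    rewrite ?mul_genK.
  have := lB (w * g s); have := length_mul_refl_neq w (refl_gen s); have := lB w.
  by move: ws wk; rewrite /right_descent; lia.
exists w => //; split=> s Ks; apply: contrapT => /negP d.
  by apply: h; exists s; rewrite Ks.
by apply: h'; exists s; rewrite Ks.
Qed.

Lemma double_max_ge I J x x' y :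
  double_max I J y -> double_coset I J x x' -> bruhat x y -> bruhat x' y.
Proof.
move=> [yI yJ]; apply: (double_coset_invariant (Q := fun w => bruhat w y)) => w s Ks wy.
  by apply: bruhat_lift_lower_left; [|exact: yI].
by apply: bruhat_lift_lower; [|exact: yJ].
Qed.

End CoxeterTheory.

(** * Signed permutations *)

(** The reflection in the root e_b - e_a of a root system of type B or D, acting
    on the indices of the vectors e_x, with the convention e_(-x) = - e_x. *)
Definition refl (a b z : Z) : Z :=
  if Z.eqb z a then b else if Z.eqb z b then a
  else if Z.eqb z (- a) then (- b)%Z else if Z.eqb z (- b) then (- a)%Z else z.

Ltac refl_cases :=
  repeat match goal with
  | |- context [Z.eqb ?x ?y] =>
      lazymatch constr:((x, y)) with
      | context [Z.eqb] => fail
      | _ => destruct (Z.eqb_spec x y); cbv iota; try (exfalso; lia)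
      end
  end.

Ltac refl_lia := rewrite /refl; refl_cases; lia.

Definition odd_fun (f : Z -> Z) := forall z, f (- z)%Z = (- f z)%Z.

Lemma refl_conj_fun (f : Z -> Z) (a b z : Z) :
  odd_fun f -> injective f -> f (refl a b z) = refl (f a) (f b) (f z).
Proof.
move=> fodd finj; rewrite /refl -!fodd.
have E x y : Z.eqb (f x) (f y) = Z.eqb x y.
  by apply/idP/idP => /Z.eqb_eq e; apply/Z.eqb_eq; [exact: finj | rewrite e].
by rewrite !E; do 4!case: ifP => // _.
Qed.

Lemma refl_odd (a b : Z) : (a <> 0)%Z -> (b <> 0)%Z -> odd_fun (refl a b).
Proof. by move=> ? ? z; refl_lia. Qed.

Lemma reflK (a b : Z) : (a <> 0)%Z -> (b <> 0)%Z -> involutive (refl a b).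
Proof. by move=> ? ? z; refl_lia. Qed.

Lemma refl_conj_refl (a b c d z : Z) : (a <> 0)%Z -> (b <> 0)%Z ->
  refl a b (refl c d (refl a b z)) = refl (refl a b c) (refl a b d) z.
Proof.
move=> a0 b0; rewrite refl_conj_fun ?reflK //; first exact: refl_odd.
exact: can_inj (reflK a0 b0).
Qed.

(** The braid relations for reflections follow from the formula for a conjugate
    of a reflection. *)
Lemma refl_braid2 (a b c d : Z) : (a <> 0)%Z -> (b <> 0)%Z -> (c <> 0)%Z -> (d <> 0)%Z ->
  refl a b c = c -> refl a b d = d ->
  forall z, iter 2 (fun z => refl a b (refl c d z)) z = z.
Proof.
by move=> a0 b0 c0 d0 ec ed z /=; rewrite refl_conj_refl // ec ed reflK.
Qed.

Lemma refl_braid3 (a b c d : Z) : (a <> 0)%Z -> (b <> 0)%Z -> (c <> 0)%Z -> (d <> 0)%Z ->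
  refl a b c = refl c d a -> refl a b d = refl c d b ->
  forall z, iter 3 (fun z => refl a b (refl c d z)) z = z.
Proof.
move=> a0 b0 c0 d0 e1 e2 z /=.
by rewrite refl_conj_refl // e1 e2 -refl_conj_refl // !reflK.
Qed.

Lemma refl_braid4 (a b c d : Z) : (a <> 0)%Z -> (b <> 0)%Z -> (c <> 0)%Z -> (d <> 0)%Z ->
  (forall z, refl (refl a b c) (refl a b d) (refl c d z)
           = refl c d (refl (refl a b c) (refl a b d) z)) ->
  forall z, iter 4 (fun z => refl a b (refl c d z)) z = z.
Proof.
move=> a0 b0 c0 d0 e z /=.
by rewrite !(@refl_conj_refl a b) // e !reflK //; refl_lia.
Qed.

Fixpoint alt_word (S : Type) (s s' : S) (k : nat) : seq S :=
  if k is k'.+1 then rcons (alt_word s' s k') s else [::].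

Section AltWords.

Local Open Scope group_scope.

Variables (S : finType) (m : S -> S -> nat).
Local Notation W := (coxeter_group m).
Local Notation g := (cox_gen m).
Local Notation ev := (cox_ev m).
Local Notation l := (@cox_length S m).
Implicit Types (w : W) (s t : S).

Lemma size_alt_word s t k : size (alt_word s t k) = k.
Proof. by elim: k s t => //= k IHk s t; rewrite size_rcons IHk. Qed.

Lemma ev_alt_wordS s t k : ev (alt_word s t k.+1) = ev (alt_word t s k) * g s.
Proof. by rewrite /= -cats1 cox_ev_cat. Qed.

(** Conjugation by s inverts t s. *)
Lemma gen_expg_conj s t k :
  (g t * g s) ^+ k * g s * (g t * g s) ^+ k = g s.
Proof.
elim: k => [|k IHk]; first by rewrite expg0 mul1g mulg1.
by rewrite {1}expgSr expgS -[RHS]IHk -!mulgA !gen_mulK.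
Qed.

Lemma ev_alt_word_swap s t k :
  ev (alt_word s t k) = ev (alt_word t s k) * (g t * g s) ^+ k.
Proof.
elim: k => [|k IHk]; first by rewrite expg0 mulg1.
rewrite !ev_alt_wordS IHk expgS -{1}(gen_expg_conj s t k) -!mulgA; congr (_ * _).
by rewrite gen_mulK.
Qed.

Lemma ev_alt_word_braid s t : s != t ->
  ev (alt_word s t (m s t)) = ev (alt_word t s (m s t)).
Proof.
move=> st; rewrite ev_alt_word_swap.
have -> : g t * g s = (g s * g t)^-1 by rewrite invgM !gen_inv.
by rewrite expVgn gen_braid // invg1 mulg1.
Qed.

(** The right descents s and t are removed alternately from w, as long as
    possible; the last conclusion holds because w' becomes longer when the
    letter removed last is put back. *)
Lemma alt_word_strip s t w : exists k w',
  [/\ w = w' * ev (alt_word s t k), l w = l w' + k,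
      ~~ right_descent (if odd k then t else s) w' &
      0 < k -> ~~ right_descent (if odd k then s else t) w'].
Proof.
have [n] := ubnP (l w); elim: n s t w => // n IHn s t w wn.
have [ws|ws] := boolP (right_descent s w); last first.
  by exists 0, w; rewrite ev_nil mulg1 addn0.
have [|k [w' [e le d d']]] := IHn t s (w * g s).
  by move: ws; rewrite /right_descent; lia.
exists k.+1, w'; split.
- by rewrite ev_alt_wordS mulgA -e mul_genK.
- by rewrite (length_desc ws) le addnS.
- by move: d => /=; case: (odd k).
- move=> _; case: k e le d' {d} => [|k] e le d'; last first.
    by move: (d' isT) => /=; case: (odd k).
  move: e; rewrite ev_nil mulg1 => <- /=.
  by move: ws; rewrite /right_descent mul_genK; lia.
Qed.

Lemma alt_word_cat s t k j : k <= j ->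
  exists u, alt_word s t j = u ++ alt_word s t k.
Proof.
elim: k s t j => [|k IHk] s t j; first by exists (alt_word s t j); rewrite cats0.
case: j => // j; rewrite ltnS => /(IHk t s) [u eu].
by exists u; rewrite /= eu rcons_cat.
Qed.

(** An alternating word of length m s t can also be written with t at its end;
    then t would be a right descent of w. *)
Lemma alt_word_lt s t w k w' : s != t -> 0 < m s t ->
  w = w' * ev (alt_word s t k) -> l w = l w' + k -> ~~ right_descent t w ->
  k < m s t.
Proof.
move=> st m0 e le wt; rewrite ltnNge; apply: contra wt => mk.
have [u eu] := alt_word_cat s t mk.
have e' : w * g t = w' * ev (u ++ alt_word s t (m s t).-1).
  rewrite e eu !cox_ev_cat ev_alt_word_braid // -{1}(prednK m0) ev_alt_wordS.
  by rewrite !mulgA mul_genK.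
have su : k = size u + m s t by rewrite -{1}(size_alt_word s t k) eu size_cat
  size_alt_word.
have := lengthM w' (ev (u ++ alt_word s t (m s t).-1)).
have := length_le m (u ++ alt_word s t (m s t).-1).
by rewrite /right_descent e' size_cat size_alt_word; lia.
Qed.

End AltWords.

Section SignedAction.

Local Open Scope group_scope.

Variables (S : finType) (m : S -> S -> nat) (lo hi : S -> Z).
Local Notation W := (coxeter_group m).
Local Notation g := (cox_gen m).
Local Notation ev := (cox_ev m).
Local Notation l := (@cox_length S m).
Implicit Types (w x y : W) (s t : S) (u v : seq S).

Definition gen_act s : Z -> Z := refl (lo s) (hi s).

Definition word_act u (z : Z) : Z := foldr gen_act z u.

(** The generator s acts as the reflection in the simple root e_(hi s) - e_(lo s).
    In the last condition f stands for an element w of the group for which the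
    images of the simple roots of s and t are positive: then so is the image of
    the root of t under w v, for every v in the dihedral group of s and t that
    does not have t as a right descent. *)
Record root_datum : Prop := RootDatum {
  root_lo_hi : forall s, (lo s < hi s)%Z /\ (lo s <> 0 /\ hi s <> 0)%Z;
  root_gt1 : forall s t, s != t -> 1 < m s t;
  root_braid : forall s t z, s != t ->
    iter (m s t) (fun z => gen_act s (gen_act t z)) z = z;
  root_dihedral : forall s t k (f : Z -> Z), s != t -> 0 < k < m s t ->
    odd_fun f -> (f (lo s) < f (hi s))%Z -> (f (lo t) < f (hi t))%Z ->
    (f (word_act (alt_word s t k) (lo t)) < f (word_act (alt_word s t k) (hi t)))%Z
}.

Hypothesis rd : root_datum.

Let lo_hi := root_lo_hi rd.
Let m_gt1 := root_gt1 rd.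
Let braid_act := root_braid rd.
Let dihedral_pos := root_dihedral rd.

Lemma word_act_cat u v z : word_act (u ++ v) z = word_act u (word_act v z).
Proof. by rewrite /word_act foldr_cat. Qed.

Lemma gen_actK s : involutive (gen_act s).
Proof. by move=> z; have := lo_hi s; rewrite /gen_act; refl_lia. Qed.

Lemma gen_act_odd s : odd_fun (gen_act s).
Proof. by move=> z; have := lo_hi s; rewrite /gen_act; refl_lia. Qed.

Lemma gen_act_lo s : gen_act s (lo s) = hi s.
Proof. by rewrite /gen_act /refl Z.eqb_refl. Qed.

Lemma gen_act_hi s : gen_act s (hi s) = lo s.
Proof. by rewrite -(gen_act_lo s) gen_actK. Qed.

Lemma word_act_eq u v z : coxeter_eq m u v -> word_act u z = word_act v z.
Proof.
elim=> {u v} [x y xy|x|x y _ IH|x y x' _ IH _ IH'] //; last by rewrite IH.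
case: xy => [u s v|u s t v st]; rewrite !word_act_cat /=; first by rewrite gen_actK.
congr (word_act _ _); rewrite -[RHS](braid_act _ st).
by elim: (m s t) => //= k ->.
Qed.

Definition act w (z : Z) : Z := word_act (repr w) z.

Lemma act_ev u z : act (ev u) z = word_act u z.
Proof. by apply: word_act_eq; exact: repr_cox_ev. Qed.

Lemma actM x y z : act (x * y) z = act x (act y z).
Proof.
by rewrite -[x]cox_ev_repr -[y]cox_ev_repr -cox_ev_cat !act_ev word_act_cat.
Qed.

Lemma act1 z : act 1 z = z. Proof. exact: (act_ev [::]). Qed.

Lemma act_gen s z : act (g s) z = gen_act s z. Proof. exact: act_ev. Qed.

Lemma act_odd w : odd_fun (act w).
Proof.
move=> z; rewrite /act; elim: (repr w) => //= s u ->; exact: gen_act_odd.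
Qed.

Lemma actK w z : act w^-1 (act w z) = z.
Proof. by rewrite -actM mulVg act1. Qed.

Lemma actVK w z : act w (act w^-1 z) = z.
Proof. by rewrite -actM mulgV act1. Qed.

Lemma act_inj w : injective (act w).
Proof. exact: can_inj (actK w). Qed.

(** Let t be a right descent of w, and write w = w' v with v in the dihedral
    group of s and t and w' without right descents s and t. By induction w' is
    positive on the simple roots of s and t, and v does not have s as a right
    descent. *)
Lemma act_asc w s : ~~ right_descent s w -> (act w (lo s) < act w (hi s))%Z.
Proof.
have [n] := ubnP (l w); elim: n w s => // n IHn w s wn ws.
case: (pselect (w = 1)) => [->|/right_descent_ex [t wt]].
  by rewrite !act1; case: (lo_hi s).
have ts : t != s by apply: contraTneq wt => ->.
have [[|k] [w' [e le]]] := alt_word_strip t s w.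
  by move: e; rewrite ev_nil mulg1 => <- /=; rewrite wt.
move=> d /(_ isT) d'; have m0 := m_gt1 ts.
have km := alt_word_lt ts (ltnW m0) e le ws.
rewrite {1}e actM e actM !act_ev; apply: dihedral_pos => //; first exact: act_odd.
  by apply: IHn; [lia | case: ifP d d'].
by apply: IHn; [lia | case: ifP d d'].
Qed.

Lemma act_desc w s : right_descent s w -> (act w (hi s) < act w (lo s))%Z.
Proof.
move=> ws; have /act_asc : ~~ right_descent s (w * g s).
  by move: ws; rewrite /right_descent mul_genK; lia.
by rewrite !actM !act_gen gen_act_lo gen_act_hi.
Qed.

Lemma act_faithful x y : act x =1 act y -> x = y.
Proof.
move=> xy; apply: (mulgI y^-1); rewrite mulVg; apply: contrapT.
case/right_descent_ex => s /act_desc.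
by rewrite !actM !xy !actK; case: (lo_hi s); lia.
Qed.

Lemma cox_gen_inj : injective g.
Proof.
move=> s t e; apply/eqP; apply: contraT => st.
have := @dihedral_pos s t 1 id st; rewrite m_gt1 // => /(_ isT) /=.
have [h1 _] := lo_hi s; have [h2 _] := lo_hi t.
move/(_ (fun=> erefl) h1 h2); rewrite /word_act /=.
by rewrite -!act_gen e !act_gen gen_act_lo gen_act_hi; lia.
Qed.

Lemma act_reflection_conj x (r : W) a b : act r =1 refl a b ->
  act (x * r * x^-1) =1 refl (act x a) (act x b).
Proof.
move=> e z; rewrite !actM e -{2}(actVK x z) -refl_conj_fun //;
  [exact: act_odd|exact: act_inj].
Qed.

End SignedAction.

(** * The two Weyl groups as signed permutations *)

Lemma dihedral_disjoint (f : Z -> Z) (a b c d : Z) : odd_fun f ->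
  refl a b c = c /\ refl a b d = d \/ refl a b c = (- d)%Z /\ refl a b d = (- c)%Z ->
  (f c < f d)%Z -> (f (refl a b c) < f (refl a b d))%Z.
Proof. by move=> fo [] [-> ->] //; rewrite !fo; lia. Qed.

(** The reflection in one of two adjacent simple roots maps the other to their
    sum. *)
Lemma dihedral_chain (f : Z -> Z) (a b c d : Z) : (a < b)%Z ->
  b = c /\ refl a b d = d \/ a = d /\ refl a b c = c ->
  (f a < f b)%Z -> (f c < f d)%Z -> (f (refl a b c) < f (refl a b d))%Z.
Proof.
move=> ab [] [<- ->].
  have -> : refl a b b = a by refl_lia.
  by lia.
have -> : refl a b a = b by refl_lia.
by lia.
Qed.

Section RootsD.

Variable n : nat.
Implicit Types (a b : nodeD n).

(** Coordinates are shifted by one with respect to the labels of the nodes, so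
    that the two ends of the fork of the diagram involve 1 and -1. *)
Definition loD a : Z :=
  match a with inl true => 1 | inl false => -1 | inr k => Z.of_nat k + 2 end%Z.
Definition hiD a : Z :=
  match a with inl _ => 2 | inr k => Z.of_nat k + 3 end%Z.

Lemma lo_hiD a : (loD a < hiD a)%Z /\ (loD a <> 0 /\ hiD a <> 0)%Z.
Proof. by case: a => [[]|k] /=; lia. Qed.

Lemma coxD_gt1 a b : a != b -> 1 < coxD a b.
Proof.
case: a => [e|k]; case: b => [e'|k'] /=; try by case: ifP.
- by case: (eqVneq e e') => [->|//]; rewrite eqxx.
- by case: (eqVneq k k') => [->|_ _]; rewrite ?eqxx //; case: ifP.
Qed.

Lemma coxD_le3 a b : coxD a b <= 3.
Proof.
by case: a => [e|k]; case: b => [e'|k'] /=; do ?case: ifP.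
Qed.

Lemma braid_actD a b z : a != b ->
  iter (coxD a b) (fun z => gen_act loD hiD a (gen_act loD hiD b z)) z = z.
Proof.
rewrite /gen_act; case: a => [e|k]; case: b => [e'|k'].
- case: e; case: e' => //= _; refl_lia.
- move=> _ /=; case: ifP => /eqP h; [apply: refl_braid3 | apply: refl_braid2];
    by case: e => /=; try lia; refl_lia.
- move=> _ /=; case: ifP => /eqP h; [apply: refl_braid3 | apply: refl_braid2];
    by case: e' => /=; try lia; refl_lia.
- rewrite (inj_eq (@inr_inj _ _)) /= => kk; rewrite (negbTE kk).
  rewrite -(inj_eq val_inj) /= in kk.
  rewrite /adjacent; case: ifP => h; [apply: refl_braid3 | apply: refl_braid2];
    by try lia; refl_lia.
Qed.

Lemma dihedral_posD a b k (f : Z -> Z) : a != b -> 0 < k < coxD a b ->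
  odd_fun f -> (f (loD a) < f (hiD a))%Z -> (f (loD b) < f (hiD b))%Z ->
  (f (word_act loD hiD (alt_word a b k) (loD b)) <
   f (word_act loD hiD (alt_word a b k) (hiD b)))%Z.
Proof.
move=> ab kab fo; have := coxD_le3 a b.
case: k kab => [|[|[|k]]] //; last by case/andP=> _; lia.
- rewrite /word_act /= /gen_act => _ _.
  case: a ab => [e|k]; case: b => [e'|k'] ab ha hb.
  + rewrite (inj_eq (@inl_inj _ _)) in ab; apply: dihedral_disjoint => //.
    by right; case: e e' ab {ha hb} => [] [] //= _; split; refl_lia.
  + have [k0|k0] := eqVneq (k' : nat) 0.
      apply: dihedral_chain => //; first by case: e {ab ha} => /=; lia.
      by left; case: e {ab ha} => /=; split; try lia; refl_lia.
    apply: dihedral_disjoint => //; left.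
    by case: e {ab ha} => /=; split; try lia; refl_lia.
  + have [k0|k0] := eqVneq (k : nat) 0.
      apply: dihedral_chain => //; first by rewrite /=; lia.
      by right; case: e' {ab hb} => /=; split; try lia; refl_lia.
    apply: dihedral_disjoint => //; left.
    by case: e' {ab hb} => /=; split; try lia; refl_lia.
  + rewrite (inj_eq (@inr_inj _ _)) -(inj_eq val_inj) /= in ab.
    have [h|h] := eqVneq (k' : nat) k.+1.
      by apply: dihedral_chain; rewrite //=; [lia | left; split; [lia | refl_lia]].
    have [h'|h'] := eqVneq (k : nat) k'.+1.
      by apply: dihedral_chain; rewrite //=; [lia | right; split; [lia | refl_lia]].
    by apply: dihedral_disjoint => //=; left; split; refl_lia.
- rewrite /word_act /= /gen_act => m3 _ ha hb.
  have suff_val (a' b' : Z) : a' = loD a -> b' = hiD a -> (f a' < f b')%Z.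
    by move=> -> ->.
  apply: suff_val; case: a ab m3 {ha} => [e|k]; case: b {hb} => [e'|k'] /= ab m3.
  + by move: m3; case: ifP.
  + by move: m3; case: ifP => // /eqP h _; case: e {ab} => /=; refl_lia.
  + by move: m3; case: ifP => // /eqP h _; case: e' {ab} => /=; refl_lia.
  + rewrite (inj_eq (@inr_inj _ _)) in ab; move: m3; rewrite (negbTE ab) /adjacent.
    by case: ifP => // h _; refl_lia.
  + by move: m3; case: ifP.
  + by move: m3; case: ifP => // /eqP h _; case: e {ab} => /=; refl_lia.
  + by move: m3; case: ifP => // /eqP h _; case: e' {ab} => /=; refl_lia.
  + rewrite (inj_eq (@inr_inj _ _)) in ab; move: m3; rewrite (negbTE ab) /adjacent.
    by case: ifP => // h _; refl_lia.
Qed.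

Lemma root_datumD : root_datum (@coxD n) loD hiD.
Proof.
split; [exact: lo_hiD|exact: coxD_gt1|exact: braid_actD|exact: dihedral_posD].
Qed.

End RootsD.

Section RootsB.

Variable n : nat.
Implicit Types (a b : 'I_n.+1).

(** Type B acts on the coordinates 2, ..., n + 2, so that its letters m >= 1 are
    the same reflections as those of type D. *)
Definition loB a : Z := if a == 0 :> nat then (-2)%Z else (Z.of_nat a + 1)%Z.
Definition hiB a : Z := (Z.of_nat a + 2)%Z.

Lemma lo_hiB a : (loB a < hiB a)%Z /\ (loB a <> 0 /\ hiB a <> 0)%Z.
Proof. by rewrite /loB /hiB; case: eqP; lia. Qed.

Lemma coxB_gt1 a b : a != b -> 1 < coxB a b.
Proof. by rewrite /coxB => /negbTE ->; case: ifP => // _; case: ifP. Qed.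

Variant coxB_spec a b : nat -> Prop :=
| CoxB2 of a.+1 <> b & b.+1 <> a : coxB_spec a b 2
| CoxB3l of a <> 0 :> nat & a.+1 = b : coxB_spec a b 3
| CoxB3r of b <> 0 :> nat & b.+1 = a : coxB_spec a b 3
| CoxB4l of a = 0 :> nat & b = 1 :> nat : coxB_spec a b 4
| CoxB4r of b = 0 :> nat & a = 1 :> nat : coxB_spec a b 4.

Lemma coxBP a b : a != b -> coxB_spec a b (coxB a b).
Proof.
rewrite /coxB => ab; rewrite (negbTE ab) /adjacent; move: ab.
rewrite -(inj_eq val_inj) /= => ab.
case: ifP => [/orP[]/eqP e|e]; last by constructor; lia.
  case: ifP => h; first by apply: CoxB4r; lia.
  by apply: CoxB3r; lia.
case: ifP => h; first by apply: CoxB4l; lia.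
by apply: CoxB3l; lia.
Qed.

Lemma braid_actB a b z : a != b ->
  iter (coxB a b) (fun z => gen_act loB hiB a (gen_act loB hiB b z)) z = z.
Proof.
move=> ab; have := lo_hiB a; have := lo_hiB b; rewrite /gen_act.
case: (coxBP ab) => h h'; move: ab;
  rewrite -(inj_eq val_inj) /= => ab [_ [b1 b2]] [_ [a1 a2]].
- apply: refl_braid2 => //; rewrite /loB /hiB {a1 a2 b1 b2};
    by do ?[case: eqP => ?]; try lia; refl_lia.
- apply: refl_braid3 => //; rewrite /loB /hiB -h' /=; case: eqP => // a0; refl_lia.
- apply: refl_braid3 => //; rewrite /loB /hiB -h' /=; case: eqP => // a0; refl_lia.
- apply: refl_braid4 => //; rewrite /loB /hiB h h' /=; rewrite /refl /= => x; refl_lia.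
- apply: refl_braid4 => //; rewrite /loB /hiB h h' /=; rewrite /refl /= => x; refl_lia.
Qed.

Lemma dihedral_posB a b k (f : Z -> Z) : a != b -> 0 < k < coxB a b ->
  odd_fun f -> (f (loB a) < f (hiB a))%Z -> (f (loB b) < f (hiB b))%Z ->
  (f (word_act loB hiB (alt_word a b k) (loB b)) <
   f (word_act loB hiB (alt_word a b k) (hiB b)))%Z.
Proof.
move=> ab kab fo; rewrite /word_act /gen_act.
have suff_val (a' b' : Z) : a' = loB a -> b' = hiB a ->
    (f (loB a) < f (hiB a))%Z -> (f a' < f b')%Z by move=> -> ->.
have f2 : f (-2)%Z = (- f 2)%Z := fo 2%Z.
have f3 : f (-3)%Z = (- f 3)%Z := fo 3%Z.
case: (coxBP ab) kab => h h'; move: ab; rewrite -(inj_eq val_inj) /= => ab.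
- case: k => [|[|k]] //= _ ha hb.
  apply: dihedral_disjoint => //; left; rewrite /loB /hiB.
  by case: eqP => a0; case: eqP => b0; split; try lia; refl_lia.
- case: k => [|[|[|k]]] //= _ ha hb.
    apply: dihedral_chain => //; first by case: (lo_hiB a).
    by left; rewrite /loB /hiB -h' /=; case: eqP => // a0; split; try lia; refl_lia.
  by apply: suff_val => //; rewrite /loB /hiB -h' /=; case: eqP => // a0; refl_lia.
- case: k => [|[|[|k]]] //= _ ha hb.
    apply: dihedral_chain => //; first by case: (lo_hiB a).
    by right; rewrite /loB /hiB -h' /=; case: eqP => // a0; split; try lia; refl_lia.
  by apply: suff_val => //; rewrite /loB /hiB -h' /=; case: eqP => // a0; refl_lia.
- have la : loB a = (-2)%Z by rewrite /loB h.
  have ha : hiB a = 2%Z by rewrite /hiB h.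
  have lb : loB b = 2%Z by rewrite /loB h'.
  have hb : hiB b = 3%Z by rewrite /hiB h'.
  by case: k => [|[|[|[|k]]]] //= _ ; rewrite !(la, ha, lb, hb) /refl /=; lia.
- have la : loB b = (-2)%Z by rewrite /loB h.
  have ha : hiB b = 2%Z by rewrite /hiB h.
  have lb : loB a = 2%Z by rewrite /loB h'.
  have hb : hiB a = 3%Z by rewrite /hiB h'.
  by case: k => [|[|[|[|k]]]] //= _ ; rewrite !(la, ha, lb, hb) /refl /=; lia.
Qed.

Lemma root_datumB : root_datum (@coxB n) loB hiB.
Proof.
split; [exact: lo_hiB|exact: coxB_gt1|exact: braid_actB|exact: dihedral_posB].
Qed.

End RootsB.

(** * Doubly increasing signed permutations *)

Section IncreasingFunctions.

Local Open Scope Z_scope.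

Lemma increasing_gap (f : Z -> Z) (a c : Z) :
  (forall p, a <= p < c -> f p < f (p + 1)) ->
  forall p q, a <= p <= q -> q <= c -> f p + (q - p) <= f q.
Proof.
move=> finc p q hp hq.
have : forall d, 0 <= d -> p + d <= c -> f p + d <= f (p + d).
  apply: natlike_ind => [|d d0 IH] hd; first by rewrite !Z.add_0_r; lia.
  have := IH ltac:(lia); have := finc (p + d) ltac:(lia).
  by rewrite /Z.succ !Z.add_assoc; lia.
by move/(_ (q - p)); rewrite Zplus_minus; lia.
Qed.

Definition zseq (a k : nat) : seq Z := [seq Z.of_nat p | p <- iota a.+1 k].

Lemma mem_zseq (a k : nat) (p : Z) :
  reflect (Z.of_nat a < p <= Z.of_nat a + Z.of_nat k) (p \in zseq a k).
Proof.
apply: (iffP mapP) => [[q]|h]; first by rewrite mem_iota => ? ->; lia.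
by exists (Z.to_nat p); rewrite ?mem_iota; lia.
Qed.

Definition rank (T : seq Z) (f : Z -> Z) (v : Z) : nat :=
  count (fun p => Z.leb (f p) v) T.

(** An increasing function passes the value v at the position given by its rank. *)
Lemma rank_threshold (f : Z -> Z) (a k : nat) (v : Z) :
  (forall p, Z.of_nat a < p < Z.of_nat a + Z.of_nat k -> f p < f (p + 1)) ->
  forall p, Z.of_nat a < p <= Z.of_nat a + Z.of_nat k ->
    (f p <= v <-> p <= Z.of_nat a + Z.of_nat (rank (zseq a k) f v)).
Proof.
elim: k => [|k IHk] finc p hp; first by lia.
have {}IHk := IHk (fun q hq => finc q ltac:(lia)).
set q := Z.of_nat a + Z.of_nat k.+1.
have -> : rank (zseq a k.+1) f v = (rank (zseq a k) f v + (Z.leb (f q) v))%N.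
  rewrite /rank /zseq -(addn1 k) iotaD map_cat count_cat /= addn0.
  congr (_ + nat_of_bool (Z.leb (f _) _))%N; rewrite /q; lia.
have rk : (rank (zseq a k) f v <= k)%N.
  by rewrite /rank (leq_trans (count_size _ _)) // size_map size_iota.
have hk : f q <= v -> (0 < k)%N -> rank (zseq a k) f v = k.
  move=> fq k0; have := IHk (Z.of_nat a + Z.of_nat k) ltac:(lia).
  have := finc (Z.of_nat a + Z.of_nat k) ltac:(lia).
  have -> : Z.of_nat a + Z.of_nat k + 1 = q by lia.
  by lia.
case: (Z.leb_spec (f q) v) => fq; rewrite /= ?addn1 ?addn0.
- have rk' : rank (zseq a k) f v = k by case: (posnP k) => [k0|/(hk fq)]; lia.
  have [e|pq] := Z.eq_dec p q; first by rewrite e rk'; lia.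
  by have := IHk p ltac:(lia); rewrite rk'; lia.
- have [e|pq] := Z.eq_dec p q; first by rewrite e; lia.
  by have := IHk p ltac:(lia); lia.
Qed.

End IncreasingFunctions.

(** The signed permutations of 1, ..., N without right descents in type D other
    than the node exchanging J1 and J1 + 1. *)
Definition grassmannian (N J1 : Z) (f : Z -> Z) : Prop :=
  (forall p, 2 <= p < N -> p <> J1 -> f p < f (p + 1))%Z /\ (Z.abs (f 1) < f 2)%Z.

Section Gaps.

Local Open Scope Z_scope.

Lemma tail_gap (N J1 : Z) (f : Z -> Z) (p q : Z) : 2 <= J1 -> grassmannian N J1 f ->
  J1 < p <= q -> q <= N -> f p + (q - p) <= f q.
Proof.
move=> hJ fgr hp; apply: (increasing_gap (a := p)); last by lia.
by move=> x hx; apply: fgr.1; lia.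
Qed.

Lemma body_gap (N J1 : Z) (f : Z -> Z) (p q : Z) : J1 < N -> grassmannian N J1 f ->
  2 <= p <= q -> q <= J1 -> f p + (q - p) <= f q.
Proof.
move=> hJ fgr hp; apply: (increasing_gap (a := p)); last by lia.
by move=> x hx; apply: fgr.1; lia.
Qed.

Lemma body_abs (N J1 : Z) (f : Z -> Z) (p : Z) : J1 < N -> grassmannian N J1 f ->
  2 <= p <= J1 -> Z.abs (f 1) + (p - 1) <= f p.
Proof. by move=> hJ fgr hp; have := @body_gap N J1 f 2 p hJ fgr; have := fgr.2; lia. Qed.

End Gaps.

(** The values of f when it is increasing, like its inverse g, with a jump at J1
    for f and at I1 for g. The body 2, ..., J1 consists of fixed points followed
    by positions sent into the tail of g; the tail consists of b positions with
    negative values, of m - b positions with values in the body of g, and of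
    fixed points. Only the signs at position 1 and of the value 1 remain
    undetermined. *)
Record normal_form (N I1 J1 b m : Z) (f : Z -> Z) : Prop := NormalForm {
  nf_b : (0 <= b <= m)%Z;
  nf_m : (m <= N - J1)%Z;
  nf_c : (m - b <= I1)%Z;
  nf_body : forall p, (2 <= p <= I1 - (m - b) -> f p = p)%Z;
  nf_first : (m - b < I1 -> Z.abs (f 1) = 1)%Z;
  nf_first_shift : (m - b = I1 -> Z.abs (f 1) = 1 + m)%Z;
  nf_shift : forall p, (2 <= p <= J1 -> I1 - (m - b) < p -> f p = p + m)%Z;
  nf_neg : forall p, (J1 < p <= J1 + b -> f p = p - J1 - 1 - I1 - b)%Z;
  nf_mid : forall p, (J1 + b < p <= J1 + m ->
    f p = p - J1 - b + (I1 - (m - b)) \/ p = J1 + b + 1 /\ f p = -1 /\ m - b = I1)%Z;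
  nf_pos : forall p, (J1 + m < p <= N -> f p = p)%Z
}.

Lemma normal_form_agree (N I1 J1 b m : Z) (f f' : Z -> Z) :
  normal_form N I1 J1 b m f -> normal_form N I1 J1 b m f' ->
  (forall q, 2 <= q <= N -> f q = f' q \/ Z.abs (f q) = 1 /\ Z.abs (f' q) = 1)%Z.
Proof.
move=> [b0 mN cI fb f1 f1' fs fn fm fp] [_ _ _ gb g1 g1' gs gn gm gp] q hq.
have [h|h] : (J1 < q \/ q <= J1)%Z by lia.
  have [h'|[[h1 h2]|[h1 h2]]] : (q <= J1 + b \/ J1 + b < q <= J1 + m \/ J1 + m < q <=
    N)%Z by lia.
  - by left; rewrite fn ?gn; lia.
  - by have := fm q; have := gm q; lia.
  - by left; rewrite fp ?gp; lia.
left; have [e|e] : (q <= I1 - (m - b) \/ I1 - (m - b) < q)%Z by lia.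
  by rewrite fb ?gb; lia.
by rewrite fs ?gs; lia.
Qed.

Lemma normal_form_agree1 (N I1 J1 b m : Z) (f f' : Z -> Z) :
  normal_form N I1 J1 b m f -> normal_form N I1 J1 b m f' ->
  ((m - b = I1 -> (f 1 < 0 <-> f' 1 < 0)) ->
  f 1 = f' 1 \/ Z.abs (f 1) = 1 /\ Z.abs (f' 1) = 1)%Z.
Proof.
move=> [b0 mN cI fb f1 f1' fs fn fm fp] [_ _ _ gb g1 g1' gs gn gm gp] fg.
have [e|e] : (m - b = I1 \/ m - b < I1)%Z by lia.
  by left; have := fg e; have := f1' e; have := g1' e; lia.
by right; split; [exact: f1|exact: g1].
Qed.

Section NormalFormTail.

Local Open Scope Z_scope.

Variables (N I1 J1 b m b' m' : Z) (f g : Z -> Z).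
Hypotheses (I2 : 2 <= I1 < N) (J2 : 2 <= J1 < N).
Hypotheses (fodd : odd_fun f) (godd : odd_fun g).
Hypotheses (fK : forall z, g (f z) = z) (gK : forall z, f (g z) = z).
Hypotheses (frange : forall z, 1 <= Z.abs z <= N -> 1 <= Z.abs (f z) <= N).
Hypotheses (grange : forall z, 1 <= Z.abs z <= N -> 1 <= Z.abs (g z) <= N).
Hypotheses (fgr : grassmannian N J1 f) (ggr : grassmannian N I1 g).
Hypotheses (b0 : 0 <= b <= N - J1) (m0 : 0 <= m <= N - J1).
Hypotheses (b'0 : 0 <= b' <= N - I1) (m'0 : 0 <= m' <= N - I1).
Hypothesis fb : forall p, J1 < p <= N -> (f p <= - I1 - 1 <-> p <= J1 + b).
Hypothesis fm : forall p, J1 < p <= N -> (f p <= I1 <-> p <= J1 + m).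
Hypothesis gb : forall v, I1 < v <= N -> (g v <= - J1 - 1 <-> v <= I1 + b').
Hypothesis gm : forall v, I1 < v <= N -> (g v <= J1 <-> v <= I1 + m').

Lemma b_le_m : b <= m.
Proof.
have [h|h] : b <= m \/ m < b by lia.
  by [].
have := fb (p := J1 + b); have := fm (p := J1 + b); lia.
Qed.

(** The values at the first b positions of the tail increase, and their opposites
    lie among the first b' positions of the tail of g. *)
Lemma negative_le : b <= b'.
Proof.
have [h|h] : b = 0 \/ 1 <= b by lia.
  by lia.
have h1 := tail_gap (p := J1 + 1) (q := J1 + b) (proj1 J2) fgr ltac:(lia) ltac:(lia).
have h2 := fb (p := J1 + b) ltac:(lia); have h3 := fb (p := J1 + 1) ltac:(lia).
have h4 := @frange (J1 + 1) ltac:(lia).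
have := gb (v := - f (J1 + 1)) ltac:(lia).
by rewrite godd fK; lia.
Qed.

(** The positions of the tail with values above I1 are sent increasingly to
    those of the tail of g with values above J1. *)
Lemma positive_le : I1 + m' <= J1 + m.
Proof.
have [h|h] : m = N - J1 \/ m < N - J1 by lia.
  by lia.
have h1 := tail_gap (p := J1 + m + 1) (q := N) (proj1 J2) fgr ltac:(lia) ltac:(lia).
have h2 := fm (p := J1 + m + 1) ltac:(lia).
have h4 := @frange (J1 + m + 1) ltac:(lia); have h5 := @frange N ltac:(lia).
have := gm (v := f (J1 + m + 1)) ltac:(lia).
by rewrite fK; lia.
Qed.

Hypotheses (bb : b' = b) (mm : I1 + m' = J1 + m).

Lemma negative_form p : J1 < p <= J1 + b -> f p = p - J1 - 1 - I1 - b.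
Proof.
move=> hp.
have h1 := tail_gap (p := J1 + 1) (q := p) (proj1 J2) fgr ltac:(lia) ltac:(lia).
have h2 := tail_gap (p := p) (q := J1 + b) (proj1 J2) fgr ltac:(lia) ltac:(lia).
have h3 := fb (p := J1 + b) ltac:(lia); have h4 := fb (p := J1 + 1) ltac:(lia).
have h5 := @frange (J1 + 1) ltac:(lia).
have := gb (v := - f (J1 + 1)) ltac:(lia).
by rewrite godd fK; lia.
Qed.

Lemma positive_form p : J1 + m < p <= N -> f p = p.
Proof.
move=> hp.
have h1 := tail_gap (p := J1 + m + 1) (q := p) (proj1 J2) fgr ltac:(lia) ltac:(lia).
have h2 := tail_gap (p := p) (q := N) (proj1 J2) fgr ltac:(lia) ltac:(lia).
have h3 := fm (p := J1 + m + 1) ltac:(lia).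
have h4 := @frange (J1 + m + 1) ltac:(lia); have h5 := @frange N ltac:(lia).
have := gm (v := f (J1 + m + 1)) ltac:(lia).
by rewrite fK; lia.
Qed.

(** Let p be the first position of the tail whose value v lies in the body of g.
    As g increases, all of v, ..., I1 come from the positions p, ..., J1 + m of
    the tail, so that their numbers agree. The value -1 is possible only if the
    whole body of g is reached. *)
Lemma middle_first : b < m ->
  1 <= f (J1 + b + 1) /\ f (J1 + b + 1) = I1 - (m - b) + 1 \/
  f (J1 + b + 1) = -1 /\ m - b = I1.
Proof.
move=> bm; set p0 := J1 + b + 1.
have f1 := fb (p := p0) ltac:(lia); have f2 := fm (p := p0) ltac:(lia).
have r := @frange p0 ltac:(lia).
have gp v : 2 <= v <= I1 -> g v > 0.
  by move=> hv; have := body_abs (proj2 I2) ggr hv; lia.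
have f3 : - 1 <= f p0.
  have [//|h] : - 1 <= f p0 \/ f p0 <= - 2 by lia.
  by have := gp (- f p0) ltac:(lia); rewrite godd fK; lia.
have fl := fm (p := J1 + m) ltac:(lia).
have gapf := tail_gap (p := p0) (q := J1 + m) (proj1 J2) fgr ltac:(lia) ltac:(lia).
have inI v : 1 <= v <= I1 -> g v <= N -> J1 < g v -> g v <= J1 + m.
  by move=> hv hg hJ; apply/fm; rewrite ?gK; lia.
have gr := @grange I1 ltac:(lia).
have gI := inI I1 ltac:(lia).
have [h|[h|h]] : 2 <= f p0 \/ f p0 = 1 \/ f p0 = - 1 by lia.
- left.
  have gapg := body_gap (p := f p0) (q := I1) (proj2 I2) ggr ltac:(lia) ltac:(lia).
  by rewrite fK in gapg; lia.
- left; have g1 : g 1 = p0 by rewrite -h fK.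
  have gapg := body_abs (p := I1) (proj2 I2) ggr ltac:(lia).
  by rewrite g1 in gapg; lia.
- right; split=> //.
  have g1 : g 1 = - p0 by have := fK p0; rewrite h (godd 1); lia.
  have gapg := body_abs (p := I1) (proj2 I2) ggr ltac:(lia).
  rewrite g1 in gapg.
  have [e|bm'] : m = b + 1 \/ b + 1 < m by lia.
    by lia.
  have gapf' := tail_gap (p := p0 + 1) (q := J1 + m) (proj1 J2) fgr ltac:(lia) ltac:(lia).
  have step := tail_gap (p := p0) (q := p0 + 1) (proj1 J2) fgr ltac:(lia) ltac:(lia).
  have r' := @frange (p0 + 1) ltac:(lia).
  have ne : f (p0 + 1) <> 1.
    by move=> e; have := fK (p0 + 1); rewrite e; lia.
  by lia.
Qed.

Lemma middle_le : m - b <= I1.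
Proof.
have [h|h] : m <= b \/ b < m by lia.
  by lia.
by case: (middle_first h); lia.
Qed.

Lemma middle_form p : J1 + b < p <= J1 + m ->
  f p = p - J1 - b + (I1 - (m - b)) \/ p = J1 + b + 1 /\ f p = -1 /\ m - b = I1.
Proof.
move=> hp; have bm : b < m by lia.
have fl := fm (p := J1 + m) ltac:(lia).
have h1 := tail_gap (p := J1 + b + 1) (q := p) (proj1 J2) fgr ltac:(lia) ltac:(lia).
have h2 := tail_gap (p := p) (q := J1 + m) (proj1 J2) fgr ltac:(lia) ltac:(lia).
case: (middle_first bm) => [[e0 e]|[e c]]; first by left; lia.
have [->|ne] : p = J1 + b + 1 \/ p <> J1 + b + 1 by lia.
  by right.
left; have step := tail_gap (p := J1 + b + 2) (q := p) (proj1 J2) fgr ltac:(lia)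
  ltac:(lia).
have r' := @frange (J1 + b + 2) ltac:(lia).
have ne' : f (J1 + b + 2) <> 1.
  move=> e'; have := fK (J1 + b + 2); rewrite e'.
  by have := fK (J1 + b + 1); rewrite e (godd 1); lia.
have step' := tail_gap (p := J1 + b + 1) (q := J1 + b + 2) (proj1 J2) fgr ltac:(lia)
  ltac:(lia).
by lia.
Qed.

End NormalFormTail.

Section NormalFormBody.

Local Open Scope Z_scope.

Variables (N I1 J1 b m m' : Z) (f g : Z -> Z).
Hypotheses (I2 : 2 <= I1 < N) (J2 : 2 <= J1 < N).
Hypotheses (fodd : odd_fun f) (godd : odd_fun g).
Hypotheses (fK : forall z, g (f z) = z) (gK : forall z, f (g z) = z).
Hypotheses (frange : forall z, 1 <= Z.abs z <= N -> 1 <= Z.abs (f z) <= N).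
Hypotheses (grange : forall z, 1 <= Z.abs z <= N -> 1 <= Z.abs (g z) <= N).
Hypotheses (fgr : grassmannian N J1 f) (ggr : grassmannian N I1 g).
Hypotheses (b0 : 0 <= b <= N - J1) (m0 : 0 <= m <= N - J1).
Hypotheses (b'0 : 0 <= b <= N - I1) (m'0 : 0 <= m' <= N - I1).
Hypothesis fb : forall p, J1 < p <= N -> (f p <= - I1 - 1 <-> p <= J1 + b).
Hypothesis fm : forall p, J1 < p <= N -> (f p <= I1 <-> p <= J1 + m).
Hypothesis gb : forall v, I1 < v <= N -> (g v <= - J1 - 1 <-> v <= I1 + b).
Hypothesis gm : forall v, I1 < v <= N -> (g v <= J1 <-> v <= I1 + m').
Hypothesis mm : I1 + m' = J1 + m.

Let g_middle v : I1 + b < v <= J1 + m ->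
  g v = v - I1 - b + (I1 - (m - b)) \/ v = I1 + b + 1 /\ g v = -1 /\ m - b = I1.
Proof.
rewrite -mm => hv.
have : g v = v - I1 - b + (J1 - (m' - b)) \/ v = I1 + b + 1 /\ g v = -1 /\ m' - b = J1.
  by apply: (@middle_form N J1 I1 b m' b m g f).
by lia.
Qed.

Let f_middle p : J1 + b < p <= J1 + m ->
  f p = p - J1 - b + (I1 - (m - b)) \/ p = J1 + b + 1 /\ f p = -1 /\ m - b = I1.
Proof.
exact: (@middle_form N I1 J1 b m b m' f g).
Qed.

(** By the formula for the inverse, whose middle values are the positions of the
    body with values beyond I1. *)
Lemma body_shift p : I1 - (m - b) < p <= J1 -> 1 <= p ->
  f p = p + m \/ p = 1 /\ f p = - (p + m) /\ m - b = I1.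
Proof.
move=> hp p1; case: (g_middle (v := p + m) ltac:(lia)) => [h|[h [h' h'']]].
  left; have e : g (p + m) = p by lia.
  by have := gK (p + m); rewrite e.
right; split; [by lia|split; last by []].
have := gK (p + m); rewrite h'.
have -> : p = 1 by lia.
by rewrite (fodd 1); lia.
Qed.

(** All other values are taken at other positions. *)
Lemma body_stays p : 1 <= p <= I1 - (m - b) -> Z.abs (f p) <= I1 - (m - b).
Proof.
move=> hp; have bm' : b <= m' by exact: (@b_le_m N J1 I1 b m' g).
have key v : v = f p \/ v = - f p -> 0 < v -> v <= I1 - (m - b).
  move=> hv v0; have gv : g v = p \/ g v = - p.
    by case: hv => ->; rewrite ?godd fK; lia.
  have vN : v <= N by have := @frange p ltac:(lia); lia.
  have [//|[h|h]] : v <= I1 - (m - b) \/ I1 - (m - b) < v <= I1 \/ I1 < v by lia.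
    have := f_middle (p := J1 + b + (v - (I1 - (m - b)))) ltac:(lia).
    case=> [e|]; last by lia.
    have e' : f (J1 + b + (v - (I1 - (m - b)))) = v by lia.
    by have := fK (J1 + b + (v - (I1 - (m - b)))); rewrite e'; lia.
  have h1 := gb (v := v) ltac:(lia); have h2 := gm (v := v) ltac:(lia).
  by have := g_middle (v := v) ltac:(lia); lia.
by have := key (f p); have := key (- f p); lia.
Qed.

Lemma body_fixed p : 2 <= p <= I1 - (m - b) -> f p = p.
Proof.
move=> hp; have bm' : b <= m' by exact: (@b_le_m N J1 I1 b m' g).
have h1 := body_gap (p := 2) (q := p) (proj2 J2) fgr ltac:(lia) ltac:(lia).
have h2 := body_gap (p := p) (q := I1 - (m - b)) (proj2 J2) fgr ltac:(lia) ltac:(lia).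
have h3 := @body_stays (I1 - (m - b)) ltac:(lia).
have := @frange 1 ltac:(lia); have := fgr.2.
by lia.
Qed.

Lemma body_first : m - b < I1 -> Z.abs (f 1) = 1.
Proof.
move=> h; have r := @frange 1 ltac:(lia).
have [h'|h'] : I1 - (m - b) = 1 \/ 2 <= I1 - (m - b) by lia.
  by have := @body_stays 1 ltac:(lia); lia.
have := @body_fixed 2 ltac:(lia).
by have := fgr.2; lia.
Qed.

End NormalFormBody.

Lemma grassmannian_normal_form (N I1 J1 b m b' m' : Z) (f g : Z -> Z) :
  (2 <= I1 < N -> 2 <= J1 < N -> odd_fun f -> odd_fun g ->
  (forall z, g (f z) = z) -> (forall z, f (g z) = z) ->
  (forall z, 1 <= Z.abs z <= N -> 1 <= Z.abs (f z) <= N) ->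
  (forall z, 1 <= Z.abs z <= N -> 1 <= Z.abs (g z) <= N) ->
  grassmannian N J1 f -> grassmannian N I1 g ->
  0 <= b <= N - J1 -> 0 <= m <= N - J1 ->
  0 <= b' <= N - I1 -> 0 <= m' <= N - I1 ->
  (forall p, J1 < p <= N -> (f p <= - I1 - 1 <-> p <= J1 + b)) ->
  (forall p, J1 < p <= N -> (f p <= I1 <-> p <= J1 + m)) ->
  (forall v, I1 < v <= N -> (g v <= - J1 - 1 <-> v <= I1 + b')) ->
  (forall v, I1 < v <= N -> (g v <= J1 <-> v <= I1 + m')) ->
  normal_form N I1 J1 b m f)%Z.
Proof.
move=> I2 J2 fodd godd fK gK frange grange fgr ggr b0 m0 b'0 m'0 fb fm gb gm.
have h1 : (b <= b')%Z by exact: (@negative_le N I1 J1 b b' f g).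
have h2 : (b' <= b)%Z by exact: (@negative_le N J1 I1 b' b g f).
have {h1 h2} bb : b' = b by lia.
have h1 : (I1 + m' <= J1 + m)%Z by exact: (@positive_le N I1 J1 m m' f g).
have h2 : (J1 + m <= I1 + m')%Z by exact: (@positive_le N J1 I1 m' m g f).
have {h1 h2} mm : (I1 + m' = J1 + m)%Z by lia.
rewrite bb in b'0 gb.
have shift (p : Z) : (I1 - (m - b) < p <= J1 -> 1 <= p ->
    f p = p + m \/ p = 1 /\ f p = - (p + m) /\ m - b = I1)%Z.
  exact: (@body_shift N I1 J1 b m m' f g).
split.
- by suff : (b <= m)%Z by [lia]; exact: (@b_le_m N I1 J1 b m f).
- by lia.
- exact: (@middle_le N I1 J1 b m b m' f g).
- by move=> p; apply: (@body_fixed N I1 J1 b m m' f g).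
- exact: (@body_first N I1 J1 b m m' f g).
- by move=> e; have := shift 1%Z; lia.
- by move=> p hp hp'; have := shift p; lia.
- by move=> p; apply: (@negative_form N I1 J1 b b f g).
- by move=> p; apply: (@middle_form N I1 J1 b m b m' f g).
- by move=> p; apply: (@positive_form N I1 J1 m m' f g).
Qed.

(** * Reflections, descents and ranks in type D *)

Section SignedPermD.

Local Open Scope group_scope.

Variable n : nat.
Local Notation W := (WD n).
Local Notation g := (cox_gen (@coxD n)).
Local Notation ev := (cox_ev (@coxD n)).
Local Notation l := (@cox_length _ (@coxD n)).
Local Notation N := (Z.of_nat n + 2)%Z.
Implicit Types (w x y z r : W) (a : nodeD n).

Definition sperm w : Z -> Z := act (@loD n) (@hiD n) w.

Let rd := root_datumD n.

Lemma spermM x y (p : Z) : sperm (x * y) p = sperm x (sperm y p).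
Proof. exact: actM. Qed.

Lemma sperm1 (p : Z) : sperm 1 p = p. Proof. exact: act1. Qed.

Lemma sperm_odd w : odd_fun (sperm w). Proof. exact: act_odd. Qed.

Lemma spermK w (p : Z) : sperm w^-1 (sperm w p) = p. Proof. exact: actK. Qed.

Lemma spermVK w (p : Z) : sperm w (sperm w^-1 p) = p. Proof. exact: actVK. Qed.

Lemma sperm_inj w : injective (sperm w). Proof. exact: act_inj. Qed.

Lemma sperm_gen a (p : Z) : sperm (g a) p = refl (loD a) (hiD a) p.
Proof. exact: act_gen. Qed.

Lemma sperm_ev_cons a u (p : Z) :
  sperm (ev (a :: u)) p = refl (loD a) (hiD a) (sperm (ev u) p).
Proof. by rewrite cox_ev_cons spermM sperm_gen. Qed.

Lemma sperm_faithful x y : sperm x =1 sperm y -> x = y.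
Proof. exact: act_faithful. Qed.

Lemma genD_inj : injective g. Proof. exact: (cox_gen_inj rd). Qed.

Lemma sperm_asc w a : ~~ right_descent a w -> (sperm w (loD a) < sperm w (hiD a))%Z.
Proof. exact: act_asc. Qed.

Lemma sperm_desc w a : right_descent a w -> (sperm w (hiD a) < sperm w (loD a))%Z.
Proof. exact: act_desc. Qed.

Lemma sperm_conj x r (p q : Z) : sperm r =1 refl p q ->
  sperm (x * r * x^-1) =1 refl (sperm x p) (sperm x q).
Proof. exact: (act_reflection_conj rd). Qed.

Lemma loD_hiD_range a :
  (1 <= Z.abs (loD a) <= N /\ 2 <= hiD a <= N)%Z.
Proof.
case: a => [[]|k]; rewrite /loD /hiD; try lia.
by have : k < n by []; lia.
Qed.

Lemma sperm_range w (p : Z) : (1 <= Z.abs p <= N -> 1 <= Z.abs (sperm w p) <= N)%Z.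
Proof.
rewrite -[w]cox_ev_repr; elim: (repr w) p => [|a u IHu] p hp; first by rewrite sperm1.
have := IHu p hp; rewrite sperm_ev_cons.
move: (sperm _ p) => q; have := loD_hiD_range a; rewrite /refl; refl_cases; lia.
Qed.

Lemma sperm_neq0 w (p : Z) : (p <> 0 -> sperm w p <> 0)%Z.
Proof.
rewrite -[w]cox_ev_repr; elim: (repr w) p => [|a u IHu] p hp; first by rewrite sperm1.
have := IHu p hp; rewrite sperm_ev_cons.
move: (sperm _ p) => q; have := loD_hiD_range a; rewrite /refl; refl_cases; lia.
Qed.

(** The simple root of a is the only positive root that a makes negative. *)
Lemma gen_inverts a (p q : Z) : (p <> 0 -> q <> 0 -> p + q <> 0 -> p < q ->
  refl (loD a) (hiD a) q <= refl (loD a) (hiD a) p ->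
  p = loD a /\ q = hiD a \/ p = - hiD a /\ q = - loD a)%Z.
Proof.
by case: a => [[]|k] h1 h2 h3 h4; rewrite /refl /loD /hiD; refl_cases; lia.
Qed.

Lemma refl_opp (p q : Z) : (p <> 0 -> q <> 0 -> refl (- q) (- p) =1 refl p q)%Z.
Proof. by move=> p0 q0 z; refl_lia. Qed.

(** Induction along a left descent a of w. If a were to reverse the order of the
    images of p and q under a w, these would be the coordinates exchanged by a;
    then a w r = w, so that w r = a w would be shorter than w. *)
Lemma reflection_asc w r (p q : Z) : is_reflection r -> sperm r =1 refl p q ->
  (p < q /\ p <> 0 /\ q <> 0 /\ p + q <> 0)%Z ->
  l w < l (w * r) -> (sperm w p < sperm w q)%Z.
Proof.
move=> rr er [pq [p0 [q0 pq0]]].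
have [k] := ubnP (l w); elim: k w => // k IHk w wk lt.
case: (pselect (w = 1)) => [->|/left_descent_ex [a aw]].
  by rewrite !sperm1.
rewrite /left_descent in aw.
have h1 : l (w * r) <= (l (g a * w * r)).+1.
  by rewrite -mulgA; have := length_gen_mul (g a * (w * r)) a; rewrite gen_mulK.
have lt' : l (g a * w) < l (g a * w * r).
  by have := length_mul_refl_neq (g a * w) rr; lia.
have := IHk (g a * w) ltac:(lia) lt'; set p' := sperm _ p; set q' := sperm _ q.
have ep : sperm w p = refl (loD a) (hiD a) p' by rewrite -sperm_gen -spermM gen_mulK.
have eq : sperm w q = refl (loD a) (hiD a) q' by rewrite -sperm_gen -spermM gen_mulK.
move=> pq''; rewrite ep eq.
have [//|h] : (refl (loD a) (hiD a) p' < refl (loD a) (hiD a) q' \/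
  refl (loD a) (hiD a) q' <= refl (loD a) (hiD a) p')%Z by lia.
have p0' : (p' <> 0)%Z by exact: sperm_neq0.
have q0' : (q' <> 0)%Z by exact: sperm_neq0.
have pq0' : (p' + q' <> 0)%Z.
  move=> e; have : sperm (g a * w) p = sperm (g a * w) (- q) by rewrite sperm_odd -/p'
    -/q'; lia.
  by move/sperm_inj; lia.
have E : g a * w * r * (g a * w)^-1 = g a.
  apply: sperm_faithful => z.
  rewrite (sperm_conj _ er) -/p' -/q' sperm_gen.
  case: (gen_inverts p0' q0' pq0' pq'' h) => [[-> ->]//|[-> ->]].
  by rewrite refl_opp //; have := loD_hiD_range a; lia.
have E' : g a * w * r = w.
  by rewrite -[LHS](mulgVK (g a * w)) E gen_mulK.
have e : w * r = g a * w by apply: (mulgI (g a)); rewrite mulgA E' gen_mulK.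
by rewrite e in lt; lia.
Qed.

Lemma reflection_ascP w r (p q : Z) : is_reflection r -> sperm r =1 refl p q ->
  (p < q /\ p <> 0 /\ q <> 0 /\ p + q <> 0)%Z ->
  (sperm w p < sperm w q)%Z -> l w < l (w * r).
Proof.
move=> rr er h wpq; rewrite ltnNge; apply/negP => le.
have lt : l (w * r) < l (w * r * r).
  by rewrite -mulgA refl_sq // mulg1; have := length_mul_refl_neq w rr; lia.
have := reflection_asc rr er h lt.
rewrite !spermM !er.
have -> : refl p q p = q by refl_lia.
have -> : refl p q q = p by refl_lia.
by lia.
Qed.

Lemma refl_sym (p q : Z) : (p <> 0 -> q <> 0 -> refl p q =1 refl q p)%Z.
Proof. by move=> p0 q0 z; refl_lia. Qed.

Lemma reflection_roots r : is_reflection r -> exists p q,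
  [/\ p < q /\ p <> 0 /\ q <> 0 /\ p + q <> 0, Z.abs p <= N, Z.abs q <= N &
   sperm r =1 refl p q]%Z.
Proof.
case=> u [a ->]; set p := sperm u (loD a); set q := sperm u (hiD a).
have e : sperm (u * g a * u^-1) =1 refl p q by apply: sperm_conj; exact: sperm_gen.
have ha := loD_hiD_range a; have hlt := (lo_hiD a).1.
have ha' : (loD a + hiD a <> 0)%Z by case: {p q e ha hlt} a => [[]|k] /=; lia.
have p0 : (p <> 0)%Z by apply: sperm_neq0; lia.
have q0 : (q <> 0)%Z by apply: sperm_neq0; lia.
have pq : (p <> q)%Z by move/sperm_inj; lia.
have pq' : (p + q <> 0)%Z.
  move=> h; have : p = sperm u (- hiD a) by rewrite sperm_odd -/q; lia.
  by move/sperm_inj; lia.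
have pN : (Z.abs p <= N)%Z by have := @sperm_range u (loD a); rewrite -/p; lia.
have qN : (Z.abs q <= N)%Z by have := @sperm_range u (hiD a); rewrite -/q; lia.
have [h|h] : (p < q \/ q < p)%Z by lia.
  by exists p, q; split.
by exists q, p; split=> // [|z]; [lia | rewrite e refl_sym].
Qed.

Lemma node_ex (p : Z) : (1 <= p < N)%Z -> exists a, loD a = p /\ hiD a = (p + 1)%Z.
Proof.
move=> hp; have [->|p2] : (p = 1 \/ 2 <= p)%Z by lia.
  by exists (inl true).
have h : Z.to_nat (p - 2) < n by lia.
by exists (inr (Ordinal h)) => /=; lia.
Qed.

Lemma reflection_ex (p q : Z) : (1 <= p < q)%Z -> (q <= N)%Z ->
  exists r, is_reflection r /\ sperm r =1 refl p q.
Proof.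
move=> hp hq; rewrite -[q](Zplus_minus (p + 1)).
have : (p + 1 + (q - (p + 1)) <= N)%Z by lia.
have : (0 <= q - (p + 1))%Z by lia.
move: (q - (p + 1))%Z; apply: natlike_ind => [|d d0 IH] hd.
  have [a [la ha]] := @node_ex p ltac:(lia); exists (g a); split; first exact: refl_gen.
  by move=> z; rewrite sperm_gen la ha Z.add_0_r.
have [r [rr er]] := IH ltac:(lia).
have [a [la ha]] := @node_ex (p + 1 + d)%Z ltac:(lia).
exists (g a * r * (g a)^-1); split; first exact: refl_conj.
move=> z; rewrite (sperm_conj _ er) !sperm_gen la ha.
have -> : refl (p + 1 + d) (p + 1 + d + 1) p = p by refl_lia.
have -> // : refl (p + 1 + d) (p + 1 + d + 1) (p + 1 + d) = (p + 1 + Z.succ d)%Z.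
by refl_lia.
Qed.

Lemma reflection_ex_opp (p q : Z) : (1 <= p < q)%Z -> (q <= N)%Z ->
  exists r, is_reflection r /\ sperm r =1 refl (- p) q.
Proof.
move=> hp hq.
have [r1 [rr1 er1]] : exists r, is_reflection r /\ sperm r =1 refl (-1) q.
  have [q2|q2] : (q = 2 \/ 2 < q)%Z by lia.
    by exists (g (inl false)); split; [exact: refl_gen | move=> z; rewrite sperm_gen q2].
  have [x [_ ex]] := @reflection_ex 2 q ltac:(lia) hq.
  exists (x * g (inl false) * x^-1); split; first exact: refl_conj (refl_gen _ _).
  move=> z; rewrite (@sperm_conj _ _ (-1) 2); last exact: sperm_gen.
  rewrite !ex.
  have -> : refl 2 q (-1) = (-1)%Z by refl_lia.
  by have -> : refl 2 q 2 = q by refl_lia.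
have [p1|p1] : (p = 1 \/ 2 <= p)%Z by lia.
  by exists r1; rewrite p1.
have [x [_ ex]] := @reflection_ex 1 p ltac:(lia) ltac:(lia).
exists (x * r1 * x^-1); split; first exact: refl_conj.
move=> z; rewrite (sperm_conj _ er1) !ex.
have -> : refl 1 p (-1) = (- p)%Z by refl_lia.
by have -> : refl 1 p q = q by refl_lia.
Qed.

(** T contains no two opposite positions and is an upper set of the poset of
    positions -N < ... < -2 < -1, 1 < 2 < ... < N, where 1 and -1 are not
    comparable. *)
Definition upper_positions (T : seq Z) : Prop :=
  uniq T /\ forall p, p \in T ->
    [/\ p <> 0, - p \notin T &
     forall q, (p < q <= N)%Z -> q <> 0 -> p + q <> 0 -> q \in T]%Z.

Lemma count_involution (T : seq Z) (h : Z -> Z) (P : pred Z) :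
  uniq T -> involutive h -> {in T, forall p, h p \in T} ->
  count (fun p => P (h p)) T = count P T.
Proof.
move=> Tu hK hT; rewrite -(count_map h); apply/permP/uniq_perm => //.
  by rewrite map_inj_uniq //; exact: inv_inj.
move=> p; apply/mapP/idP => [[q qT ->]|pT]; first exact: hT.
by exists (h p); rewrite ?hK //; exact: hT.
Qed.

Lemma leq_in_count (T : seq Z) (P Q : pred Z) :
  {in T, forall t, P t -> Q t} -> count P T <= count Q T.
Proof.
elim: T => //= t T IHT PQ; apply: leq_add; last first.
  by apply: IHT => u uT; apply: PQ; rewrite inE uT orbT.
by have := PQ t (mem_head _ _); case: (P t) => // ->.
Qed.

(** Multiplication by a reflection exchanging p < q, with x p < x q, lowers the
    value at q and at - p. Either T contains both members of an exchanged pair,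
    and the set of values on T is unchanged, or no value on T is raised. *)
Lemma rank_bruhat (T : seq Z) x y (v : Z) : upper_positions T ->
  bruhat x y -> rank T (sperm x) v <= rank T (sperm y) v.
Proof.
move=> [Tu TP]; elim=> {x y} [x y [r [rr -> lt]]|//|x y z _ xy _ yz];
  last exact: leq_trans yz.
have [p [q [pq pN qN er]]] := reflection_roots rr.
have xpq := reflection_asc rr er pq lt.
case: pq => pq [p0 [q0 pq0]].
have hK : involutive (refl p q) by exact: reflK.
have eT : rank T (sperm (x * r)) v = count (fun t => Z.leb (sperm x (refl p q t)) v) T.
  by apply: eq_count => t; rewrite spermM er.
have swap : (p \in T) && (q \in T) || (- p \in T)%Z && (- q \in T)%Z ->
    rank T (sperm (x * r)) v = rank T (sperm x) v.
  move=> h; rewrite eT (count_involution (fun t => Z.leb (sperm x t) v)) // => t tT.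
  have [_ tT' _] := TP t tT.
  case/orP: h => /andP[pT qT]; rewrite /refl.
  - case: Z.eqb_spec => // _; case: Z.eqb_spec => // _.
    case: Z.eqb_spec => [e|_]; first by move: tT'; rewrite e Z.opp_involutive pT.
    case: Z.eqb_spec => [e|_ //]; by move: tT'; rewrite e Z.opp_involutive qT.
  - case: Z.eqb_spec => [e|_]; first by move: tT'; rewrite e pT.
    case: Z.eqb_spec => [e|_]; first by move: tT'; rewrite e qT.
    by case: Z.eqb_spec => // _; case: Z.eqb_spec.
case: (boolP ((p \in T) && (q \in T) || (- p \in T)%Z && (- q \in T)%Z)) =>
  [/swap -> //|h].
rewrite eT /rank; apply: leq_in_count => t tT /Z.leb_le tv; apply/Z.leb_le.
apply: Z.le_trans tv; have [_ _ up] := TP t tT; rewrite /refl.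
case: Z.eqb_spec => [e|_].
  by case/orP: h; left; rewrite -e tT (up q) //; lia.
case: Z.eqb_spec => [->|_]; first by lia.
case: Z.eqb_spec => [->|_]; first by rewrite !sperm_odd; lia.
case: Z.eqb_spec => [e|_]; last by lia.
by case/orP: h; right; rewrite -e tT (up (- p)%Z) //; lia.
Qed.

(** A change of sign of the single coordinate 1 would have no descent. *)
Lemma sperm_no_flip w : (forall p, (2 <= p <= N)%Z -> sperm w p = p) ->
  Z.abs (sperm w 1) = 1%Z -> w = 1.
Proof.
move=> w2 w1; apply: contrapT => /right_descent_ex [a /sperm_desc].
have [h1 h2] := loD_hiD_range a; rewrite (w2 (hiD a)); last by lia.
case: a h1 h2 => [[]|k]; rewrite /loD /hiD => h1 h2.
- by lia.
- by rewrite (sperm_odd w 1%Z); lia.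
- by rewrite w2; lia.
Qed.

(** Otherwise y x^-1 would change the sign of the single coordinate 1. *)
Lemma sperm_agree x y :
  (forall p, 1 <= p <= N -> sperm x p = sperm y p \/
     Z.abs (sperm x p) = 1 /\ Z.abs (sperm y p) = 1)%Z -> x = y.
Proof.
move=> xy; suff : y * x^-1 = 1 by move=> e; rewrite -[RHS](mulgVK x) e mul1g.
have key (q : Z) : (1 <= Z.abs q <= N -> sperm x q = sperm y q \/
    Z.abs (sperm x q) = 1 /\ Z.abs (sperm y q) = 1)%Z.
  move=> hq; have [h|h] : (0 < q \/ q < 0)%Z by lia.
    by apply: xy; lia.
  have := xy (- q)%Z ltac:(lia); rewrite !sperm_odd; lia.
apply: sperm_no_flip => [p hp|]; rewrite spermM.
  have := key (sperm x^-1 p); rewrite spermVK.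
  by have := @sperm_range x^-1 p; lia.
have := key (sperm x^-1 1%Z); rewrite spermVK.
by have := @sperm_range x^-1 1%Z; lia.
Qed.

End SignedPermD.

(** * The poset of minimal double coset representatives *)

Section MiddleNodes.

Variables (n p : nat).
Hypothesis hp : 1 <= p <= n.

Lemma midD_spec : exists2 k : 'I_n, midD n p = inr k & k.+1 = p.
Proof.
rewrite /midD /toD; case: unliftP => [k e|e].
  by exists k => //; have := congr1 val e; rewrite /= inordK /bump //=; lia.
by have := congr1 val e; rewrite /= inordK //; lia.
Qed.

Lemma not_midD a : predC1 (midD n p) a ->
  match a with inl _ => True | inr k => k.+1 <> p end.
Proof.
have [k -> kp] := midD_spec; case: a => // k' /= kk' e; move: kk'.
by rewrite (inj_eq (@inr_inj _ _)) -(inj_eq val_inj) /=; lia.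
Qed.

End MiddleNodes.

(** Let V and F be spanned by the vectors e_p with p > j + 1 and with p > i + 1,
    respectively. These are the codimensions in w V of its intersections with
    the orthogonal of F and with F; they determine the relative position of w V
    and F up to the sign. *)
Definition bnum n i j (w : WD n) : nat :=
  rank (zseq j.+1 (n.+1 - j)) (sperm w) (- (Z.of_nat i + 1) - 1).
Definition mnum n i j (w : WD n) : nat :=
  rank (zseq j.+1 (n.+1 - j)) (sperm w) (Z.of_nat i + 1).

Section Tail.

Local Open Scope group_scope.

Variables n j : nat.
Hypothesis hj : 1 <= j <= n.
Local Notation W := (WD n).
Local Notation N := (Z.of_nat n + 2)%Z.
Local Notation J1 := (Z.of_nat j + 1)%Z.
Local Notation PJ := (predC1 (midD n j)).

Lemma right_min_grassmannian (z : W) : right_min PJ z -> grassmannian N J1 (sperm z).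
Proof.
move=> zJ; split=> [p hp pJ|].
  have h : Z.to_nat (p - 2) < n by lia.
  have hk : PJ (inr (Ordinal h)).
    have [k -> kj] := midD_spec hj.
    by rewrite /= (inj_eq (@inr_inj _ _)) -(inj_eq val_inj) /=; lia.
  have := sperm_asc (zJ _ hk); rewrite /loD /hiD /=.
  have -> : (Z.of_nat (Z.to_nat (p - 2)) + 2 = p)%Z by lia.
  by have -> : (Z.of_nat (Z.to_nat (p - 2)) + 3 = p + 1)%Z by lia.
have hk e : PJ (inl e) by have [k -> kj] := midD_spec hj.
have := sperm_asc (zJ _ (hk true)); have := sperm_asc (zJ _ (hk false)).
by rewrite /loD /hiD (sperm_odd z 1%Z); lia.
Qed.

Lemma rank_size (T : seq Z) (f : Z -> Z) (v : Z) : rank T f v <= size T.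
Proof. exact: count_size. Qed.

Lemma size_zseq (c k : nat) : size (zseq c k) = k.
Proof. by rewrite size_map size_iota. Qed.

Lemma tail_threshold (f : Z -> Z) (v p : Z) : grassmannian N J1 f ->
  (J1 < p <= N -> (f p <= v <-> p <= J1 + Z.of_nat (rank (zseq j.+1 (n.+1 - j)) f v)))%Z.
Proof.
move=> fgr hp.
have := @rank_threshold f j.+1 (n.+1 - j) v; rewrite Nat2Z.inj_succ.
case/(_ _ p) => [q hq||h1 h2]; [apply: fgr.1; lia | lia |].
by split=> [/h1|h]; [lia | apply: h2; lia].
Qed.

End Tail.

Section DoubleMin.

Local Open Scope group_scope.

Variables n i j : nat.
Hypotheses (hi : 1 <= i <= n) (hj : 1 <= j <= n).
Local Notation W := (WD n).
Local Notation g := (cox_gen (@coxD n)).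
Local Notation l := (@cox_length _ (@coxD n)).
Local Notation N := (Z.of_nat n + 2)%Z.
Local Notation I1 := (Z.of_nat i + 1)%Z.
Local Notation J1 := (Z.of_nat j + 1)%Z.
Local Notation tail := (zseq j.+1 (n.+1 - j)).
Local Notation body := (zseq 0 j.+1).
Local Notation PI := (predC1 (midD n i)).
Local Notation PJ := (predC1 (midD n j)).
Local Notation dmin := (double_min PI PJ).
Local Notation bn := (bnum i j).
Local Notation mn := (mnum i j).
Implicit Types (w x y z r : W) (a : nodeD n).

Lemma dmin_normal_form z : dmin z ->
  normal_form N I1 J1 (Z.of_nat (bn z)) (Z.of_nat (mn z)) (sperm z).
Proof.
move=> [zI zJ].
have fgr : grassmannian N J1 (sperm z) by exact: right_min_grassmannian.
have ggr : grassmannian N I1 (sperm z^-1).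
  by apply: right_min_grassmannian => // a Ia; rewrite right_descentV; exact: zI.
have rk k (f : Z -> Z) (v : Z) : rank (zseq k.+1 (n.+1 - k)) f v <= n.+1 - k.
  by rewrite -[X in _ <= X](size_zseq k.+1) rank_size.
apply: (@grassmannian_normal_form N I1 J1 _ _
  (Z.of_nat (bnum j i z^-1)) (Z.of_nat (mnum j i z^-1)) _ (sperm z^-1)).
- by lia.
- by lia.
- exact: sperm_odd.
- exact: sperm_odd.
- exact: spermK.
- exact: spermVK.
- exact: sperm_range.
- exact: sperm_range.
- exact: fgr.
- exact: ggr.
- by have := rk j (sperm z) (- I1 - 1)%Z; rewrite -/(bnum i j z); lia.
- by have := rk j (sperm z) I1; rewrite -/(mnum i j z); lia.
- by have := rk i (sperm z^-1) (- J1 - 1)%Z; rewrite -/(bnum j i z^-1); lia.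
- by have := rk i (sperm z^-1) J1; rewrite -/(mnum j i z^-1); lia.
- by move=> p; exact: tail_threshold.
- by move=> p; exact: tail_threshold.
- by move=> p; exact: tail_threshold.
- by move=> p; exact: tail_threshold.
Qed.

Lemma dmin_eq x y : dmin x -> dmin y -> bn x = bn y -> mn x = mn y ->
  (mn x = bn x + i.+1 -> (sperm x 1 < 0 <-> sperm y 1 < 0)%Z) -> x = y.
Proof.
move=> /dmin_normal_form cx /dmin_normal_form cy eb em sg.
rewrite -eb -em in cy; apply: sperm_agree => p hp.
have [->|p2] : (p = 1 \/ 2 <= p)%Z by lia.
  by apply: (normal_form_agree1 cx cy) => h; apply: sg; lia.
by apply: (normal_form_agree cx cy); lia.
Qed.

Lemma uniq_zseq (c k : nat) : uniq (zseq c k).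
Proof. by rewrite map_inj_uniq ?iota_uniq //; exact: Nat2Z.inj. Qed.

Lemma rank_tail_mulr w a (v : Z) : PJ a ->
  rank tail (sperm (w * g a)) v = rank tail (sperm w) v.
Proof.
move=> /(not_midD hj) aj; rewrite /rank.
have [a0 [alo ahi]] := lo_hiD a.
rewrite (eq_count (a2 := fun p => Z.leb (sperm w (refl (loD a) (hiD a) p)) v));
  last first.
  by move=> p; rewrite spermM sperm_gen.
apply: (count_involution (h := refl (loD a) (hiD a)) (fun p => Z.leb (sperm w p) v));
  [exact: uniq_zseq|exact: reflK|].
move=> p /mem_zseq hp; apply/mem_zseq; move: aj (loD_hiD_range a) {a0 alo ahi}.
by case: a => [[]|k]; rewrite /loD /hiD /refl; refl_cases; lia.
Qed.

Lemma rank_tail_mull w a (v : Z) : PI a -> v = I1 \/ v = (- I1 - 1)%Z ->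
  rank tail (sperm (g a * w)) v = rank tail (sperm w) v.
Proof.
move=> /(not_midD hi) ai hv; rewrite /rank; apply: eq_in_count => p /mem_zseq hp.
rewrite spermM sperm_gen.
have := @sperm_neq0 n w p ltac:(lia); move: (sperm w p) => q q0.
by move: ai; case: a => [[]|k]; rewrite /loD /hiD /refl; refl_cases;
  do ?case: Z.leb_spec; lia.
Qed.

(** When the body is sent outside - (i + 1), ..., i + 1, the parity of the number
    of its negative values is an invariant of the double coset. *)
Definition far w := forall p, (1 <= p <= J1)%Z -> (I1 < Z.abs (sperm w p))%Z.
Definition sign_parity w : bool := odd (count (fun p => Z.ltb (sperm w p) 0) body).

Lemma far_mulr w a : PJ a -> far w -> far (w * g a).
Proof.
move=> /(not_midD hj) aj wf p hp; rewrite spermM sperm_gen.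
have key (q : Z) : (1 <= Z.abs q <= J1 -> I1 < Z.abs (sperm w q))%Z.
  move=> hq; have [h|h] : (0 < q \/ q < 0)%Z by lia.
    by apply: wf; lia.
  by have := wf (- q)%Z ltac:(lia); rewrite sperm_odd; lia.
apply: key; move: aj.
by case: a => [[]|k]; rewrite /loD /hiD /refl; refl_cases; lia.
Qed.

Lemma far_mull w a : PI a -> far w -> far (g a * w).
Proof.
move=> /(not_midD hi) ai wf p /wf; rewrite spermM sperm_gen.
move: (sperm w p) => q; move: ai.
by case: a => [[]|k]; rewrite /loD /hiD /refl; refl_cases; lia.
Qed.

Lemma sign_parity_mull w a : PI a -> far w -> sign_parity (g a * w) = sign_parity w.
Proof.
move=> /(not_midD hi) ai wf; congr odd; apply: eq_in_count => p /mem_zseq hp.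
have := wf p ltac:(lia); rewrite spermM sperm_gen; move: (sperm w p) => q.
move: ai; case: a => [[]|k]; rewrite /loD /hiD /refl; refl_cases; do ?case: Z.ltb_spec;
  lia.
Qed.

Lemma body_cons : body = 1%Z :: 2%Z :: zseq 2 j.-1.
Proof. by case: (j) hj => // j'; case/andP. Qed.

Lemma sign_parity_mulr w a : PJ a -> sign_parity (w * g a) = sign_parity w.
Proof.
move=> /(not_midD hj) aj; rewrite /sign_parity.
have [a0 [alo ahi]] := lo_hiD a.
rewrite (eq_count (a2 := fun p => Z.ltb (sperm w (refl (loD a) (hiD a) p)) 0));
  last first.
  by move=> p; rewrite spermM sperm_gen.
case: a aj a0 alo ahi => [[]|k] aj a0 alo ahi.
- congr odd; apply: (count_involution (h := refl (loD _) (hiD _)) (fun p =>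
  Z.ltb (sperm w p) 0)); [exact: uniq_zseq|exact: reflK|].
  by move=> p /mem_zseq hp; apply/mem_zseq; rewrite /loD /hiD /refl; refl_cases; lia.
- rewrite body_cons /=.
  have -> : count (fun p => Z.ltb (sperm w (refl (-1) 2 p)) 0) (zseq 2 j.-1)
          = count (fun p => Z.ltb (sperm w p) 0) (zseq 2 j.-1).
    apply: eq_in_count => p /mem_zseq hp; congr (Z.ltb (sperm w _) 0).
    by rewrite /refl; refl_cases; lia.
  have -> : refl (-1) 2 1 = (-2)%Z by [].
  have -> : refl (-1) 2 2 = (-1)%Z by [].
  rewrite (sperm_odd w 2%Z) (sperm_odd w 1%Z) !addnA !oddD; congr (_ (+) _).
  have := @sperm_neq0 n w 1%Z ltac:(lia); have := @sperm_neq0 n w 2%Z ltac:(lia).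
  by do 4!case: Z.ltb_spec => //; lia.
- congr odd; apply: (count_involution (h := refl (loD _) (hiD _)) (fun p =>
  Z.ltb (sperm w p) 0)); [exact: uniq_zseq|exact: reflK|].
  by move=> p /mem_zseq hp; apply/mem_zseq; rewrite /loD /hiD /refl; refl_cases; lia.
Qed.

Lemma double_coset_parameters x y : double_coset PI PJ x y ->
  [/\ bn y = bn x, mn y = mn x & far x -> sign_parity y = sign_parity x].
Proof.
move=> xy; suff [-> -> h] : [/\ bn y = bn x, mn y = mn x &
    far x -> far y /\ sign_parity y = sign_parity x].
  by split=> // /h [].
apply: (double_coset_invariant (Q := fun w => [/\ bn w = bn x, mn w = mn x &
    far x -> far w /\ sign_parity w = sign_parity x])) xy _ => [w a Ia|w a Ja|//].
- move=> [<- <- h]; split; [by apply: rank_tail_mull; auto|by apply: rank_tail_mull;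
  auto|].
  by move=> /h [wf <-]; split; [exact: far_mull|exact: sign_parity_mull].
- move=> [<- <- h]; split; [by exact: rank_tail_mulr|by exact: rank_tail_mulr|].
  by move=> /h [wf <-]; split; [exact: far_mulr|exact: sign_parity_mulr].
Qed.

Hypothesis hij : i <= j.

Lemma dmin_bounds z : dmin z -> bn z <= mn z <= n.+1 - j /\ mn z <= bn z + i.+1.
Proof. by case/(dmin_normal_form) => *; lia. Qed.

Lemma rank_change (T : seq Z) (f f' : Z -> Z) (p v : Z) : uniq T -> p \in T ->
  {in T, forall q, q <> p -> f q = f' q} ->
  rank T f v + (Z.leb (f' p) v) = rank T f' v + (Z.leb (f p) v).
Proof.
move=> Tu pT ff'; rewrite /rank !(permP (perm_to_rem pT)) /=.
have -> : count (fun q => Z.leb (f q) v) (rem p T) = count (fun q =>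
  Z.leb (f' q) v) (rem p T).
  apply: eq_in_count => q; rewrite mem_rem_uniq // inE => /andP[/eqP qp qT].
  by rewrite ff'.
by rewrite addnC [X in _ + X]addnC addnA.
Qed.

Lemma body_positive z p : dmin z -> (2 <= p <= J1 -> 0 < sperm z p)%Z.
Proof.
case=> _ zJ hp; have := body_abs _ (right_min_grassmannian hj zJ) hp.
by lia.
Qed.

Lemma sign_parity_first w : (forall p, 2 <= p <= J1 -> 0 < sperm w p)%Z ->
  sign_parity w <-> (sperm w 1 < 0)%Z.
Proof.
move=> wp; rewrite /sign_parity -[zseq 0 j.+1]/(1%Z :: zseq 1 j) /=.
rewrite (eq_in_count (a2 := pred0)) ?count_pred0 ?addn0.
  by case: Z.ltb_spec; split=> //; lia.
by move=> p /mem_zseq hp /=; case: Z.ltb_spec => //; have := wp p; lia.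
Qed.

Lemma dmin_sign z : dmin z -> sign_parity z <-> (sperm z 1 < 0)%Z.
Proof. by move=> zm; apply: sign_parity_first => p; exact: body_positive. Qed.

Lemma dmin_far z : dmin z -> mn z = bn z + i.+1 -> far z.
Proof.
move=> /(dmin_normal_form) zf c p hp.
have [->|p2] : (p = 1 \/ 2 <= p)%Z by lia.
  by rewrite (nf_first_shift zf); lia.
by rewrite (nf_shift zf); lia.
Qed.

Lemma double_coset_dmin_eq z z' y : dmin z -> dmin z' ->
  double_coset PI PJ z y -> double_coset PI PJ z' y -> z = z'.
Proof.
move=> zm z'm /(double_coset_parameters) [b1 m1 s1].
move=> /(double_coset_parameters) [b2 m2 s2].
apply: (dmin_eq) => //; [lia|lia|move=> c].
rewrite -(dmin_sign zm) -(dmin_sign z'm) -s1 -?s2 //; apply: dmin_far => //; lia.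
Qed.

(** The reflection changes, on the tail, the value at p only, so that ranks change
    by at most one. *)
Lemma dmin_reflect z r (p q : Z) : dmin z -> is_reflection r -> sperm r =1 refl q p ->
  (Z.abs q <= J1 < p)%Z -> (p <= N)%Z -> (q <> 0)%Z -> (sperm z q < sperm z p)%Z ->
  exists z', [/\ dmin z', bruhat z z', double_coset PI PJ z' (z * r) &
   bn z' + Z.leb (sperm z p) (- I1 - 1) = bn z + Z.leb (sperm z q) (- I1 - 1) /\
   mn z' + Z.leb (sperm z p) I1 = mn z + Z.leb (sperm z q) I1].
Proof.
move=> zm rr er hq hp q0 zqp.
have pT : p \in tail by apply/mem_zseq; lia.
have zr : bruhat z (z * r).
  apply: (bruhat_mul_refl rr); apply: (reflection_ascP rr er _ zqp).
  by lia.
have [z' [z'm z'zr _ h]] := double_min_ex PI PJ (z * r).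
exists z'; split=> //; first exact: h.
have [<- <- _] := double_coset_parameters z'zr.
have ep : sperm (z * r) p = sperm z q.
  by rewrite spermM er; congr (sperm z _); rewrite /refl; refl_cases; lia.
have eT : {in tail, forall t, t <> p -> sperm z t = sperm (z * r) t}.
  move=> t /mem_zseq ht tp; rewrite spermM er; congr (sperm z _).
  by rewrite /refl; refl_cases; lia.
have e1 := rank_change (- I1 - 1) (uniq_zseq _ _) pT eT.
have e2 := rank_change I1 (uniq_zseq _ _) pT eT.
by rewrite !ep in e1 e2; rewrite /bnum /mnum; lia.
Qed.

(** The first fixed point p of the tail is exchanged with 1 or with -1, whose
    values are 1 and -1: a value above i + 1 is replaced by one in the body.
    If no further raise is possible, the choice between 1 and -1 decides on the
    sign. *)
Lemma dmin_raise z (e : bool) : dmin z -> mn z < n.+1 - j -> mn z <= bn z + i ->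
  exists z', [/\ dmin z', bruhat z z', bn z' = bn z, mn z' = (mn z).+1 &
    mn z' = bn z' + i.+1 -> (sperm z' 1 < 0)%Z <-> e].
Proof.
move=> zm mr mi; have zf := dmin_normal_form zm.
have [bm _] := dmin_bounds zm.
pose p := (J1 + Z.of_nat (mn z) + 1)%Z; pose q := (if e then (-1)%Z else 1%Z).
have zp : sperm z p = p by apply: (nf_pos zf); lia.
have z1 : Z.abs (sperm z 1) = 1%Z by apply: (nf_first zf); lia.
have zq : Z.abs (sperm z q) = 1%Z by rewrite /q; case: (e) => //;
  rewrite (sperm_odd z 1%Z); lia.
have [r [rr er]] : exists r, is_reflection r /\ sperm r =1 refl q p.
  by rewrite /q; case: (e); [apply: (@reflection_ex_opp n 1%Z p)|apply: reflection_ex];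
    lia.
have hq : Z.abs q = 1%Z by rewrite /q; case: (e).
have pI : (I1 < sperm z p)%Z by rewrite zp; lia.
have [z' [z'm zz' z'zr [eb em]]] :=
  @dmin_reflect z r p q zm rr er ltac:(lia) ltac:(lia) ltac:(lia) ltac:(lia).
have eb' : bn z' = bn z by move: eb; do 2!case: Z.leb_spec => /=; lia.
have em' : mn z' = (mn z).+1 by move: em; do 2!case: Z.leb_spec => /=; lia.
exists z'; split=> // hc.
have [_ _ /(_ (dmin_far z'm hc)) sgn] := double_coset_parameters z'zr.
rewrite -(dmin_sign z'm) -sgn sign_parity_first.
  rewrite spermM er /q; case: (e).
    have -> : refl (-1) p 1 = (- p)%Z by refl_lia.
    by rewrite sperm_odd zp; split=> //; lia.
  have -> : refl 1 p 1 = p by refl_lia.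
  by rewrite zp; split=> //; lia.
move=> t ht; rewrite spermM er; have -> : refl q p t = t by refl_lia.
exact: body_positive.
Qed.

(** The last position of the tail with a value in the body is exchanged with
    - (j + 1), where the value is below - (i + 1). *)
Lemma dmin_negate z : dmin z -> bn z < mn z ->
  exists z', [/\ dmin z', bruhat z z', bn z' = (bn z).+1 & mn z' = mn z].
Proof.
move=> zm bm; have zf := dmin_normal_form zm.
have [_ mi] := dmin_bounds zm; have := nf_m zf => mr.
pose p := (J1 + Z.of_nat (mn z))%Z; pose q := (- J1)%Z.
have zp : sperm z p = I1 by have := nf_mid zf (p := p) ltac:(lia); lia.
have zq : sperm z q = (- p)%Z by rewrite sperm_odd (nf_shift zf); lia.
have [r [rr er]] : exists r, is_reflection r /\ sperm r =1 refl q p.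
  by apply: reflection_ex_opp; lia.
have [z' [z'm zz' z'zr [eb em]]] :=
  @dmin_reflect z r p q zm rr er ltac:(lia) ltac:(lia) ltac:(lia) ltac:(lia).
exists z'; split=> //.
  by move: eb; do 2!case: Z.leb_spec => /=; lia.
by move: em; do 2!case: Z.leb_spec => /=; lia.
Qed.

(** As long as the target is not reached, one of the two steps stays within the
    bounds: if b is to grow and no value of the tail lies in the body, m is to
    grow as well. *)
Lemma dmin_above z b m (e : bool) : dmin z -> bn z <= b -> mn z <= m ->
  b <= m <= n.+1 - j -> m <= b + i.+1 ->
  (bn z = b -> mn z = m -> m = b + i.+1 -> (sperm z 1 < 0)%Z <-> e) ->
  exists z', [/\ dmin z', bruhat z z', bn z' = b, mn z' = m &
    m = b + i.+1 -> (sperm z' 1 < 0)%Z <-> e].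
Proof.
have [k] := ubnP ((b - bn z) + (m - mn z)); elim: k z => // k IHk z hk zm hb hm bm mi ze.
have [zbm zmi] := dmin_bounds zm.
have next z1 : dmin z1 -> bruhat z z1 -> bn z1 <= b -> mn z1 <= m ->
    (b - bn z1) + (m - mn z1) < (b - bn z) + (m - mn z) ->
    (bn z1 = b -> mn z1 = m -> m = b + i.+1 -> (sperm z1 1 < 0)%Z <-> e) ->
    exists z', [/\ dmin z', bruhat z z', bn z' = b, mn z' = m &
      m = b + i.+1 -> (sperm z' 1 < 0)%Z <-> e].
  move=> z1m zz1 hb1 hm1 hk1 ze1.
  have [|z' [z'm z1z' eb em ee]] := IHk z1 _ z1m hb1 hm1 bm mi ze1; first by lia.
  by exists z'; split=> //; exact: bruhat_trans z1z'.
have [[h1 h2]|[h|h]] : (bn z = b /\ mn z = m) \/ (bn z < b /\ bn z < mn z) \/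
    (mn z < m /\ mn z <= bn z + i) by lia.
- exists z; split=> //; [exact: bruhat_refl|exact: ze].
- have [z1 [z1m zz1 eb em]] := dmin_negate zm h.2.
  by apply: (next z1) => //; lia.
- have [z1 [z1m zz1 eb em ee]] := @dmin_raise z e zm ltac:(lia) h.2.
  by apply: (next z1) => //; [lia|lia|lia|move=> eb1 em1 hc; apply: ee; lia].
Qed.

Lemma dmin1 : [/\ dmin (1 : W), bn (1 : W) = 0 & mn (1 : W) = 0].
Proof.
have d1 a : ~~ right_descent a (1 : W) by rewrite /right_descent length1.
split; first by split=> a _ //; rewrite -right_descentV invg1.
  rewrite /bnum /rank (eq_in_count (a2 := pred0)) ?count_pred0 // => p /mem_zseq hp.
  by rewrite sperm1 /=; case: Z.leb_spec => //; lia.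
rewrite /mnum /rank (eq_in_count (a2 := pred0)) ?count_pred0 // => p /mem_zseq hp.
by rewrite sperm1 /=; case: Z.leb_spec => //; lia.
Qed.

Lemma dmin_ex b m (e : bool) : b <= m <= n.+1 - j -> m <= b + i.+1 ->
  exists z, [/\ dmin z, bn z = b, mn z = m & m = b + i.+1 -> (sperm z 1 < 0)%Z <-> e].
Proof.
move=> bm mi; have [d1 b1 m1] := dmin1.
have [|||z [zm _ eb em ee]] := dmin_above (e := e) (b := b) (m := m) d1 _ _ bm mi.
- by rewrite b1.
- by rewrite m1.
- by rewrite b1 m1; lia.
- by exists z.
Qed.

Lemma upper_tail : upper_positions n tail.
Proof.
split; first exact: uniq_zseq.
move=> p /mem_zseq hp; split; [lia|by apply/negP => /mem_zseq; lia|].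
by move=> q hq q0 pq; apply/mem_zseq; lia.
Qed.

Lemma upper_from_first (s : Z) : Z.abs s = 1%Z -> upper_positions n (s :: zseq 1 n.+1).
Proof.
move=> hs; split.
  by rewrite cons_uniq uniq_zseq andbT; apply/negP => /mem_zseq; lia.
move=> p; rewrite inE => hp.
have hp' : (p = s \/ 2 <= p <= N)%Z.
  by case/orP: hp => [/eqP|/mem_zseq] h; lia.
split; first by lia.
  by rewrite inE; apply/negP => /orP[/eqP|/mem_zseq] h; lia.
move=> q hq q0 pq; rewrite inE; apply/orP; right; apply/mem_zseq; lia.
Qed.

(** Elements that differ by the sign have the same ranks b and m. They are
    separated by a rank over the upper set formed of 2, ..., N and of the one of
    1 and -1 at which x is negative. *)
Lemma dmin_sign_bruhat x y : dmin x -> dmin y -> bn x = bn y -> mn x = mn y ->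
  mn x = bn x + i.+1 -> bruhat x y -> (sperm x 1 < 0 <-> sperm y 1 < 0)%Z.
Proof.
move=> xm ym eb em c xy.
have xf := dmin_normal_form xm; have yf := dmin_normal_form ym.
rewrite -eb -em in yf.
have x1 := nf_first_shift xf ltac:(lia); have y1 := nf_first_shift yf ltac:(lia).
(* At s the value of x is - (1 + m); the values of x and y at 2, ..., N only    *)
(* differ by the sign of 1.                                                    *)
pose s := (if Z.ltb (sperm x 1) 0 then 1 else -1)%Z.
have hs : Z.abs s = 1%Z by rewrite /s; case: ifP.
have := rank_bruhat (- (1 + Z.of_nat (mn x))) (upper_from_first hs) xy.
have E f v : rank (s :: zseq 1 n.+1) f v = Z.leb (f s) v + rank (zseq 1 n.+1) f v by [].
rewrite !{}E.
have -> : rank (zseq 1 n.+1) (sperm x) (- (1 + Z.of_nat (mn x)))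
        = rank (zseq 1 n.+1) (sperm y) (- (1 + Z.of_nat (mn x))).
  apply: eq_in_count => p /mem_zseq hp.
  have := normal_form_agree xf yf (q := p) ltac:(lia).
  by do 2!case: Z.leb_spec => //; lia.
have sx : sperm x s = (- (1 + Z.of_nat (mn x)))%Z.
  by rewrite /s; case: Z.ltb_spec => h; rewrite ?(sperm_odd x 1%Z); lia.
have sy : sperm y s = (if Z.ltb (sperm x 1) 0 then sperm y 1 else - sperm y 1)%Z.
  by rewrite /s; case: ifP => // _; rewrite (sperm_odd y 1%Z).
rewrite leq_add2r sx sy Z.leb_refl.
by case: Z.ltb_spec => h; case: Z.leb_spec => //; lia.
Qed.

Lemma dmin_bruhat x y : dmin x -> dmin y ->
  bruhat x y <-> [/\ bn x <= bn y, mn x <= mn y &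
    bn x = bn y -> mn x = mn y -> mn x = bn x + i.+1 ->
    (sperm x 1 < 0 <-> sperm y 1 < 0)%Z].
Proof.
move=> xm ym; split=> [xy|[hb hm he]].
  split; [exact: rank_bruhat upper_tail xy|exact: rank_bruhat upper_tail xy|].
  by move=> eb em c; exact: dmin_sign_bruhat xy.
have [b1 b2] := dmin_bounds ym.
have ey : (sperm y 1 < 0)%Z <-> Z.ltb (sperm y 1) 0 by apply: rwP; exact: Z.ltb_spec0.
have [z [zm xz eb em ee]] := dmin_above (e := Z.ltb (sperm y 1) 0) xm hb hm b1 b2
  (fun h1 h2 h3 => iff_trans (he h1 h2 ltac:(lia)) ey).
suff -> : y = z by [].
apply: (dmin_eq) => // c; rewrite ee; [exact: ey|lia].
Qed.

(** W is finite, as w is determined by the values w 1, ..., w N, which become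
    natural numbers after a shift by N. *)
Lemma length_bounded : exists B, forall w, l w <= B.
Proof.
pose F w : {ffun 'I_n.+2 -> 'I_(n.+2).*2.+1} :=
  [ffun p => inord (Z.to_nat (sperm w (Z.of_nat (val p) + 1) + N))].
have Finj : injective F.
  move=> x y /ffunP xy; apply: sperm_agree => p hp; left.
  have hp' : Z.to_nat (p - 1) < n.+2 by lia.
  have := congr1 val (xy (Ordinal hp')); rewrite !ffunE /=.
  have -> : (Z.of_nat (Z.to_nat (p - 1)) + 1 = p)%Z by lia.
  have := @sperm_range n x p ltac:(lia); have := @sperm_range n y p ltac:(lia).
  by move=> h1 h2; rewrite !inordK; lia.
pose L f := if pselect (exists w, F w = f) is left e then l (projT1 (cid e)) else 0.
exists (\max_f L f) => w; suff -> : l w = L (F w) by exact: leq_bigmax.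
rewrite /L; case: pselect => [e|[]]; last by exists w.
by congr l; apply: Finj; case: (cid e).
Qed.

Lemma dmin_descents z : dmin z -> z <> 1 ->
  left_descent (midD n i) z /\ right_descent (midD n j) z.
Proof.
move=> [zI zJ] z1; split.
  have [a za] := left_descent_ex z1; have [<-//|ai] := eqVneq a (midD n i).
  by have := zI a ai; rewrite za.
have [a za] := right_descent_ex z1; have [<-//|aj] := eqVneq a (midD n j).
by have := zJ a aj; rewrite za.
Qed.

Lemma dmin_eq1 z : dmin z -> mn z = 0 -> z = 1.
Proof.
move=> zm m0; have [d1 b1 m1] := dmin1.
have [h _] := dmin_bounds zm.
by apply: (dmin_eq) => //; rewrite ?b1 ?m1; lia.
Qed.

Lemma join_irreducible_dmin w : JI (midD n i) (midD n j) w -> dmin w /\ 0 < mn w.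
Proof.
move=> [wJ wi wj].
have wm : dmin w.
  split=> a ha; apply/negP => wa; move: ha; rewrite /=.
    by rewrite (join_irreducible_left_descent (@genD_inj n) wJ wa wi) eqxx.
  by rewrite (join_irreducible_right_descent (@genD_inj n) wJ wa wj) eqxx.
split=> //; rewrite lt0n; apply/eqP => m0; move: wi.
by rewrite (dmin_eq1 wm m0) /left_descent length1.
Qed.

(** Otherwise w is the supremum of the elements of P strictly below it: those
    with parameters (b, b) and either (0, m) or (m - i - 1, m) force every upper
    bound in P to have parameters at least b and m, and w has no sign. *)
Lemma join_irreducible_parameters w : JI (midD n i) (midD n j) w ->
  [\/ bn w = 0 /\ mn w <= i, bn w = mn w | mn w = bn w + i.+1].
Proof.
move=> wJI; have [wm m0] := join_irreducible_dmin wJI.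
have [bm mi] := dmin_bounds wm.
apply: contrapT => h.
have {h} [b0 [bm' mi']] : 0 < bn w /\ bn w < mn w /\ mn w <= bn w + i.
  suff : ~ ((bn w = 0 /\ mn w <= i) \/ bn w = mn w \/ mn w = bn w + i.+1) by lia.
  by move=> [h1|[h1|h1]]; apply: h; [constructor 1|constructor 2|constructor 3].
case: wJI => wJ _ _; apply: wJ.
exists [set x | [/\ dmin x, bruhat x w & x <> w]]%classic; split; last by case.
split=> [x [] //|y Uy].
have [z [zm _ zy zmax]] := double_min_ex PI PJ y.
suff wz : bruhat w z by exact: bruhat_trans wz zy.
have below b m : b <= bn w -> m <= mn w -> b <= m <= n.+1 - j -> m <= b + i.+1 ->
    b <> bn w \/ m <> mn w -> b <= bn z /\ m <= mn z.
  move=> hb hm hbm hmi ne.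
  have [x [xm xb xmn xe]] := dmin_ex true hbm hmi.
  have xw : bruhat x w.
    by apply/(dmin_bruhat) => //; rewrite xb xmn; split=> //; lia.
  have /(zmax _ xm) : bruhat x y.
    by apply: Uy; split=> // ex; rewrite ex in xb xmn; lia.
  by case/(dmin_bruhat) => // h1 h2 _; lia.
apply/(dmin_bruhat) => //; split; last by lia.
  by have := below (bn w) (bn w); lia.
have [h|h] : mn w <= i \/ i < mn w by lia.
  by have := below 0 (mn w); lia.
by have := below (mn w - i.+1) (mn w); lia.
Qed.

(** The maximal element y of the double coset of z is above every x < d, because
    the minimal representative of the double coset of x is below z, and it is
    not above d. *)
Lemma dmin_witness d z : dmin d -> dmin z ->
  (forall x, dmin x -> bruhat x d -> x <> d -> bruhat x z) -> ~ bruhat d z ->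
  join_irreducible d.
Proof.
move=> dm zm dz ndz; have [B lB] := length_bounded.
have [y ymax zy] := double_max_ex PI PJ z lB.
have [z' [z'm z'y z'ley ymin]] := double_min_ex PI PJ y.
have ez := double_coset_dmin_eq z'm zm z'y zy; subst z'.
apply: (join_irreducible_witness (y := y)) => [x xd nxd|dy]; last by apply/ndz/ymin.
have [x0 [x0m x0x x0lex _]] := double_min_ex PI PJ x.
apply: double_max_ge ymax x0x _; apply: bruhat_trans z'ley.
apply: dz => //; first exact: bruhat_trans xd.
by move=> e; apply: nxd; apply: bruhat_anti => //; rewrite -e.
Qed.

(** The witness has parameters (m - 1, m) if b = m, and (m - 1, m - 1) otherwise:
    in the first case an element strictly below z has a smaller b, in the second
    one a smaller m. *)
Lemma dmin_join_irreducible z : dmin z -> 0 < mn z ->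
  [\/ bn z = 0 /\ mn z <= i, bn z = mn z | mn z = bn z + i.+1] ->
  JI (midD n i) (midD n j) z.
Proof.
move=> zm m0 h; have [zi zj] : left_descent (midD n i) z /\ right_descent (midD n j) z.
  apply: dmin_descents => // z1; move: m0; rewrite z1.
  by have [_ _ ->] := dmin1.
split=> //; have [bm mi] := dmin_bounds zm.
have [e|ne] := eqVneq (bn z) (mn z).
- have [z0 [z0m b0 m0' _]] := dmin_ex (b := (mn z).-1) (m := mn z) true
    ltac:(lia) ltac:(lia).
  apply: (dmin_witness zm z0m) => [x xm|].
    move=> /(dmin_bruhat xm zm) [h1 h2 _] xz.
    have [hx _] := dmin_bounds xm.
    apply/(dmin_bruhat) => //; split; [|lia|lia].
    have [//|h3] : bn x <= bn z0 \/ bn x = mn z by lia.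
    by case: xz; apply: (dmin_eq) => //; lia.
  by move=> /(dmin_bruhat zm z0m) [h1 _ _]; lia.
- have [z0 [z0m b0 m0' _]] := dmin_ex (b := (mn z).-1) (m := (mn z).-1) true
    ltac:(lia) ltac:(lia).
  apply: (dmin_witness zm z0m) => [x xm|].
    move=> /(dmin_bruhat xm zm) [h1 h2 h3] xz.
    have [hx hx'] := dmin_bounds xm.
    have mx : mn x < mn z.
      rewrite ltn_neqAle h2 andbT; apply/eqP => em; apply: xz.
      have eb : bn x = bn z by case: h => [[]|/eqP|]; [lia|by rewrite (negbTE ne)|lia].
      by apply: (dmin_eq) => //; exact: h3.
    by apply/(dmin_bruhat) => //; split; lia.
  by move=> /(dmin_bruhat zm z0m) [_ h2 _]; lia.
Qed.

End DoubleMin.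

(** * The order on labels *)

Section Labels.

Variables n i j : nat.
Hypotheses (hi : 1 <= i) (hij : i <= j) (hj : j <= n).
Implicit Types (lb : label) (k : nat).

Definition label_b lb : nat :=
  match lb with TypeOA k => 0 | TypeOB _ k => k - i.+1 | TypeX k => k end.

Definition label_m lb : nat :=
  match lb with TypeOA k | TypeOB _ k | TypeX k => k end.

(** The sign of the rightmost letter 0 when that of the leftmost one is e and the
    signs of the k - i letters 0 alternate; it decides on the sign of the value
    at 1. *)
Definition label_neg lb : bool :=
  if lb is TypeOB e k then ~~ (e (+) odd (k - i.+1)) else false.

Definition label_le lb lb' : Prop :=
  [/\ label_b lb <= label_b lb', label_m lb <= label_m lb' &
    label_b lb = label_b lb' -> label_m lb = label_m lb' ->
    label_m lb = label_b lb + i.+1 -> label_neg lb = label_neg lb'].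

Lemma generating_label_le lb lb' : clos_refl_trans label (generating n i j) lb lb' ->
  label_le lb lb'.
Proof.
elim=> {lb lb'} [lb lb' []|lb|lb1 lb2 lb3 _ [h1 h2 h3] _ [h4 h5 h6]].
- by move=> k hk; split=> //=; lia.
- by move=> e h; split=> /=; lia.
- by move=> e e' k hk; split=> /=; lia.
- by move=> k hk; split=> /=; lia.
- by move=> k hk; split=> /=; lia.
- by move=> e k hk; split=> /=; lia.
- by move=> e k hk; split=> /=; lia.
- by split.
- split; [lia|lia|move=> h7 h8 h9].
  by rewrite h3 ?h6; lia.
Qed.

Local Notation R := (clos_refl_trans label (generating n i j)).

Let gen lb lb' : generating n i j lb lb' -> R lb lb'. Proof. exact: rt_step. Qed.
Let trans lb2 lb1 lb3 : R lb1 lb2 -> R lb2 lb3 -> R lb1 lb3. Proof. exact: rt_trans. Qed.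

Lemma generating_OA k k' : 1 <= k <= k' -> k' <= minn i (n.+1 - j) ->
  R (TypeOA k) (TypeOA k').
Proof.
elim: k' => [|k' IHk'] hk hk'; first by lia.
have [->|ne] := eqVneq k k'.+1; first exact: rt_refl.
apply: (trans (IHk' _ _)); [lia|lia|].
by apply/gen/Gen_OA_OA; lia.
Qed.

Lemma generating_OB e e' k k' : i < k < k' -> k' <= n.+1 - j ->
  R (TypeOB e k) (TypeOB e' k').
Proof.
elim: k' e' => [|k' IHk'] e' hk hk'; first by lia.
have [->|ne] := eqVneq k k'; first by apply/gen/Gen_OB_OB; lia.
apply: (trans (IHk' e' _ _)); [lia|lia|].
by apply/gen/Gen_OB_OB; lia.
Qed.

Lemma generating_X k k' : 1 <= k <= k' -> k' <= n.+1 - j -> R (TypeX k) (TypeX k').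
Proof.
elim: k' => [|k' IHk'] hk hk'; first by lia.
have [->|ne] := eqVneq k k'.+1; first exact: rt_refl.
apply: (trans (IHk' _ _)); [lia|lia|].
by apply/gen/Gen_X_X; lia.
Qed.

Lemma label_le_generating lb lb' : valid_label n i j lb -> valid_label n i j lb' ->
  label_le lb lb' -> R lb lb'.
Proof.
case: lb => [k|e k|k]; case: lb' => [k'|e' k'|k'] /= v v' [/= hb hm hs].
- by apply: generating_OA; lia.
- apply: (trans (generating_OA (k' := i) _ _)); [lia|lia|].
  have [->|ne] := eqVneq k' i.+1; first by apply/gen/Gen_OA_OB; lia.
  apply: (trans (lb2 := TypeOB e' i.+1)); first by apply/gen/Gen_OA_OB; lia.
  by apply: generating_OB; lia.
- apply: (trans (lb2 := TypeX k)); first by apply/gen/Gen_OA_X.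
  by apply: generating_X; lia.
- by lia.
- have [ek|ne] := eqVneq k k'; last by apply: generating_OB; lia.
  have := hs ltac:(lia) ek ltac:(lia); rewrite ek => /negb_inj/addIb ->.
  exact: rt_refl.
- apply: (trans (lb2 := TypeX k)); first by apply/gen/Gen_OB_X.
  by apply: generating_X; lia.
- by lia.
- have -> : k' = (k' - i.+1 + i).+1 by lia.
  apply: (trans (generating_X (k' := k' - i.+1) _ _)); [lia|lia|].
  by apply/gen/Gen_X_OB; lia.
- by apply: generating_X; lia.
Qed.

End Labels.

(** * The signed permutations of the given words *)

Ltac compare_cases :=
  repeat match goal with
  | |- context [?op ?x ?y] =>
      lazymatch op with Z.eqb => idtac | Z.leb => idtac | Z.ltb => idtac end;
      lazymatch constr:((x, y)) with
      | context [Z.eqb] => fail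
      | context [Z.leb] => fail
      | context [Z.ltb] => fail
      | _ => lazymatch op with
             | Z.eqb => destruct (Z.eqb_spec x y)
             | Z.leb => destruct (Z.leb_spec x y)
             | Z.ltb => destruct (Z.ltb_spec x y)
             end; cbv iota beta delta [andb]; try (exfalso; lia)
      end
  end; try lia.

Section Words.

Local Open Scope Z_scope.

Definition letter_act (a : nat) : Z -> Z :=
  refl (if a == 0%N then -2 else Z.of_nat a + 1) (Z.of_nat a + 2).

Definition letters_act (u : seq nat) (z : Z) : Z := foldr letter_act z u.

Lemma letters_act_cat u v z : letters_act (u ++ v) z = letters_act u (letters_act v z).
Proof. by rewrite /letters_act foldr_cat. Qed.

Lemma letters_act_cons a u z : letters_act (a :: u) z = letter_act a (letters_act u z).
Proof. by []. Qed.

Lemma letter_act_odd a : odd_fun (letter_act a).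
Proof. by apply: refl_odd; [case: eqP; lia | lia]. Qed.

Lemma letters_act_odd u : odd_fun (letters_act u).
Proof.
by elim: u => // a u IHu z; rewrite !letters_act_cons IHu letter_act_odd.
Qed.

Lemma letters_act_down (b k : nat) (z : Z) : (0 < b)%N -> 0 < z ->
  letters_act (rev (iota b k)) z =
  if Z.eqb z (Z.of_nat b + 1) then z + Z.of_nat k
  else if Z.ltb (Z.of_nat b + 1) z && Z.leb z (Z.of_nat b + 1 + Z.of_nat k)
       then z - 1 else z.
Proof.
move=> b0 z0; elim: k => [|k IHk].
  rewrite /letters_act /=; case: Z.eqb_spec => h; first by lia.
  by case: Z.ltb_spec => h'; case: Z.leb_spec => /= h''; lia.
rewrite -(addn1 k) iotaD rev_cat letters_act_cat {}IHk letters_act_cons /letter_act.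
have -> : (b + k == 0)%N = false by lia.
rewrite [letters_act [::] _]/=.
case: Z.eqb_spec => h; first by rewrite /refl; refl_cases; lia.
case: Z.ltb_spec => h1; do 2!(case: Z.leb_spec => ?); rewrite /= /refl; refl_cases; lia.
Qed.

Lemma letters_act_up (k : nat) (z : Z) : 2 <= z ->
  letters_act (iota 1 k) z =
  if Z.eqb z (Z.of_nat k + 2) then 2 else if Z.ltb z (Z.of_nat k + 2) then z + 1 else z.
Proof.
elim: k z => [|k IHk] z z2.
  by rewrite /letters_act /=; compare_cases.
rewrite -(addn1 k) iotaD letters_act_cat letters_act_cons [letters_act [::] _]/=
  /letter_act.
have -> : (1 + k == 0)%N = false by lia.
have h : 2 <= refl (Z.of_nat (1 + k) + 1) (Z.of_nat (1 + k) + 2) z by refl_lia.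
rewrite IHk //; move: {h} z z2 => z z2; rewrite /refl; compare_cases.
Qed.

(** The final 0 negates 2; then the letters act on absolute values. *)
Lemma s_word0_act (a : nat) (z : Z) : 2 <= z ->
  letters_act (s_word a 0) z =
  if Z.eqb z 2 then - (Z.of_nat a + 2)
  else if Z.leb z (Z.of_nat a + 2) then z - 1 else z.
Proof.
move=> z2; rewrite /s_word subn0 /= -[in rev _]cat1s -[iota 1 a]/(iota 1 a) rev_cat
  letters_act_cat.
rewrite letters_act_cons [letters_act [::] _]/=.
case: Z.eqb_spec => [->|h].
  have -> : letter_act 0 2 = - 2 by [].
  by rewrite (letters_act_odd _ 2) letters_act_down //; compare_cases.
have -> : letter_act 0 z = z by rewrite /letter_act /=; refl_lia.
rewrite letters_act_down //; last by lia.
by compare_cases.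
Qed.

Lemma s_word_act (a b : nat) (z : Z) : (0 < b <= a)%N -> 0 < z ->
  letters_act (s_word a b) z =
  if Z.eqb z (Z.of_nat b + 1) then Z.of_nat a + 2
  else if Z.ltb (Z.of_nat b + 1) z && Z.leb z (Z.of_nat a + 2) then z - 1 else z.
Proof.
move=> /andP[b0 ba] z0; rewrite /s_word ba letters_act_down //.
have -> : Z.of_nat b + 1 + Z.of_nat (a - b).+1 = Z.of_nat a + 2 by lia.
by case: Z.eqb_spec => // ->; lia.
Qed.

Lemma t_word_act (a b : nat) (z : Z) : (0 < b <= a)%N -> 2 <= z ->
  letters_act (t_word a b) z =
  if Z.eqb z (Z.of_nat b + 2) then - (Z.of_nat a + 2)
  else if Z.ltb (Z.of_nat b + 2) z && Z.leb z (Z.of_nat a + 2) then z - 1 else z.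
Proof.
move=> /andP[b0 ba] z2; rewrite /t_word letters_act_cat.
have -> : rev (iota 0 a.+1) = s_word a 0 by rewrite /s_word subn0.
rewrite letters_act_up // s_word0_act; last by compare_cases.
by compare_cases.
Qed.

(** The product exchanges a block of length M with a block of length k: each
    factor moves one element of the first block across the second one. *)
Lemma s_blocks_act (c k M : nat) (z : Z) : (0 < c)%N -> (0 < k)%N -> 2 <= z ->
  letters_act (flatten [seq s_word (c + k - 1 + r) (c + r) | r <- iota 0 M]) z =
  if Z.leb z (Z.of_nat c) then z
  else if Z.leb z (Z.of_nat c + Z.of_nat M) then z + Z.of_nat k
  else if Z.leb z (Z.of_nat c + Z.of_nat M + Z.of_nat k) then z - Z.of_nat M else z.
Proof.
move=> c0 k0; elim: M z => [|M IHM] z z2.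
  by rewrite /letters_act /=; compare_cases.
rewrite -(addn1 M) iotaD map_cat flatten_cat letters_act_cat /= cats0 add0n.
rewrite s_word_act; [|lia|lia].
rewrite IHM; last by compare_cases.
by compare_cases.
Qed.

Lemma s_blocks0_act (i M : nat) (z : Z) : 2 <= z ->
  letters_act (flatten [seq s_word (i + r) 0 | r <- iota 0 M]) z =
  if Z.leb z (Z.of_nat M + 1) then - (Z.of_nat i + Z.of_nat M + 3 - z)
  else if Z.leb z (Z.of_nat i + Z.of_nat M + 1) then z - Z.of_nat M else z.
Proof.
elim: M z => [|M IHM] z z2.
  by rewrite /letters_act /=; compare_cases.
rewrite -(addn1 M) iotaD map_cat flatten_cat letters_act_cat /= cats0 add0n.
rewrite s_word0_act //; case: Z.eqb_spec => [->|z3].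
  rewrite letters_act_odd IHM; last by lia.
  by compare_cases.
rewrite IHM; last by compare_cases.
by compare_cases.
Qed.

Lemma t_blocks_act (i M : nat) (z : Z) : (0 < i)%N -> 2 <= z ->
  letters_act (flatten [seq t_word (i + r) i | r <- iota 0 M]) z =
  if Z.leb (Z.of_nat i + 2) z && Z.leb z (Z.of_nat i + Z.of_nat M + 1)
  then - (Z.of_nat i + Z.of_nat i + Z.of_nat M + 3 - z) else z.
Proof.
move=> i0; elim: M z => [|M IHM] z z2.
  by rewrite /letters_act /=; compare_cases.
rewrite -(addn1 M) iotaD map_cat flatten_cat letters_act_cat /= cats0 add0n.
rewrite t_word_act //; last by lia.
case: Z.eqb_spec => [->|z3].
  rewrite letters_act_odd IHM; last by lia.
  by compare_cases.
rewrite IHM; last by compare_cases.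
by compare_cases.
Qed.

End Words.

(** * The morphism phi and the maps phi^+ and phi^- *)

Section TypeB.

Local Open Scope group_scope.

Variable n : nat.
Local Notation evb := (cox_ev (@coxB n)).
Local Notation evd := (cox_ev (@coxD n)).
Local Notation N := (Z.of_nat n + 2)%Z.
Implicit Types (w : WB n) (a : 'I_n.+1) (u v : seq 'I_n.+1).

Definition bperm w : Z -> Z := act (@loB n) (@hiB n) w.

Let rd := root_datumB n.

Lemma bperm_ev_cons a u (p : Z) :
  bperm (evb (a :: u)) p = letter_act a (bperm (evb u) p).
Proof. by rewrite /bperm !(act_ev rd). Qed.

Lemma bperm_nil (p : Z) : bperm (evb [::]) p = p.
Proof. by rewrite /bperm (act_ev rd). Qed.

Lemma bperm_odd w : odd_fun (bperm w). Proof. exact: (act_odd rd). Qed.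

Lemma bperm_inj w : injective (bperm w). Proof. exact: (act_inj rd). Qed.

Lemma bpermVK w (p : Z) : bperm w (bperm w^-1 p) = p. Proof. exact: (actVK rd). Qed.

Lemma bperm_range w (p : Z) : (2 <= Z.abs p -> 2 <= Z.abs (bperm w p))%Z /\
  (Z.abs p <= N -> Z.abs (bperm w p) <= N)%Z.
Proof.
rewrite -[w]cox_ev_repr; elim: (repr w) p => [|a u IHu] p; first by rewrite bperm_nil.
rewrite bperm_ev_cons /letter_act; have := IHu p; move: (bperm _ p) => q.
have : a <= n by rewrite -ltnS ltn_ord.
by case: eqP => a0 an; rewrite /refl; refl_cases; lia.
Qed.

Lemma bperm_evB (u : seq nat) (p : Z) : all (fun c => c <= n) u ->
  bperm (evB n u) p = letters_act u p.
Proof.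
rewrite /evB; elim: u => [|c u IHu] /=; first by rewrite bperm_nil.
by case/andP=> cn un; rewrite bperm_ev_cons IHu // inordK.
Qed.

Lemma toD_act e a : a != ord0 ->
  loD (toD e a) = (Z.of_nat a + 1)%Z /\ hiD (toD e a) = (Z.of_nat a + 2)%Z.
Proof.
rewrite /toD; case: unliftP => [k ->|->]; last by rewrite eqxx.
by rewrite /loD /hiD lift0; lia.
Qed.

Lemma toD0 e : toD e (ord0 : 'I_n.+1) = inl e.
Proof. by rewrite /toD unlift_none. Qed.

(** The product of 0^+ and 0^- changes the signs of both 1 and 2. *)
Lemma sperm_phi w (p : Z) : (2 <= Z.abs p)%Z -> sperm (phi w) p = bperm w p.
Proof.
rewrite -[w]cox_ev_repr phi_cox_ev => p2.
elim: (repr w) => [|a u IHu]; first by rewrite bperm_nil sperm1.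
rewrite bperm_ev_cons -IHu /phi_word /= -/(phi_word u) cox_ev_cat spermM.
have : (2 <= Z.abs (sperm (evd (phi_word u)) p))%Z by rewrite IHu;
  case: (bperm_range (evb u) p); lia.
move: (sperm _ p) => q q2; rewrite /phi_letter /letter_act.
have [->|a0] := eqVneq a ord0.
  by rewrite !sperm_ev_cons sperm1 /loD /hiD /= /refl; refl_cases; lia.
have [la ha] := toD_act true a0; rewrite sperm_ev_cons sperm1 la ha.
by rewrite -(inj_eq val_inj) /= in a0; rewrite (negbTE a0).
Qed.

Lemma sperm_phi1 w : Z.abs (sperm (phi w) 1) = 1%Z.
Proof.
rewrite -[w]cox_ev_repr phi_cox_ev.
elim: (repr w) => [|a u IHu]; first by rewrite sperm1.
rewrite /phi_word /= -/(phi_word u) cox_ev_cat spermM.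
move: (sperm _ 1%Z) IHu => q q1; rewrite /phi_letter.
have [_|a0] := eqVneq a ord0.
  by rewrite !sperm_ev_cons sperm1 /loD /hiD /= /refl; refl_cases; lia.
have [la ha] := toD_act true a0; rewrite sperm_ev_cons sperm1 la ha.
rewrite -(inj_eq val_inj) /= in a0.
by rewrite /refl; refl_cases; lia.
Qed.

Lemma bperm_asc_ord0 w : ~~ right_descent ord0 w -> (0 < bperm w 2)%Z.
Proof.
move=> /(act_asc rd) h; have {h} : (bperm w (-2) < bperm w 2)%Z by exact: h.
by rewrite (bperm_odd w 2%Z); lia.
Qed.

Lemma bperm_asc w (p : Z) (c : nat) : (forall a, a <> c :> nat -> ~~ right_descent a w) ->
  (2 <= p < N -> p <> Z.of_nat c + 1 -> bperm w p < bperm w (p + 1))%Z.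
Proof.
move=> wc hp pc; have h : Z.to_nat (p - 1) < n.+1 by lia.
have := act_asc rd (wc (Ordinal h) _); rewrite /loB /hiB /=.
have -> : (Z.to_nat (p - 1) == 0) = false by lia.
have -> : (Z.of_nat (Z.to_nat (p - 1)) + 1 = p)%Z by lia.
have -> : (Z.of_nat (Z.to_nat (p - 1)) + 2 = p + 1)%Z by lia.
by apply; lia.
Qed.

Lemma bperm_asc0 w (c : nat) : (forall a, a <> c :> nat -> ~~ right_descent a w) ->
  0 < c -> (0 < bperm w 2)%Z.
Proof.
by move=> wc c0; apply: bperm_asc_ord0; apply: wc; rewrite /=; lia.
Qed.

(** The relation between the signed permutations t of a reduced word in type B and
    s of the same word with alternating letters 0^+ and 0^-, the leftmost one
    having sign e. Each of the z letters 0 acts in type B on the value 2 of a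
    position of the tail, which becomes negative. In type D it gives to this
    position the value 1 or -1 instead, and changes the previous value 1 or -1
    of the tail to -2, because the signs alternate. The rightmost letter 0 also
    moves the value at the position 1 to 2 or -2; from then on this position
    carries the largest absolute value among the negative values of t. *)
Record alternating_form (J1 : Z) (e : bool) (z : nat) (t s : Z -> Z) : Prop :=
  AlternatingForm {
  af_range : (J1 + Z.of_nat z <= N)%Z;
  af_body : forall p, (2 <= p <= J1 -> 0 < t p)%Z;
  af_neg : forall p, (J1 < p <= J1 + Z.of_nat z -> t p < 0)%Z;
  af_pos : forall p, (J1 + Z.of_nat z < p <= N -> 0 < t p)%Z;
  af_first : s 1%Z = if z == 0 then 1%Z
    else if e (+) odd z.-1 then (- t (J1 + 1))%Z else t (J1 + 1)%Z;
  af_same : forall p, (2 <= p <= J1 \/ J1 + Z.of_nat z < p <= N -> s p = t p)%Z;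
  af_shift : forall p, (J1 < p < J1 + Z.of_nat z -> s p = t (p + 1))%Z;
  af_last : 0 < z -> s (J1 + Z.of_nat z)%Z = if e then 1%Z else (-1)%Z
}.

(** Induction on the word, whose suffixes have no right descent but j either. A
    letter 0 on the left of a reduced word acts on the value 2 of a position p0,
    which must be the first position of the tail with a positive value, since
    the values stay increasing on the body and on the tail. *)
Lemma alternate_form (j : nat) (e : bool) v : 0 < j <= n -> reduced (@coxB n) v ->
  (forall a, a <> j :> nat -> ~~ right_descent a (evb v)) ->
  exists z, alternating_form (Z.of_nat j + 1) e z
    (bperm (evb v)) (sperm (evd (alternate e v))).
Proof.
move=> hj; elim: v e => [|a v IHv] e rv vj.
  exists 0; split=> [|p hp|p hp|p hp||p hp|p hp|//]; rewrite ?bperm_nil ?sperm1 //; lia.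
have [rv' va] := reduced_behead rv.
have vj' (b : 'I_n.+1) : b <> j :> nat -> ~~ right_descent b (evb v).
  by move=> /vj; apply: contra; exact: right_descent_behead.
have [z [fr fb fn fp f1 fs fsh fl]] := IHv (if a == ord0 then ~~ e else e) rv' vj'.
have t2 (p : Z) : (2 <= Z.abs p -> 2 <= Z.abs (bperm (evb v) p))%Z.
  by case: (bperm_range (evb v) p).
have t'E p : bperm (evb (a :: v)) p = letter_act a (bperm (evb v) p) by exact:
  bperm_ev_cons.
have s'E p : sperm (evd (alternate e (a :: v))) p = refl (loD (toD e a)) (hiD (toD e a))
    (sperm (evd (alternate (if a == ord0 then ~~ e else e) v)) p).
  by rewrite /= sperm_ev_cons.
have [a0|a0] := eqVneq a ord0; last first.
  have [la ha] := toD_act e a0; rewrite (negbTE a0) in s'E fs fsh fl f1.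
  rewrite la ha in s'E; rewrite -(inj_eq val_inj) /= in a0.
  rewrite /letter_act (negbTE a0) in t'E.
  have sgn (q : Z) : (2 <= Z.abs q ->
    0 < refl (Z.of_nat a + 1) (Z.of_nat a + 2) q <-> 0 < q)%Z.
    by rewrite /refl; refl_cases; lia.
  exists z; split=> [|p hp|p hp|p hp||p hp|p hp|z0].
  - exact: fr.
  - by rewrite t'E; apply/sgn; [apply: t2; lia|exact: fb].
  - by rewrite t'E; have := fn p hp; have := t2 p; have := sgn (bperm (evb v) p); 
      rewrite /refl; refl_cases; lia.
  - by rewrite t'E; apply/sgn; [apply: t2; lia|exact: fp].
  - rewrite s'E t'E f1; case: eqP => z0; first by refl_lia.
    by case: ifP => // _; rewrite refl_odd //; lia.
  - by rewrite s'E t'E fs.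
  - by rewrite s'E t'E fsh.
  - by rewrite s'E fl //; case: (e); refl_lia.
rewrite {}a0 eqxx toD0 in rv vj va t'E s'E f1 fs fsh fl *.
rewrite /loD /hiD in s'E.
set c := (if e then 1 else -1)%Z.
have {}s'E p : sperm (evd (alternate e (ord0 :: v))) p =
    refl c 2 (sperm (evd (alternate (~~ e) v)) p) by rewrite s'E /c; case: (e).
have {}t'E p : bperm (evb (ord0 :: v)) p = refl (-2) 2 (bperm (evb v) p) by rewrite t'E.
have hc : Z.abs c = 1%Z by rewrite /c; case: (e).
pose p0 := bperm (evb v)^-1 2; have tp0 : bperm (evb v) p0 = 2%Z by exact: bpermVK.
have p0pos : (0 < p0)%Z.
  by apply: bperm_asc_ord0; rewrite right_descentV.
have p0range : (2 <= p0 <= N)%Z.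
  by have [h1 h2] := bperm_range (evb v)^-1 2%Z; rewrite -/p0 in h1 h2; lia.
have t'p0 : bperm (evb (ord0 :: v)) p0 = (-2)%Z by rewrite t'E tp0.
have body' p : (2 <= p <= Z.of_nat j + 1)%Z -> (0 < bperm (evb (ord0 :: v)) p)%Z.
  move=> hp; have h0 := bperm_asc0 vj ltac:(lia).
  have inc x : (2 <= x < Z.of_nat j + 1)%Z ->
      (bperm (evb (ord0 :: v)) x < bperm (evb (ord0 :: v)) (x + 1))%Z.
    by move=> hx; apply: (bperm_asc vj); lia.
  by have := increasing_gap inc (p := 2%Z) (q := p) ltac:(lia) ltac:(lia); lia.
have inc x : (Z.of_nat j + 1 < x < N)%Z ->
    (bperm (evb (ord0 :: v)) x < bperm (evb (ord0 :: v)) (x + 1))%Z.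
  by move=> hx; apply: (bperm_asc vj); lia.
have p0tail : (Z.of_nat j + 1 < p0)%Z.
  have [//|h] : (Z.of_nat j + 1 < p0 \/ p0 <= Z.of_nat j + 1)%Z by lia.
  by have := body' p0 ltac:(lia); lia.
have p0z : (Z.of_nat j + 1 + Z.of_nat z < p0)%Z.
  have [//|h] : (Z.of_nat j + 1 + Z.of_nat z < p0 \/ p0 <= Z.of_nat j + 1 + Z.of_nat
    z)%Z by lia.
  by have := fn p0 ltac:(lia); lia.
have ne p : (2 <= p <= N)%Z -> p <> p0 -> (3 <= Z.abs (bperm (evb v) p))%Z.
  move=> hp pp0; have h := t2 p ltac:(lia).
  have h1 : bperm (evb v) p <> 2%Z by rewrite -tp0 => /bperm_inj.
  have h2 : bperm (evb v) p <> (-2)%Z.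
    rewrite -[(-2)%Z]/(- (2))%Z -tp0 -bperm_odd => /bperm_inj; lia.
  by lia.
have t'same p : (2 <= p <= N)%Z -> p <> p0 -> bperm (evb (ord0 :: v)) p = bperm (evb v) p.
  by move=> hp pp0; have := ne p hp pp0; rewrite t'E; refl_lia.
(* Otherwise the next position of the tail would keep a positive value, before *)
(* the value -2 at p0.                                                         *)
have ep0 : p0 = (Z.of_nat j + 1 + Z.of_nat z.+1)%Z.
  have [//|h] : p0 = (Z.of_nat j + 1 + Z.of_nat z.+1)%Z \/
    (Z.of_nat j + 1 + Z.of_nat z.+1 < p0)%Z by lia.
  have := fp (Z.of_nat j + 1 + Z.of_nat z.+1)%Z ltac:(lia).
  rewrite -t'same; [|lia|lia].
  have := increasing_gap (a := (Z.of_nat j + 2)%Z) (c := N)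
    (fun x hx => inc x ltac:(lia)) (p := (Z.of_nat j + 1 + Z.of_nat z.+1)%Z) (q := p0)
    ltac:(lia) ltac:(lia).
  by lia.
have s'same p q : sperm (evd (alternate (~~ e) v)) p = q -> (3 <= Z.abs q)%Z ->
    sperm (evd (alternate e (ord0 :: v))) p = q.
  by move=> e1 h; rewrite s'E e1; refl_lia.
exists z.+1; split=> [|p hp|p hp|p hp||p hp|p hp|_].
- by lia.
- exact: body'.
- have [->|pp0] := Z.eq_dec p p0; first by rewrite t'p0.
  by rewrite t'same //; [apply: fn; lia|lia].
- by rewrite t'same; [apply: fp; lia|lia|lia].
- rewrite s'E f1 /=; case: (posnP z) => [z0|z0].
    have -> : (Z.of_nat j + 1 + 1)%Z = p0 by lia.
    by rewrite t'p0 z0 /= addbF /c; case: (e).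
  have h := ne (Z.of_nat j + 1 + 1)%Z ltac:(lia) ltac:(lia).
  rewrite t'same; [|lia|lia].
  rewrite -{2}(prednK z0) /= addbN -addNb.
  by case: ifP => _; refl_lia.
- by apply: s'same; rewrite ?t'same ?fs //; try apply: ne; lia.
- have [h|h] : (p < Z.of_nat j + 1 + Z.of_nat z \/ p = Z.of_nat j + 1 + Z.of_nat z)%Z
  by lia.
    by apply: s'same; rewrite ?t'same ?fsh //; try apply: ne; lia.
  have -> : (p + 1)%Z = p0 by lia.
  rewrite t'p0 s'E h fl; last by lia.
  by rewrite /c; case: (e).
- by rewrite -ep0 s'E fs ?tp0 /c; [case: (e)|lia].
Qed.

End TypeB.

(** * The join-irreducible elements *)

Section Elements.

Local Open Scope group_scope.

Variables n i j : nat.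
Hypotheses (i0 : 1 <= i) (hij : i <= j) (jn : j <= n).
Local Notation I1 := (Z.of_nat i + 1)%Z.
Local Notation J1 := (Z.of_nat j + 1)%Z.
Local Notation PI := (predC1 (midD n i)).
Local Notation PJ := (predC1 (midD n j)).
Local Notation dmin := (double_min PI PJ).

Let hi : 1 <= i <= n. Proof. by lia. Qed.
Let hj : 1 <= j <= n. Proof. by lia. Qed.

Lemma s_word_le a b c : c \in s_word a b -> c <= maxn a b.
Proof. by rewrite /s_word; case: ifP; rewrite ?mem_rev mem_iota; lia. Qed.

Lemma t_word_le a b c : c \in t_word a b -> c <= maxn a b.
Proof. by rewrite /t_word mem_cat mem_rev !mem_iota; lia. Qed.

Lemma bo_word_le k : 1 <= k <= n.+1 - j -> all (fun c => c <= n) (bo_word i j k).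
Proof.
move=> hk; apply/allP => c; rewrite /bo_word; case: ifP => ki.
  by case/flattenP => w /mapP [r + ->] /s_word_le; rewrite mem_iota; lia.
rewrite mem_cat => /orP[] /flattenP [w /mapP [r + ->] /s_word_le]; rewrite mem_iota; lia.
Qed.

Lemma bx_word_le k : 1 <= k <= n.+1 - j -> all (fun c => c <= n) (bx_word i j k).
Proof.
move=> hk; apply/allP => c; rewrite /bx_word mem_cat => /orP[].
  by case/flattenP => w /mapP [r + ->] /t_word_le; rewrite mem_iota; lia.
by case/flattenP => w /mapP [r + ->] /s_word_le; rewrite mem_iota; lia.
Qed.

Lemma bperm_bo_A k (p : Z) : 1 <= k <= minn i (n.+1 - j) -> (2 <= p)%Z ->
  bperm (bo n i j k) p =
  (if Z.leb p (I1 - Z.of_nat k) then p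
   else if Z.leb p J1 then p + Z.of_nat k
   else if Z.leb p (J1 + Z.of_nat k) then p - J1 + I1 - Z.of_nat k else p)%Z.
Proof.
move=> hk p2; rewrite /bo bperm_evB; last by apply: bo_word_le; lia.
rewrite /bo_word; have -> : k <= i by lia.
have -> : [seq s_word (i + r) (i - k + 1 + r) | r <- iota 0 (k + j - i)] =
    [seq s_word (i - k + 1 + k - 1 + r) (i - k + 1 + r) | r <- iota 0 (k + j - i)].
  by apply: eq_map => r; congr s_word; lia.
rewrite s_blocks_act //; [|lia|lia].
by compare_cases.
Qed.

Lemma bperm_bo_B k (p : Z) : i < k <= n.+1 - j -> (2 <= p)%Z ->
  bperm (bo n i j k) p =
  (if Z.leb p J1 then p + Z.of_nat k
   else if Z.leb p (J1 + Z.of_nat (k - i)) then - (J1 + Z.of_nat k + 2 - p)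
   else if Z.leb p (J1 + Z.of_nat k) then p - J1 + I1 - Z.of_nat k else p)%Z.
Proof.
move=> hk p2; rewrite /bo bperm_evB; last by apply: bo_word_le; lia.
rewrite /bo_word; have -> : (k <= i) = false by lia.
have -> : [seq s_word (k + r) (r + 1) | r <- iota 0 j] =
    [seq s_word (1 + k - 1 + r) (1 + r) | r <- iota 0 j].
  by apply: eq_map => r; congr s_word; lia.
rewrite letters_act_cat s_blocks_act //; [|lia].
rewrite s_blocks0_act; last by compare_cases.
by compare_cases.
Qed.

Lemma bperm_bx k (p : Z) : 1 <= k <= n.+1 - j -> (2 <= p)%Z ->
  bperm (bx n i j k) p =
  (if Z.leb p I1 then p
   else if Z.leb p J1 then p + Z.of_nat k
   else if Z.leb p (J1 + Z.of_nat k) then p - J1 - 1 - I1 - Z.of_nat k else p)%Z.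
Proof.
move=> hk p2; rewrite /bx bperm_evB; last exact: bx_word_le.
rewrite /bx_word.
have -> : [seq s_word (i + k + r) (i + 1 + r) | r <- iota 0 (j - i)] =
    [seq s_word (i + 1 + k - 1 + r) (i + 1 + r) | r <- iota 0 (j - i)].
  by apply: eq_map => r; congr s_word; lia.
rewrite letters_act_cat s_blocks_act //; [|lia|lia].
rewrite t_blocks_act //; last by compare_cases.
by compare_cases.
Qed.

Lemma bo_right_descent k : 1 <= k <= n.+1 - j ->
  forall a : 'I_n.+1, a <> j :> nat -> ~~ right_descent a (bo n i j k).
Proof.
move=> hk a aj; apply/negP => /(act_desc (root_datumB n)).
rewrite -/(bperm (bo n i j k)) /loB /hiB.
have : a <= n by rewrite -ltnS ltn_ord.
move=> an; case: eqP => [-> | a0].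
  rewrite -[(-2)%Z]/(- (2))%Z bperm_odd.
  have [h|h] := leqP k i.
    by rewrite bperm_bo_A; compare_cases.
  by rewrite bperm_bo_B; compare_cases.
have [h|h] := leqP k i.
  by rewrite !bperm_bo_A; compare_cases.
by rewrite !bperm_bo_B; compare_cases.
Qed.

Lemma phi_pm_form e k : 1 <= k <= n.+1 - j -> exists z,
  alternating_form n J1 e z (bperm (bo n i j k)) (sperm (phi_pm e (bo n i j k))).
Proof.
move=> hk; rewrite /phi_pm /reduced_word; case: cid => u [/= ru eu].
have := alternate_form e hj ru; rewrite eu; apply.
exact: bo_right_descent.
Qed.

Lemma phi_bo_phi_pm e k : 1 <= k <= minn i (n.+1 - j) ->
  phi (bo n i j k) = phi_pm e (bo n i j k).
Proof.
move=> hk; have [z [fr fb fn fp f1 fs fsh fl]] := @phi_pm_form e k ltac:(lia).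
have z0 : z = 0.
  case: z fr fn {fp f1 fs fsh fl} => // z fr fn.
  by have := fn (J1 + 1)%Z ltac:(lia); rewrite bperm_bo_A //; compare_cases.
rewrite {}z0 /= in fr fn fp f1 fs fsh fl.
apply: sperm_agree => p hp; have [->|p2] : (p = 1 \/ 2 <= p)%Z by lia.
  by right; rewrite f1 sperm_phi1.
by left; rewrite fs ?sperm_phi //; lia.
Qed.

(** There is an element of P with the parameters of the label, and its normal form
    agrees with the signed permutation computed from the words, up to the sign
    of the value 1. *)
Lemma label_dmin lb : valid_label n i j lb ->
  [/\ dmin (d_elt n i j lb), bnum i j (d_elt n i j lb) = label_b i lb,
   mnum i j (d_elt n i j lb) = label_m lb &
   label_m lb = label_b i lb + i.+1 ->
     (sperm (d_elt n i j lb) 1 < 0)%Z <-> label_neg i lb].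
Proof.
move=> v.
have bm : label_b i lb <= label_m lb <= n.+1 - j by case: lb v => [k|e k|k] /=; lia.
have mi : label_m lb <= label_b i lb + i.+1 by case: lb v {bm} => [k|e k|k] /=; lia.
have [z [zm eb em es]] := dmin_ex hi hj hij (label_neg i lb) bm mi.
suff -> : d_elt n i j lb = z by [].
have zf := dmin_normal_form hi hj zm; rewrite {}eb {}em in zf.
case: zf => _ _ _ zbody zfirst zfirst' zshift zneg zmid zpos.
apply: sperm_agree => p hp.
case: lb v bm mi es zbody zfirst zfirst' zshift zneg zmid zpos => [k|e k|k] /= v bm mi es
  zbody zfirst zfirst' zshift zneg zmid zpos.
- have [->|p2] : (p = 1 \/ 2 <= p)%Z by lia.
    by right; split; [exact: sperm_phi1|apply: zfirst; lia].
  left; rewrite sperm_phi; last by lia.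
  rewrite bperm_bo_A; [|lia|lia].
  have := zbody p; have := zshift p; have := zmid p; have := zpos p.
  by compare_cases.
- have [z' [fr fb fn fp f1 fs fsh fl]] := @phi_pm_form e k ltac:(lia).
  have tau := bperm_bo_B v.
  (* The number of letters 0 is that of the negative values in type B. *)
  have ez' : z' = k - i.
    have [h|[h|h]] : z' = k - i \/ z' < k - i \/ k - i < z' by lia.
    + by [].
    + have := fp (J1 + Z.of_nat z' + 1)%Z ltac:(lia).
      by rewrite tau; [compare_cases|lia].
    + have := fn (J1 + Z.of_nat z')%Z ltac:(lia).
      by rewrite tau; [compare_cases|lia].
  have [->|p2] : (p = 1 \/ 2 <= p)%Z by lia.
    left; have := zfirst' ltac:(lia); have := es ltac:(lia).
    rewrite f1; have -> : (z' == 0) = false by lia.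
    have -> : z'.-1 = k - i.+1 by lia.
    have -> : bperm (bo n i j k) (J1 + 1) = (- (1 + Z.of_nat k))%Z.
      by rewrite tau; [compare_cases|lia].
    by case: (e (+) _) => /=; lia.
  have [h|[h|[h|h]]] : (p <= J1 \/ J1 < p < J1 + Z.of_nat z' \/
     p = J1 + Z.of_nat z' \/ J1 + Z.of_nat z' < p)%Z by lia.
  + left; rewrite fs; last by lia.
    rewrite tau; last by lia.
    by have := zshift p; compare_cases.
  + left; rewrite fsh; last by lia.
    rewrite tau; last by lia.
    by have := zneg p; compare_cases.
  + right; rewrite {1}h fl; last by lia.
    by have := zmid p; case: (e); lia.
  + left; rewrite fs; last by lia.
    rewrite tau; last by lia.
    by have := zmid p; have := zpos p; compare_cases.
- have [->|p2] : (p = 1 \/ 2 <= p)%Z by lia.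
    by right; split; [exact: sperm_phi1|apply: zfirst; lia].
  left; rewrite sperm_phi; last by lia.
  rewrite bperm_bx; [|lia|lia].
  have := zbody p; have := zshift p; have := zneg p; have := zpos p.
  by compare_cases.
Qed.

End Elements.

Theorem proposition5p32 (n i j : nat)
    (hn : 2 <= n) (hi : 1 <= i) (hij : i <= j) (hj : j <= n) :
  [/\ forall k : nat, 1 <= k <= minn i (n.+1 - j) ->
        phi (bo n i j k) = phi_pm true (bo n i j k) /\
        phi (bo n i j k) = phi_pm false (bo n i j k),
      forall w : WD n,
        JI (midD n i) (midD n j) w <->
        exists l : label, valid_label n i j l /\ w = d_elt n i j l
    & forall l l' : label, valid_label n i j l -> valid_label n i j l' ->
        (bruhat (d_elt n i j l) (d_elt n i j l') <->
         clos_refl_trans label (generating n i j) l l')].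
Proof.
have hi' : 1 <= i <= n by lia.
have hj' : 1 <= j <= n by lia.
have dm := label_dmin hi hij hj.
split=> [k hk|w|lb lb' v v'].
- by split; exact: phi_bo_phi_pm.
- split=> [wJ|[lb [v ->]]].
    have [wm m0] := join_irreducible_dmin hi' hj' hij wJ.
    have [bm mi] := dmin_bounds hi' hj' hij wm.
    have par := join_irreducible_parameters hi' hj' hij wJ.
    have find lb : valid_label n i j lb -> label_b i lb = bnum i j w ->
        label_m lb = mnum i j w ->
        (mnum i j w = bnum i j w + i.+1 -> (sperm w 1 < 0)%Z <-> label_neg i lb) ->
        exists l : label, valid_label n i j l /\ w = d_elt n i j l.
      move=> v eb em es; exists lb; split=> //; have [dmm db dM ds] := dm lb v.
      apply: (dmin_eq hi' hj') => //; rewrite ?db ?dM //.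
      by move=> c; rewrite es // ds //; lia.
    case: par => [[b0 mi']|bm'|c].
    + by apply: (find (TypeOA (mnum i j w))) => /=; lia.
    + by apply: (find (TypeX (mnum i j w))) => /=; lia.
    + have sgn : exists e, (sperm w 1 < 0)%Z <->
          label_neg i (TypeOB e (mnum i j w)).
        have [h|h] : (sperm w 1 < 0 \/ 0 <= sperm w 1)%Z by lia.
          exists (odd (mnum i j w - i.+1)); by split=> // _; rewrite /= addbb.
        by exists (~~ odd (mnum i j w - i.+1)); rewrite /= addNb addbb; split=> //; lia.
      have [e he] := sgn.
      by apply: (find (TypeOB e (mnum i j w))) => //=; lia.
  have [dmm db dM _] := dm lb v.
  apply: (dmin_join_irreducible hi' hj' hij) => //; rewrite ?db ?dM.
    by case: lb v {dmm db dM} => [k|e k|k] /=; lia.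
  by case: lb v {dmm db dM} => [k|e k|k] /= v;
    [constructor 1|constructor 3|constructor 2]; lia.
- have [m1 b1 M1 s1] := dm lb v; have [m2 b2 M2 s2] := dm lb' v'.
  have bP := dmin_bruhat hi' hj' hij m1 m2; rewrite b1 b2 M1 M2 in bP.
  split=> [/bP [hb hm hs]|h].
    apply: label_le_generating => //; split=> // eb em c.
    have := hs eb em c; rewrite s1 // s2; last by lia.
    by case: (label_neg i lb); case: (label_neg i lb') => // -[h1 h2];
      [have := h1 isT | have := h2 isT].
  have [hb hm hs] := generating_label_le hi hij hj h; apply/bP; split=> // eb em c.
  by rewrite s1 // s2; [rewrite hs|lia].
Qed.
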